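(* Let $\mathcal{I}$ be a finite category. Then the extended $L^2$-Euler characteristic $\chi^{(2)}_{\mathrm{ex}}(\mathrm{Sd}(\mathcal{I})^{\mathrm{op}})$ of the opposite category of the barycentric subdivision of $\mathcal{I}$ is defined if and only if the series Euler characteristic $\chi_{\sum}(\mathcal{I})$ exists, in which case $$\chi_{\sum}(\mathcal{I})=\chi^{(2)}_{\mathrm{ex}}(\mathrm{Sd}(\mathcal{I})^{\mathrm{op}}).$$
   Context: A finite category has finitely many objects and morphisms. Nerve. For a natural number $n\ge 0$, $[n]=\{0,1,\dots,n\}$ is the poset with the usual order. For a small category $\mathcal{J}$, $N_n(\mathcal{J})$ is the set of chains $x_0\xrightarrow{f_1}x_1\to\cdots\xrightarrow{f_n}x_n$ in $\mathcal{J}$, i.e. functors $[n]\to\mathcal{J}$. The set of non-degenerate chains $\overline{N_n}(\mathcal{J})$ consists of those chains in which no $f_i$ is an identity, with $\overline{N_0}(\mathcal{J})=N_0(\mathcal{J})=\mathrm{Ob}(\mathcal{J})$. Barycentric subdivision. $\mathrm{Sd}(\mathcal{J})$ is the small category whose set of objects is $\coprod_{n\ge0}\overline{N_n}(\mathcal{J})$. An object $X$ of length $q_X$ is regarded as a functor $X:[q_X]\to\mathcal{J}$. The set of morphisms from $X$ to $Y$ is the quotient of the set of order-preserving maps $f:[q_X]\to[q_Y]$ with $Y\circ f=X$ by the equivalence relation generated by: $f\sim g$ if for every $0\le i\le q_X$ the morphism $Y(\min\{f(i),g(i)\}\to\max\{f(i),g(i)\})$ is an identity. Composition is induced by composition of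 order-preserving maps. Series Euler characteristic. For a formal power series $f(t)\in\mathbb{Z}[[t]]$, if there is a rational function $g(t)/h(t)\in\mathbb{Q}(t)$ with $f(t)=g(t)/h(t)$ in $\mathbb{Q}((t))$ and $h(-1)\neq0$, set $f|_{t=-1}=g(-1)/h(-1)\in\mathbb{Q}$. For a finite category $\mathcal{I}$, let $f_{\mathcal{I}}(t)=\sum_{n=0}^\infty\#\overline{N_n}(\mathcal{I})\,t^n$ and $\chi_{\sum}(\mathcal{I})=f_{\mathcal{I}}(t)|_{t=-1}$, if this exists. $L^2$-invariants. $\mathbb{C}\text{-vect}$ is the category of all complex vector spaces and $\mathrm{Func}(\mathcal{J}^{\mathrm{op}},\mathbb{C}\text{-vect})$ is the abelian category of functors; $\underline{\mathbb{C}}$ is the constant functor with value $\mathbb{C}$. For an object $x$ of $\mathcal{J}$, the splitting functor $S_x:\mathrm{Func}(\mathcal{J}^{\mathrm{op}},\mathbb{C}\text{-vect})\to\mathrm{Func}(\mathrm{Aut}(x)^{\mathrm{op}},\mathbb{C}\text{-vect})$ sends $F$ to the cokernel $$S_xF=\mathrm{Coker}\Big(\bigoplus_{u}F(u^{\mathrm{op}}):\bigoplus_{u}F(y)\longrightarrow F(x)\Big),$$ where $u:x\to y$ runs over all non-invertible morphisms of $\mathcal{J}$ with source $x$, with the induced right action of $\mathrm{Aut}(x)$; on natural transformations it is induced by the universal property of cokernels. Write $\mathbb{C}[x]=\mathbb{C}[\mathrm{Aut}(x)]$ for the group ring and $\mathcal{N}(x)=\mathcal{N}(\mathrm{Aut}(x))$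 for the group von Neumann algebra of the discrete group $\mathrm{Aut}(x)$ (it is $\mathbb{C}[\mathrm{Aut}(x)]$ if $\mathrm{Aut}(x)$ is finite). Let $\dim_{\mathcal{N}(G)}$ be the (Lück extended) von Neumann dimension, defined on all algebraic $\mathcal{N}(G)$-modules with values in $[0,\infty]$; for a finite group $G$ it equals $\frac{1}{\#G}\dim_{\mathbb{C}}$. For a chain complex $C_*$ of $\mathcal{N}(G)$-modules set $b^{(2)}_p(C_* )=\dim_{\mathcal{N}(G)}(H_p(C_* ))$. Extended $L^2$-Euler characteristic. A small category $\mathcal{J}$ is of type extended $(L^2)$ if for some projective resolution $P_*$ of $\underline{\mathbb{C}}$ in $\mathrm{Func}(\mathcal{J}^{\mathrm{op}},\mathbb{C}\text{-vect})$: for every $n\ge0$ the sum $$h^{(2)}_n(\mathcal{J})=\sum_{[x]\in\mathrm{iso}(\mathcal{J})}b^{(2)}_n(S_xP_*\otimes_{\mathbb{C}[x]}\mathcal{N}(x))$$ over isomorphism classes of objects converges (is finite); the complex power series $f^{(2)}_{\mathcal{J}}(z)=\sum_{n=0}^\infty h^{(2)}_n(\mathcal{J})z^n$ has nonzero radius of convergence $\rho$; and there exist $\varepsilon\in(1,\infty]$ and a function $g$ such that, with $U(0;r)$ denoting the open disc of radius $r$ centred at $0$ (all of $\mathbb{C}$ if $r=\infty$), $g$ has only finitely many poles in $U(0;\varepsilon)$, none of them at $-1$, $g$ is holomorphic on $U(0;\varepsilon)$ away from its poles, and $g(z)=f^{(2)}_{\mathcal{J}}(z)$ on $U(0;\min\{\rho,\varepsilon\})$.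 In that case the extended $L^2$-Euler characteristic of $\mathcal{J}$ is defined, and it is $\chi^{(2)}_{\mathrm{ex}}(\mathcal{J})=g(-1)$. *)

(* Defs.v *)
From HB Require Import structures.
From mathcomp Require Import all_boot all_order all_algebra.
From mathcomp Require Import all_classical all_reals all_analysis.
From mathcomp Require Import finmap complex.
From mathcomp.multinomials Require Import freeg.
From mathcomp Require Import lra.
From Stdlib Require Import Relation_Operators.

Set Implicit Arguments.
Unset Strict Implicit.
Unset Printing Implicit Defensive.

Import Order.TTheory GRing.Theory Num.Theory numFieldNormedType.Exports.
Import Normc.

Local Open Scope classical_set_scope.
Local Open Scope quotient_scope.
Local Open Scope ring_scope.

Record category := Category {
  ob :> Type;
  hom : ob -> ob -> Type;
  idm : forall x, hom x x;
  cmp : forall x y z, hom y z -> hom x y -> hom x z;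
  cmp1m : forall x y (f : hom x y), cmp (idm y) f = f;
  cmpm1 : forall x y (f : hom x y), cmp f (idm x) = f;
  cmpA : forall x y z t (h : hom z t) (g : hom y z) (f : hom x y),
    cmp h (cmp g f) = cmp (cmp h g) f }.

Arguments hom {c} _ _.
Arguments idm {c} _.
Arguments cmp {c x y z} _ _.

(* [is_id f] typechecks although the endpoints of [f] need not be
   syntactically equal: it says that they are equal and that [f] is the
   identity. *)
Inductive is_id (C : category) (x : C) : forall y : C, hom x y -> Prop :=
  IsId : is_id (idm x).

Definition op_cat (C : category) : category :=
  @Category C (fun x y => @hom C y x) (@idm C) (fun x y z g f => cmp f g)
    (fun x y f => cmpm1 f) (fun x y f => cmp1m f)
    (fun x y z t h g f => esym (cmpA f g h)).

Definition invertible (C : category) (x y : C) (f : hom x y) : Prop :=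
  exists g : hom y x, cmp g f = idm x /\ cmp f g = idm y.

Definition finite_category (C : category) : Prop :=
  finite_set [set: C] /\ forall x y : C, finite_set [set: hom x y].

Record functor (C D : category) := Functor {
  fob :> C -> D;
  fmap : forall x y : C, hom x y -> hom (fob x) (fob y);
  fmap1 : forall x : C, fmap (idm x) = idm (fob x);
  fmapM : forall (x y z : C) (g : hom y z) (f : hom x y),
    fmap (cmp g f) = cmp (fmap g) (fmap f) }.

Arguments fmap {C D} _ {x y} _.

Section FunctorComposition.
Variables B C D : category.

Definition fid : functor C C :=
  @Functor C C id (fun _ _ f => f) (fun=> erefl) (fun _ _ _ _ _ => erefl).

Definition fcomp (G : functor C D) (F : functor B C) : functor B D.
Proof.
refine (@Functor B D (fun x => G (F x)) (fun x y f => fmap G (fmap F f)) _ _).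
- by move=> x; rewrite !fmap1.
- by move=> x y z g f; rewrite !fmapM.
Defined.

End FunctorComposition.

Lemma fcompA (A B C D : category)
    (H : functor C D) (G : functor B C) (F : functor A B) :
  fcomp H (fcomp G F) = fcomp (fcomp H G) F.
Proof. by rewrite /fcomp /=; congr Functor; exact: Prop_irrelevance. Qed.

Lemma fcompf1 (C D : category) (F : functor C D) : fcomp F (fid C) = F.
Proof. by case: F => *; rewrite /fcomp /=; congr Functor; exact: Prop_irrelevance. Qed.

Lemma fcomp1f (C D : category) (F : functor C D) : fcomp (fid D) F = F.
Proof. by case: F => *; rewrite /fcomp /=; congr Functor; exact: Prop_irrelevance. Qed.

(* [ordcat n] is the poset {0 < ... < n}, with n + 1 elements. *)
Definition ordcat (n : nat) : category :=
  @Category 'I_n.+1 (fun i j => (i <= j)%N : Type) (fun i => leqnn i)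
    (fun i j k (jk : (j <= k)%N) (ij : (i <= j)%N) => leq_trans ij jk)
    (fun i j f => bool_irrelevance _ _) (fun i j f => bool_irrelevance _ _)
    (fun i j k l h g f => bool_irrelevance _ _).

Definition chain (n : nat) (C : category) := functor (ordcat n) C.

Definition nondegenerate (n : nat) (C : category) (X : chain n C) : Prop :=
  forall (i j : ordcat n) (ij : hom i j),
    nat_of_ord j = (nat_of_ord i).+1 -> ~ is_id (fmap X ij).

Definition num_nondegenerate (C : category) (n : nat) : nat :=
  #|` fset_set [set X : {classic chain n C} | nondegenerate X] |.

Record ndchain (C : category) := NDChain {
  len : nat;
  ndchain_val :> functor (ordcat len) C;
  ndchainP : nondegenerate ndchain_val }.

Section Subdivision.
Variable C : category.
Implicit Types X Y Z : ndchain C.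

(* Order-preserving maps [p] -> [q] are the same thing as functors
   [functor (ordcat p) (ordcat q)]. *)
Definition sd_premor X Y :=
  {f : functor (ordcat (len X)) (ordcat (len Y)) | fcomp Y f = X}.

Lemma min_le_max n (i j : 'I_n.+1) : (Order.min i j <= Order.max i j)%N.
Proof.
suff: (Order.min i j <= Order.max i j)%O by [].
by rewrite le_max ge_min lexx.
Qed.

Definition sd_rel X Y (f g : sd_premor X Y) : Prop :=
  forall i : 'I_(len X).+1,
    is_id (@fmap _ _ Y (Order.min (sval f i) (sval g i))
             (Order.max (sval f i) (sval g i)) (min_le_max _ _)).

Definition sd_equiv X Y (f g : {classic sd_premor X Y}) : bool :=
  `[< clos_refl_sym_trans _ (@sd_rel X Y) f g >].

Lemma sd_equiv_class X Y : equiv_class_of (@sd_equiv X Y).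
Proof.
split.
- by move=> f; apply/asboolP/rst_refl.
- by move=> f g; apply/asboolP/asboolP => h; exact: rst_sym.
- by move=> g f h /asboolP fg /asboolP gh; apply/asboolP/(rst_trans _ _ _ _ _ fg gh).
Qed.

Canonical sd_equiv_rel X Y := EquivRelPack (@sd_equiv_class X Y).

Definition sd_hom X Y := {eq_quot (@sd_equiv X Y)}.

Definition sd_preid X : sd_premor X X := exist _ (fid _) (fcompf1 X).

Lemma sd_precmp_subproof X Y Z (g : sd_premor Y Z) (f : sd_premor X Y) :
  fcomp Z (fcomp (sval g) (sval f)) = X.
Proof. by rewrite fcompA (svalP g) (svalP f). Qed.

Definition sd_precmp X Y Z (g : sd_premor Y Z) (f : sd_premor X Y) :
  sd_premor X Z := exist _ _ (sd_precmp_subproof g f).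

Definition sd_id X : sd_hom X X :=
  \pi_(sd_hom X X) (sd_preid X : {classic _}).

Definition sd_cmp X Y Z (g : sd_hom Y Z) (f : sd_hom X Y) : sd_hom X Z :=
  \pi_(sd_hom X Z) (sd_precmp (repr g) (repr f) : {classic _}).

Lemma sd_premorP X Y (f g : sd_premor X Y) : sval f = sval g -> f = g.
Proof. by case: f g => [f fX] [g gX] /= fg; exact: eq_exist. Qed.

Lemma sd_homP X Y (f g : {classic sd_premor X Y}) :
  reflect (clos_refl_sym_trans _ (@sd_rel X Y) f g)
    (\pi_(sd_hom X Y) f == \pi_(sd_hom X Y) g).
Proof. by rewrite eqmodE; exact: asboolP. Qed.

Lemma is_id_eq n (Z : chain n C) (i j k l : ordcat n) (ij : hom i j)
    (kl : hom k l) : i = k -> j = l -> is_id (fmap Z ij) -> is_id (fmap Z kl).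
Proof.
by move=> ik jl; move: ij; rewrite ik jl => ij; rewrite (bool_irrelevance ij kl).
Qed.

Lemma ordcat_mono p q (f : functor (ordcat p) (ordcat q)) (i j : 'I_p.+1) :
  (i <= j)%N -> (f i <= f j)%N.
Proof. by move=> ij; exact: (fmap f (ij : @hom (ordcat p) i j)). Qed.

Lemma sd_rel_cmpr X Y Z (g g' : sd_premor Y Z) (f : sd_premor X Y) :
  sd_rel g g' -> sd_rel (sd_precmp g f) (sd_precmp g' f).
Proof. by move=> gg i; exact: gg. Qed.

Lemma sd_rel_cmpl X Y Z (g : sd_premor Y Z) (f f' : sd_premor X Y) :
  sd_rel f f' -> sd_rel (sd_precmp g f) (sd_precmp g f').
Proof.
move=> ff i; move: (ff i); rewrite /sd_precmp /=.
move: (sval f i) (sval f' i) => a b; case: g => g /= gY.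
have mE : Order.min (g a) (g b) = g (Order.min a b).
  have [ab|/ltW ba] := leP a b; first by rewrite min_l // leEord ordcat_mono.
  by rewrite min_r // leEord ordcat_mono.
have ME : Order.max (g a) (g b) = g (Order.max a b).
  have [ab|/ltW ba] := leP a b; first by rewrite max_r // leEord ordcat_mono.
  by rewrite max_l // leEord ordcat_mono.
rewrite -gY /=.
exact: is_id_eq (esym mE) (esym ME).
Qed.

Lemma sd_equiv_cmp X Y Z (g g' : {classic sd_premor Y Z})
    (f f' : {classic sd_premor X Y}) :
  sd_equiv g g' -> sd_equiv f f' ->
  \pi_(sd_hom X Z) (sd_precmp g f : {classic _}) =
  \pi_(sd_hom X Z) (sd_precmp g' f' : {classic _}).
Proof.
move=> /asboolP gg /asboolP ff; transitivity
  (\pi_(sd_hom X Z) (sd_precmp g' f : {classic _})).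
- elim: gg => [u v uv|//|u v _ ->//|u v w _ -> _ ->//].
  by apply/eqP/sd_homP/rst_step; exact: sd_rel_cmpr.
- elim: ff => [u v uv|//|u v _ ->//|u v w _ -> _ ->//].
  by apply/eqP/sd_homP/rst_step; exact: sd_rel_cmpl.
Qed.

Lemma sd_equiv_repr X Y (f : {classic sd_premor X Y}) :
  sd_equiv (repr (\pi_(sd_hom X Y) f)) f.
Proof. by rewrite -eqmodE; apply/eqP; rewrite reprK. Qed.

Lemma sd_equivxx X Y (f : {classic sd_premor X Y}) : sd_equiv f f.
Proof. by case: (sd_equiv_class X Y). Qed.

Lemma sd_cmp1m X Y (f : sd_hom X Y) : sd_cmp (sd_id Y) f = f.
Proof.
rewrite -[RHS]reprK /sd_cmp (sd_equiv_cmp (sd_equiv_repr _) (sd_equivxx _)).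
by congr (\pi_(sd_hom _ _) _); apply: sd_premorP; rewrite /= fcomp1f.
Qed.

Lemma sd_cmpm1 X Y (f : sd_hom X Y) : sd_cmp f (sd_id X) = f.
Proof.
rewrite -[RHS]reprK /sd_cmp (sd_equiv_cmp (sd_equivxx _) (sd_equiv_repr _)).
by congr (\pi_(sd_hom _ _) _); apply: sd_premorP; rewrite /= fcompf1.
Qed.

Lemma sd_cmpA X Y Z T (h : sd_hom Z T) (g : sd_hom Y Z) (f : sd_hom X Y) :
  sd_cmp h (sd_cmp g f) = sd_cmp (sd_cmp h g) f.
Proof.
rewrite /sd_cmp (sd_equiv_cmp (sd_equivxx _) (sd_equiv_repr _)).
rewrite (sd_equiv_cmp (sd_equiv_repr _) (sd_equivxx _)).
by congr (\pi_(sd_hom _ _) _); apply: sd_premorP; rewrite /= fcompA.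
Qed.

Definition Sd : category := @Category (ndchain C) sd_hom sd_id sd_cmp
  sd_cmp1m sd_cmpm1 sd_cmpA.

End Subdivision.

Section Modules.
Variable A : pzRingType.

Record submodule (V : lmodType A) := Submodule {
  submodule_pred :> {pred V};
  submoduleP : submod_closed submodule_pred }.

HB.instance Definition _ (V : lmodType A) (S : submodule V) :=
  GRing.isSubmodClosed.Build A V (submodule_pred S) (submoduleP S).

Section Span.
Variables (V : lmodType A) (X : set V).

Definition gen_submod_pred : {pred V} :=
  fun v => `[< forall S : submodule V, (forall x, X x -> x \in S) -> v \in S >].

Fact gen_submod_closed : submod_closed gen_submod_pred.
Proof.
split.
  by apply/asboolP => S _; exact: rpred0.
move=> a u v /asboolP uS /asboolP vS; apply/asboolP => S XS.
by rewrite rpredD// ?rpredZ ?uS ?vS.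
Qed.

Definition gen_submod : submodule V := Submodule gen_submod_closed.

End Span.

Section Submodule.
Variables (V : lmodType A) (S : submodule V).

Record submod := Submod { submod_val :> V; submodP : submod_val \in S }.
HB.instance Definition _ := [isSub for submod_val].
HB.instance Definition _ := [Choice of submod by <:].
HB.instance Definition _ := [SubChoice_isSubLmodule of submod by <:].

End Submodule.

Section Quotient.
Variables (V : lmodType A) (S : submodule V).

Definition quotmod := Quotient.quot S.
HB.instance Definition _ := GRing.Zmodule.on quotmod.

Definition quotmod_pi (v : V) : quotmod := \pi_(Quotient.quot S) v.

Definition quotmod_scale (a : A) (x : quotmod) : quotmod :=
  quotmod_pi (a *: repr (x : Quotient.quot S)).

Lemma quotmod_piP (u v : V) : (quotmod_pi u = quotmod_pi v) <-> (u - v \in S).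
Proof. by rewrite Quotient.idealrBE; split=> [/eqP|/eqP]. Qed.

Lemma quotmod_repr (x : quotmod) : quotmod_pi (repr (x : Quotient.quot S)) = x.
Proof. exact: reprK. Qed.

Lemma quotmod_piD (u v : V) :
  quotmod_pi (u + v) = quotmod_pi u + quotmod_pi v.
Proof. exact: (@Quotient.pi_add V S). Qed.

Lemma quotmod_piZ a (v : V) : quotmod_pi (a *: v) = quotmod_scale a (quotmod_pi v).
Proof.
apply/quotmod_piP; rewrite -scalerBr rpredZ //.
by apply/quotmod_piP; rewrite quotmod_repr.
Qed.

Fact quotmod_scalerA a b x :
  quotmod_scale a (quotmod_scale b x) = quotmod_scale (a * b) x.
Proof. by rewrite -(quotmod_repr x) -!quotmod_piZ scalerA. Qed.

Fact quotmod_scale1r : left_id 1 quotmod_scale.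
Proof. by move=> x; rewrite -(quotmod_repr x) -quotmod_piZ scale1r. Qed.

Fact quotmod_scalerDr : right_distributive quotmod_scale +%R.
Proof.
move=> a x y; rewrite -(quotmod_repr x) -(quotmod_repr y).
by rewrite -quotmod_piD -!quotmod_piZ scalerDr quotmod_piD.
Qed.

Fact quotmod_scalerDl x : {morph quotmod_scale^~ x : a b / a + b}.
Proof.
by move=> a b; rewrite -(quotmod_repr x) -!quotmod_piZ scalerDl quotmod_piD.
Qed.

HB.instance Definition _ := GRing.Zmodule_isLmodule.Build A quotmod
  quotmod_scalerA quotmod_scale1r quotmod_scalerDr quotmod_scalerDl.

Fact quotmod_pi_linear : linear quotmod_pi.
Proof. by move=> a u v; rewrite quotmod_piD quotmod_piZ. Qed.
HB.instance Definition _ :=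
  GRing.isLinear.Build A V quotmod *:%R quotmod_pi quotmod_pi_linear.

End Quotient.

Section QuotientMap.
Variables (V W : lmodType A) (S : submodule V) (T : submodule W).
Variables (f : {linear V -> W}) (fST : forall v, v \in S -> f v \in T).

Definition quotmod_map of (forall v, v \in S -> f v \in T) :=
  fun x : quotmod S => quotmod_pi T (f (repr (x : Quotient.quot S))).

Lemma quotmod_map_pi v : quotmod_map fST (quotmod_pi S v) = quotmod_pi T (f v).
Proof.
apply/quotmod_piP; rewrite -linearB; apply: fST.
by apply/quotmod_piP; rewrite quotmod_repr.
Qed.

Fact quotmod_map_linear : linear (quotmod_map fST).
Proof.
move=> a x y; rewrite -(quotmod_repr x) -(quotmod_repr y).
by rewrite -linearP !quotmod_map_pi !linearP.
Qed.
HB.instance Definition _ := GRing.isLinear.Build A (quotmod S) (quotmod T) *:%R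
  (quotmod_map fST) quotmod_map_linear.

End QuotientMap.

Section Homology.
Variables (V : nat -> lmodType A) (d : forall n, {linear V n.+1 -> V n}).

Definition cycle_pred (n : nat) : {pred V n} :=
  match n return {pred V n} with
  | 0 => predT
  | m.+1 => fun v => d m v == 0
  end.

Fact cycle_submod_closed n : submod_closed (@cycle_pred n).
Proof.
case: n => [//|n]; split; first by apply/eqP; rewrite linear0.
move=> a u v /eqP uE /eqP vE; apply/eqP.
by rewrite linearP uE vE scaler0 addr0.
Qed.

Definition cycles n : lmodType A := submod (Submodule (@cycle_submod_closed n)).

Definition boundary_pred n : {pred cycles n} :=
  fun z => `[< exists v, d n v = submod_val z >].

Fact boundary_submod_closed n : submod_closed (@boundary_pred n).
Proof.
split; first by apply/asboolP; exists 0; rewrite linear0.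
move=> a u v /asboolP[u' uE] /asboolP[v' vE]; apply/asboolP.
by exists (a *: u' + v'); rewrite linearP uE vE.
Qed.

Definition homology n : lmodType A :=
  quotmod (Submodule (@boundary_submod_closed n)).

End Homology.
End Modules.

Section GroupVonNeumann.
Variables (R : realType) (G : groupType).
Local Notation C := (R[i]).
Implicit Types f : G -> C^o.

Definition l2norm2 f : \bar R := \esum_(g in [set: G]) ((normc (f g)) ^+ 2)%:E.

Lemma l2norm2_ge0 f : (0 <= l2norm2 f)%E.
Proof. by apply: esum_ge0 => g _; rewrite lee_fin sqr_ge0. Qed.

Lemma l2norm2_lin a (u v : G -> C^o) :
  (l2norm2 (a *: u + v)%R <= (2 * normc a ^+ 2)%:E * l2norm2 u + 2%:E * l2norm2 v)%E.
Proof.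
have esumZ (c : R) (h : G -> R) : 0 <= c -> (forall g, 0 <= h g) ->
    (\esum_(g in [set: G]) (c * h g)%:E <= c%:E * \esum_(g in [set: G]) (h g)%:E)%E.
  move=> c0 h0; apply: ge_ereal_sup => _ /= [F [finF _] <-].
  under eq_fsbigr do rewrite EFinM.
  rewrite -ge0_mule_fsumr; last by move=> g; rewrite lee_fin.
  by apply: lee_wpmul2l; rewrite ?lee_fin//; apply: ereal_sup_ubound; exists F.
apply: (@le_trans _ _ (\esum_(g in [set: G]) (2 * normc a ^+ 2 * normc (u g) ^+ 2)%:E
    + \esum_(g in [set: G]) (2 * normc (v g) ^+ 2)%:E)%E); last first.
  apply: leeD.
    by apply: esumZ => [|g]; [rewrite mulr_ge0 ?sqr_ge0|exact: sqr_ge0].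
  by apply: esumZ => // g; exact: sqr_ge0.
rewrite -esumD; last 2 first.
- by move=> g _; rewrite lee_fin (mulr_ge0 (mulr_ge0 _ (sqr_ge0 _)) (sqr_ge0 _)).
- by move=> g _; rewrite lee_fin mulr_ge0 ?sqr_ge0.
apply: le_esum => g _; rewrite -EFinD lee_fin.
have h : normc ((a *: u + v) g) <= normc a * normc (u g) + normc (v g).
  by apply: le_trans (le_normcD _ _) _; rewrite normcM.
have normc_ge0 (z : C) : 0 <= normc z by case: z => x y; exact: sqrtr_ge0.
apply: (@le_trans _ _ ((normc a * normc (u g) + normc (v g)) ^+ 2)).
  by rewrite ler_sqr ?nnegrE ?addr_ge0 ?mulr_ge0.
rewrite -mulrA -exprMn; set s := _ * _; set t := normc _.
rewrite -subr_ge0 (_ : _ - _ = (s - t) ^+ 2) ?sqr_ge0 //.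
by rewrite sqrrD sqrrB !mulr2n !mulrDl !mul1r; lra.
Qed.

Lemma l2norm2_reindex (s : G -> G) f :
  bijective s -> l2norm2 (f \o s) = l2norm2 f.
Proof.
move=> bs; rewrite /l2norm2 [RHS](reindex_esum [set: G] [set: G] s) //.
by rewrite setTT_bijective.
Qed.

Lemma l2norm2_0 : l2norm2 0 = 0%E.
Proof. by apply: esum1 => g _; rewrite normc0 expr0n. Qed.

Definition l2_pred : {pred G -> C^o} := fun f => (l2norm2 f < +oo)%E.

Fact l2_submod_closed : submod_closed l2_pred.
Proof.
split; first by rewrite unfold_in /l2_pred l2norm2_0.
move=> a u v ul vl; rewrite unfold_in /l2_pred; apply: le_lt_trans (l2norm2_lin _ _ _) _.
apply: lte_add_pinfty; apply: lte_mul_pinfty => //.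
by rewrite lee_fin mulr_ge0 ?sqr_ge0.
Qed.
HB.instance Definition _ :=
  GRing.isSubmodClosed.Build C (G -> C^o) l2_pred l2_submod_closed.

Record l2 := L2 { l2_val :> G -> C^o; l2P : l2_val \in l2_pred }.
HB.instance Definition _ := [isSub for l2_val].
HB.instance Definition _ := [Choice of l2 by <:].
HB.instance Definition _ := [SubChoice_isSubLmodule of l2 by <:].

Lemma l2_comp_subproof (s : G -> G) (bs : bijective s) (f : l2) :
  l2_val f \o s \in l2_pred.
Proof. by rewrite unfold_in /l2_pred l2norm2_reindex //; exact: (l2P f). Qed.

Definition l2_comp (s : G -> G) (bs : bijective s) (f : l2) : l2 :=
  L2 (l2_comp_subproof bs f).

Lemma mulgl_bij (g : G) : bijective (fun h : G => (g * h)%g).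
Proof. by exists (fun h => g^-1 * h)%g => h; rewrite ?mulKg ?mulVKg. Qed.

Lemma mulgr_bij (g : G) : bijective (fun h : G => (h * g)%g).
Proof. by exists (fun h => h * g^-1)%g => h; rewrite ?mulgK ?mulgVK. Qed.

Definition ltrans (g : G) : l2 -> l2 := l2_comp (mulgl_bij g^-1).
Definition rtrans (g : G) : l2 -> l2 := l2_comp (mulgr_bij g).

Fact delta1_subproof : (fun g : G => (g == 1%g)%:R : C^o) \in l2_pred.
Proof.
rewrite unfold_in /l2_pred /l2norm2 (esumID [set 1%g])/=; last first.
  by move=> g _; rewrite lee_fin sqr_ge0.
rewrite setTI esum_set1 ?lee_fin ?sqr_ge0// eqxx normc1 expr1n esum1 ?adde0 ?ltry//.
by move=> g [_ /= /eqP/negbTE ->]; rewrite normc0 expr0n.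
Qed.

Definition delta1 : l2 := L2 delta1_subproof.

(* N(G) is realized as the algebra of bounded operators on l^2(G) that commute
   with right translations; C[G] embeds into it by left translations
   [vN_group]. *)
Definition vN_pred : {pred l2 -> l2} := fun T => `[<
  [/\ linear T,
      (exists2 M : R, 0 <= M & forall f : l2, (l2norm2 (T f) <= M%:E * l2norm2 f)%E)
    & forall g (f : l2), T (rtrans g f) = rtrans g (T f)] >].

Fact vN_submod_closed : submod_closed vN_pred.
Proof.
split.
  apply/asboolP; split.
  - by move=> a u v; rewrite [LHS]/= scaler0 addr0.
  - by exists 0 => // f; rewrite mul0e [X in (X <= _)%E]l2norm2_0.
  - by move=> g f; apply/val_inj.
move=> a S T /asboolP[Sl [M M0 SM] Sr] /asboolP[Tl [N N0 TN] Tr].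
have E (f : l2) : (a *: S + T : l2 -> l2) f = a *: S f + T f by [].
apply/asboolP; split.
- move=> b u v; rewrite !E Sl Tl !scalerDr !scalerA [b * a]mulrC -!addrA.
  by congr +%R; rewrite addrCA.
- exists (2 * normc a ^+ 2 * M + 2 * N).
    by rewrite addr_ge0// ?(mulr_ge0 (mulr_ge0 _ (sqr_ge0 _)))// mulr_ge0.
  move=> f; apply: le_trans (l2norm2_lin _ _ _) _.
  have a0 : 0 <= 2 * normc a ^+ 2 by rewrite mulr_ge0 ?sqr_ge0.
  rewrite [(_ * M + _)%:E]EFinD [leRHS]ge0_muleDl ?lee_fin ?(mulr_ge0 a0)// ?mulr_ge0//.
  rewrite (EFinM _ M) (EFinM _ N) -!muleA.
  by apply: leeD; apply: lee_wpmul2l; rewrite ?lee_fin.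
- by move=> g f; rewrite !E Sr Tr; apply/val_inj.
Qed.
HB.instance Definition _ :=
  GRing.isSubmodClosed.Build C (l2 -> l2) vN_pred vN_submod_closed.

Record vN := VN { vN_val :> l2 -> l2; vNP : vN_val \in vN_pred }.
HB.instance Definition _ := [isSub for vN_val].
HB.instance Definition _ := [Choice of vN by <:].
HB.instance Definition _ := [SubChoice_isSubLmodule of vN by <:].

Fact vN_linear (T : vN) : linear T.
Proof. by have /asboolP[] := vNP T. Qed.

Fact vN_one_subproof : (id : l2 -> l2) \in vN_pred.
Proof. by apply/asboolP; split=> //; exists 1 => // f; rewrite mul1e. Qed.

Definition vN_one : vN := VN vN_one_subproof.

Fact vN_mul_subproof (S T : vN) : (S \o T) \in vN_pred.
Proof.
have /asboolP[Sl [M M0 SM] Sr] := vNP S.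
have /asboolP[Tl [N N0 TN] Tr] := vNP T.
apply/asboolP; split=> /=.
- by move=> a u v /=; rewrite Tl Sl.
- exists (M * N); first exact: mulr_ge0.
  move=> f /=; apply: le_trans (SM _) _; rewrite EFinM -muleA.
  exact: lee_wpmul2l.
- by move=> g f /=; rewrite Tr Sr.
Qed.

Definition vN_mul (S T : vN) : vN := VN (vN_mul_subproof S T).

Fact vN_mulA : associative vN_mul. Proof. by move=> S T U; apply/val_inj. Qed.
Fact vN_mul1 : left_id vN_one vN_mul. Proof. by move=> S; apply/val_inj. Qed.
Fact vN_mulr1 : right_id vN_one vN_mul. Proof. by move=> S; apply/val_inj. Qed.
Fact vN_mulDl : left_distributive vN_mul +%R.
Proof. by move=> S T U; apply/val_inj. Qed.
Fact vN_mulDr : right_distributive vN_mul +%R.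
Proof.
move=> S T U; apply/val_inj/funext => f /=.
by have := vN_linear S 1 (T f) (U f); rewrite !scale1r.
Qed.
Fact vN_one_neq0 : vN_one != 0.
Proof.
apply/eqP => /(congr1 (fun T : vN => l2_val (T delta1) 1%g)) /=.
by rewrite eqxx => /eqP; rewrite oner_eq0.
Qed.

HB.instance Definition _ := GRing.Zmodule_isNzRing.Build vN
  vN_mulA vN_mul1 vN_mulr1 vN_mulDl vN_mulDr vN_one_neq0.

Fact vN_group_subproof (g : G) : ltrans g \in vN_pred.
Proof.
apply/asboolP; split.
- by move=> a u v; apply/val_inj.
- exists 1 => // f; rewrite mul1e [X in (X <= _)%E]l2norm2_reindex //.
  exact: mulgl_bij.
- by move=> h f; apply/val_inj/funext => k /=; rewrite mulgA.
Qed.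

Definition vN_group (g : G) : vN := VN (vN_group_subproof g).

(* The von Neumann trace T |-> <T delta_1, delta_1>. *)
Definition vN_trace (T : vN) : C := T delta1 1%g.

End GroupVonNeumann.

Section Dimension.
Variables (R : realType) (G : groupType).
Local Notation N := (vN R G).

(* Right N(G)-modules are left modules over the opposite ring [N^c]. The
   dimension of M is the supremum of the dimensions of the finitely generated
   projective submodules of M. Such a submodule is the injective image of
   [{v : 'rV_k | v *m E = v}] for an idempotent matrix E, and its dimension is
   the trace of E, which is a nonnegative real number. *)
Definition vN_dim (M : lmodType N^c) : \bar R :=
  ereal_sup [set t | exists k (E : 'M[N^c]_k) (f : {linear 'rV[N^c]_k -> M}),
    [/\ E *m E = E,
        forall v : 'rV_k, v *m E = v -> f v = 0 -> v = 0
      & t = (complex.Re (\sum_(i < k) vN_trace (E i i)))%:E]].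

(* Objects of Func(G^op, C-vect): complex vector spaces with a linear right
   action of G. *)
Record rightrep := RightRep {
  rep_val :> lmodType R[i];
  rep_act : G -> {linear rep_val -> rep_val};
  rep_act1 : forall m, rep_act 1%g m = m;
  rep_actM : forall g h m, rep_act (g * h)%g m = rep_act h (rep_act g m) }.

Record repmor (M M' : rightrep) := RepMor {
  repmor_val :> {linear M -> M'};
  repmorP : forall g m, repmor_val (rep_act M g m) = rep_act M' g (repmor_val m) }.

(* The right N(G)-module M (x)_{C[G]} N(G), presented with the generators
   <<m>> = m (x) 1, for m in M; thus <<T *g m>> stands for m (x) T. *)
Definition tensor_rels (M : rightrep) : set {freeg M / N^c} :=
  [set r | (exists m m' : M, r = << m + m' >> - << m >> - << m' >>)
        \/ (exists (c : R[i]) (m : M), r = << c *: m >> - << (c *: (1 : N) : N) *g m >>)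
        \/ (exists g (m : M), r = << rep_act M g m >> - << vN_group R g *g m >>)].

Definition tensor_vN (M : rightrep) : lmodType N^c :=
  quotmod (gen_submod (@tensor_rels M)).

End Dimension.

Section FreeMap.
Variables (A : nzRingType) (K : choiceType) (V : lmodType A) (f : K -> V).

Lemma fglift_linear : linear (fglift f : {freeg K / A} -> V).
Proof.
have liftD : {morph (fglift f : {freeg K / A} -> V) : x y / x + y}.
  have liftB := lift_is_additive f.
  have lift0 : fglift f (0 : {freeg K / A}) = 0.
    by have := liftB 0 0; rewrite !subrr.
  have liftN x : fglift f (- x) = - fglift f x.
    by have := liftB 0 x; rewrite !sub0r lift0 sub0r.
  by move=> x y; have := liftB x (- y); rewrite liftN !opprK.
have lift_sum (I : Type) (r : seq I) (F : I -> {freeg K / A}) :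
    fglift f (\sum_(i <- r) F i) = \sum_(i <- r) fglift f (F i).
  elim: r => [|i r IH]; last by rewrite !big_cons liftD IH.
  by rewrite !big_nil; apply: (addIr (fglift f 0)); rewrite -liftD !add0r.
move=> a x y; rewrite liftD; congr +%R.
rewrite -{2}[x]freeg_sumE lift_sum scaler_sumr [LHS]lift_sum.
by apply: eq_bigr => k _; rewrite !liftU scalerA.
Qed.
HB.instance Definition _ := GRing.isLinear.Build A {freeg K / A} V *:%R
  (fglift f) fglift_linear.

End FreeMap.

Section Induction.
Variables (R : realType) (G : groupType).
Local Notation N := (vN R G).
Variables (M M' : rightrep R G) (f : repmor M M').

Definition tensor_pre : {freeg M / N^c} -> {freeg M' / N^c} :=
  fglift (fun m : M => << f m >>).
HB.instance Definition _ := GRing.Linear.on tensor_pre.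

Lemma tensor_preU (a : N^c) (m : M) :
  tensor_pre << a *g m >> = << a *g f m >>.
Proof.
rewrite /tensor_pre liftU; apply/eqP/freeg_eqP => x.
by rewrite coeffZ !coeffU mul1r.
Qed.

Lemma tensor_pre_span r :
  r \in gen_submod (@tensor_rels R G M) -> tensor_pre r \in gen_submod (@tensor_rels R G M').
Proof.
pose S := [pred r | tensor_pre r \in gen_submod (@tensor_rels R G M')].
have Scl : submod_closed S.
  split; first by rewrite inE linear0 rpred0.
  move=> a u v; rewrite !inE => uS vS.
  by rewrite linearP rpredD// rpredZ.
move=> /asboolP/(_ (Submodule Scl)); apply=> {}r rr.
rewrite inE; apply/asboolP => T; apply.
case: rr => [[m [m' ->]]|[[c [m ->]]|[g [m ->]]]].
- left; exists (f m), (f m').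
  by rewrite !linearB/= !tensor_preU linearD.
- by right; left; exists c, (f m); rewrite !linearB/= !tensor_preU linearZ.
- by right; right; exists g, (f m); rewrite !linearB/= !tensor_preU repmorP.
Qed.

Definition tensor_vN_map : {linear tensor_vN M -> tensor_vN M'} :=
  quotmod_map tensor_pre_span.

End Induction.

Section Automorphisms.
Variables (J : category) (x : J).

Definition aut := {f : hom x x | invertible f}.

HB.instance Definition _ := gen_eqMixin aut.
HB.instance Definition _ := gen_choiceMixin aut.

Lemma aut_inj (f g : aut) : sval f = sval g -> f = g.
Proof. by case: f g => [f fP] [g gP] /= fg; exact: eq_exist. Qed.

Lemma invertible_id : invertible (idm x).
Proof. by exists (idm x); rewrite cmp1m. Qed.

Lemma invertible_cmp (f g : aut) : invertible (cmp (sval f) (sval g)).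
Proof.
case: f g => [f [f' [f'f ff']]] [g [g' [g'g gg']]] /=; exists (cmp g' f'); split.
  by rewrite -cmpA [cmp f' _]cmpA f'f cmp1m.
by rewrite -cmpA [cmp g _]cmpA gg' cmp1m.
Qed.

Definition aut_one : aut := exist _ _ invertible_id.
Definition aut_mul (f g : aut) : aut := exist _ _ (invertible_cmp f g).

Lemma invertible_inv (f : aut) : invertible (sval (cid (svalP f))).
Proof. by case: (cid (svalP f)) => g [gf fg] /=; exists (sval f). Qed.

Definition aut_inv (f : aut) : aut := exist _ _ (invertible_inv f).

Fact aut_mulA : associative aut_mul.
Proof. by move=> f g h; apply/aut_inj; rewrite /= cmpA. Qed.
Fact aut_mul1 : left_id aut_one aut_mul.
Proof. by move=> f; apply/aut_inj; rewrite /= cmp1m. Qed.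
Fact aut_mulr1 : right_id aut_one aut_mul.
Proof. by move=> f; apply/aut_inj; rewrite /= cmpm1. Qed.
Fact aut_mulV : left_inverse aut_one aut_inv aut_mul.
Proof. by move=> f; apply/aut_inj; rewrite /=; case: cid => g []. Qed.
Fact aut_mulrV : right_inverse aut_one aut_inv aut_mul.
Proof. by move=> f; apply/aut_inj; rewrite /=; case: cid => g []. Qed.

HB.instance Definition _ := isGroup.Build aut
  aut_mulA aut_mul1 aut_mulr1 aut_mulV aut_mulrV.

End Automorphisms.

Section IsoClasses.
Variable J : category.

Definition isomorphic (x y : {classic J}) : bool :=
  `[< exists f : @hom J x y, invertible f >].

Lemma isomorphic_class : equiv_class_of isomorphic.
Proof.
have sym x y : isomorphic x y -> isomorphic y x.
  by move=> /asboolP[f [g [gf fg]]]; apply/asboolP; exists g, f.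
split=> [x|x y|y x z]; first by apply/asboolP; exists (idm x); exact: invertible_id.
  by apply/idP/idP; exact: sym.
move=> /asboolP[f [f' [f'f ff']]] /asboolP[g [g' [g'g gg']]]; apply/asboolP.
exists (cmp g f), (cmp f' g'); split.
  by rewrite -cmpA [cmp g' _]cmpA g'g cmp1m.
by rewrite -cmpA [cmp f _]cmpA ff' cmp1m.
Qed.

Canonical isomorphic_rel := EquivRelPack isomorphic_class.

Definition iso_class := {eq_quot isomorphic}.

End IsoClasses.

Section Presheaves.
Variables (R : realType) (J : category).

(* Objects of Func(J^op, C-vect). *)
Record presheaf := Presheaf {
  psh_ob :> J -> lmodType R[i];
  psh_map : forall x y : J, hom x y -> {linear psh_ob y -> psh_ob x};
  psh_map1 : forall (x : J) m, psh_map (idm x) m = m;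
  psh_mapM : forall (x y z : J) (g : hom y z) (f : hom x y) m,
    psh_map (cmp g f) m = psh_map f (psh_map g m) }.

Record nattrans (F F' : presheaf) := NatTrans {
  nat_map :> forall x : J, {linear F x -> F' x};
  nat_natural : forall (x y : J) (u : hom x y) m,
    nat_map x (psh_map F u m) = psh_map F' u (nat_map y m) }.

Definition const_presheaf : presheaf :=
  @Presheaf (fun=> (R[i])^o) (fun _ _ _ => idfun) (fun _ _ => erefl)
    (fun _ _ _ _ _ _ => erefl).

(* Epimorphisms and exactness in Func(J^op, C-vect) are computed objectwise. *)
Definition epi_nat (F F' : presheaf) (p : nattrans F F') : Prop :=
  forall x m, exists m', p x m' = m.

Definition projective (P : presheaf) : Prop :=
  forall (F F' : presheaf) (p : nattrans F F') (q : nattrans P F'),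
    epi_nat p -> exists r : nattrans P F, forall x m, p x (r x m) = q x m.

Record proj_resolution (F : presheaf) := ProjResolution {
  res_ob :> nat -> presheaf;
  res_d : forall n, nattrans (res_ob n.+1) (res_ob n);
  res_aug : nattrans (res_ob 0) F;
  res_projective : forall n, projective (res_ob n);
  res_aug_epi : epi_nat res_aug;
  res_exact0 : forall x m, res_aug x m = 0 <-> exists m', res_d 0 x m' = m;
  res_exact : forall n x m, res_d n x m = 0 <-> exists m', res_d n.+1 x m' = m }.

End Presheaves.

Section Splitting.
Variables (R : realType) (J : category) (x : J).

(* The cokernel of the sum of the maps F(u) is the quotient of F(x) by the
   submodule generated by their images. *)
Definition split_image (F : presheaf R J) : set (F x) :=
  [set m | exists (y : J) (u : hom x y) (m' : F y),
             ~ invertible u /\ m = psh_map F u m'].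

Definition split_mod (F : presheaf R J) : lmodType R[i] :=
  quotmod (gen_submod (@split_image F)).

Lemma noninvertible_aut (y : J) (u : hom x y) (g : aut x) :
  ~ invertible u -> ~ invertible (cmp u (sval g)).
Proof.
move=> uN [w [wu uw]]; apply: uN; case: g wu uw => g [g' [g'g gg']] /= wu uw.
exists (cmp g w); split; last by rewrite cmpA.
have -> : cmp (cmp g w) u = cmp (cmp g (cmp w (cmp u g))) g'.
  by rewrite -!cmpA gg' cmpm1.
by rewrite wu cmpm1 gg'.
Qed.

Lemma split_act_subproof (F : presheaf R J) (g : aut x) m :
  m \in gen_submod (@split_image F) -> psh_map F (sval g) m \in gen_submod (@split_image F).
Proof.
pose S := [pred m | psh_map F (sval g) m \in gen_submod (@split_image F)].
have Scl : submod_closed S.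
  split; first by rewrite inE linear0 rpred0.
  by move=> a u v; rewrite !inE => uS vS; rewrite linearP rpredD// rpredZ.
move=> /asboolP/(_ (Submodule Scl)); apply=> _ [y [u [m' [uN ->]]]].
rewrite inE -psh_mapM; apply/asboolP => T; apply.
by exists y, (cmp u (sval g)), m'; split=> //; exact: noninvertible_aut.
Qed.

Definition split_act (F : presheaf R J) (g : aut x) :
    {linear split_mod F -> split_mod F} :=
  quotmod_map (@split_act_subproof F g).

Lemma split_actE (F : presheaf R J) (g : aut x) (m : F x) :
  split_act F g (quotmod_pi _ m) = quotmod_pi _ (psh_map F (sval g) m).
Proof. exact: quotmod_map_pi. Qed.

Fact split_act1 (F : presheaf R J) m : split_act F 1%g m = m.
Proof. by rewrite -(quotmod_repr m) split_actE psh_map1. Qed.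

Fact split_actM (F : presheaf R J) (g h : aut x) m :
  split_act F (g * h)%g m = split_act F h (split_act F g m).
Proof. by rewrite -(quotmod_repr m) !split_actE psh_mapM. Qed.

(* S_x F with its right action of Aut(x). *)
Definition splitting (F : presheaf R J) : rightrep R (aut x) :=
  RightRep (@split_act1 F) (@split_actM F).

Lemma split_map_subproof (F F' : presheaf R J) (p : nattrans F F') m :
  m \in gen_submod (@split_image F) -> p x m \in gen_submod (@split_image F').
Proof.
pose S := [pred m | p x m \in gen_submod (@split_image F')].
have Scl : submod_closed S.
  split; first by rewrite inE linear0 rpred0.
  by move=> a u v; rewrite !inE => uS vS; rewrite linearP rpredD// rpredZ.
move=> /asboolP/(_ (Submodule Scl)); apply=> _ [y [u [m' [uN ->]]]].
rewrite inE nat_natural; apply/asboolP => T; apply.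
by exists y, u, (p y m').
Qed.

Definition split_map_fun (F F' : presheaf R J) (p : nattrans F F') :
    {linear splitting F -> splitting F'} :=
  quotmod_map (@split_map_subproof F F' p).

Lemma split_map_funE (F F' : presheaf R J) (p : nattrans F F') (m : F x) :
  split_map_fun p (quotmod_pi _ m) = quotmod_pi _ (p x m).
Proof. exact: quotmod_map_pi. Qed.

Fact split_map_equiv (F F' : presheaf R J) (p : nattrans F F') g m :
  split_map_fun p (rep_act (splitting F) g m) =
  rep_act (splitting F') g (split_map_fun p m).
Proof.
by rewrite -(quotmod_repr m) /= split_actE !split_map_funE split_actE nat_natural.
Qed.

Definition split_map (F F' : presheaf R J) (p : nattrans F F') :
    repmor (splitting F) (splitting F') :=
  RepMor (@split_map_equiv F F' p).

End Splitting.

Section L2Euler.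
Variables (R : realType) (J : category).
Local Notation C := (R[i]).

(* b^(2)_n (S_x P_* (x)_{C[x]} N(x)) *)
Definition l2_betti (F : presheaf R J) (P : proj_resolution F) (x : J) (n : nat) :
    \bar R :=
  vN_dim (homology (fun k => tensor_vN_map (split_map x (res_d P k))) n).

Definition l2_h (F : presheaf R J) (P : proj_resolution F) (n : nat) : \bar R :=
  \esum_(c in [set: iso_class J]) l2_betti P (repr c) n.

Definition conv_radius (a : nat -> R) : \bar R :=
  ereal_sup [set r%:E | r in
    [set r : R | 0 <= r /\ cvgn (series (fun n => `|a n| * r ^+ n))]].

Definition disc (r : \bar R) : set C := [set z | ((normc z)%:E < r)%E].

Definition is_pole (g : C -> C) (s : C) : Prop :=
  forall M : R, \forall z \near (s : C^o)^', M < normc (g z).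

(* [v] is the value at -1 of a meromorphic continuation g of sum_n a_n z^n to
   the disc of radius [eps], with set of poles [poles]; the values of the total
   function g at its poles are irrelevant. *)
Definition continuation_value (a : nat -> R) (v : C) : Prop :=
  (0 < conv_radius a)%E /\
  exists (eps : \bar R) (g : C -> C) (poles : seq C),
    [/\ (1%:E < eps)%E,
        forall s, s \in poles -> [/\ disc eps s, s != -1 & is_pole g s],
        forall z, disc eps z -> z \notin poles ->
          derivable (g : C^o -> C^o) z 1,
        forall z, disc (Order.min (conv_radius a) eps) z ->
          series (fun n => (a n)%:C%C * z ^+ n : C^o) @ \oo --> (g z : C^o)
      & v = g (-1)].

Definition is_chi2_ex (v : C) : Prop :=
  exists P : proj_resolution (const_presheaf R J),
    (forall n, l2_h P n \is a fin_num) /\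
    continuation_value (fun n => fine (l2_h P n)) v.

End L2Euler.

(* The equality f = g/h in Q((t)) is the equality h * f = g of formal power
   series, which is stated coefficientwise. *)
Definition is_chi_sum (C : category) (q : rat) : Prop :=
  exists g h : {poly rat},
    [/\ h.[-1] != 0,
        forall n, \sum_(i < n.+1) h`_i * (num_nondegenerate C (n - i))%:R = g`_n
      & q = g.[-1] / h.[-1]].

(* Main.v *)
From Pilot Require Import Defs.
From HB Require Import structures.
From mathcomp Require Import all_boot all_order all_algebra finmap.
From mathcomp Require Import all_classical all_reals all_analysis.
From mathcomp Require Import complex lra ring zify.
From mathcomp.multinomials Require Import freeg.
From Stdlib Require Import Eqdep_dec Relation_Operators.
(* The libraries above shadow the names hom, fmap and nondegenerate of the
   categorical definitions. *)
Import Pilot.Defs.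

Set Implicit Arguments.
Unset Strict Implicit.
Unset Printing Implicit Defensive.

Import Order.TTheory GRing.Theory Num.Theory numFieldNormedType.Exports.
Import Normc.

Local Open Scope classical_set_scope.
Local Open Scope quotient_scope.
Local Open Scope ring_scope.

(** The series Euler characteristic is the value at -1 of the rational function
    expanding to the sum of a_n t^n, where a_n is the number of nondegenerate
    n-chains, and the claim is that the L2-series of the opposite of the
    subdivision is this very series, and that for a rational series the two
    ways of evaluating at -1 agree.

    Coefficients. Premorphisms of the subdivision are strictly increasing,
    because their sources are nondegenerate; hence all isomorphisms of the
    subdivision are identities, all automorphism groups are trivial, and N(1)
    is the field of complex numbers. Presheaves on the opposite category are
    covariant functors on the subdivision, and the constant one is resolved by
    the normalized chains of the simplices [len Y], taken modulo the relation
    that defines the morphisms of the subdivision ([chains_resolution]). This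
    functor is projective in degree n, being the sum of the functors
    represented by the chains of length n, and the cone from the vertex 0 of
    [len Y] makes the augmented complex exact. The splitting functor at X
    kills all simplices except the top one, so the complex S_X P is
    concentrated in degree len X, where it is a line ([chains_betti]). The
    comparison theorem makes the Betti numbers independent of the resolution
    ([l2_betti_eq]), and summing over X gives h_n = a_n ([l2_hE]).

    Values. The numbers a_n are entries of powers of a transfer matrix, so the
    series is a quotient g / h of polynomials and has positive radius of
    convergence ([num_nondegenerate_rational], [num_nondegenerate_growth]). If
    h(-1) <> 0, then in lowest terms g / h is a meromorphic continuation to
    the whole plane ([represents_continuation]). Conversely, for a continuation
    G to a disc of radius greater than 1, the identity theorem applied to
    h G - g gives h(-1) G(-1) = g(-1) ([continuation_value_eq]); if g and h do
    not both vanish at -1, then h(-1) <> 0, and the values agree.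

    The identity theorem is proved from complex differentiability alone:
    Goursat's theorem for rectangles ([goursat]) gives Cauchy's estimate
    ([cauchy_bound]), and this estimate applied to f(z) / z^n for all n shows
    that a holomorphic function that vanishes near the centre of a square
    vanishes on the inscribed disc ([vanish_square]). Such discs are chained
    along a path from 0 to -1 that avoids the poles ([continuation_zero]). *)

(** * The modulus and the topology of the complex numbers *)

Section ComplexModulus.
Variable R : realType.
Implicit Types z w : R[i].

Lemma normc_ge0 z : 0 <= normc z.
Proof. by case: z => a b; exact: sqrtr_ge0. Qed.

Lemma norm_normc z : `|z| = (normc z)%:C%C.
Proof. by rewrite normc_def; case: z. Qed.

Lemma normc_eq0 z : (normc z == 0) = (z == 0).
Proof.
apply/eqP/eqP => [|->]; last exact: normc0.
exact: eq0_normc.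
Qed.

Lemma normc_gt0 z : (0 < normc z) = (z != 0).
Proof. by rewrite lt0r normc_eq0 normc_ge0 andbT. Qed.

Lemma normc_add z w : normc (z + w) <= normc z + normc w.
Proof. exact: le_normcD. Qed.

Lemma normc_opp z : normc (- z) = normc z.
Proof. by case: z => a b /=; rewrite !sqrrN. Qed.

Lemma normc_dist z w : normc (z - w) = normc (w - z).
Proof. by rewrite -normc_opp opprB. Qed.

Lemma normc_mul z w : normc (z * w) = normc z * normc w.
Proof. exact: normcM. Qed.

Lemma normc_exp z n : normc (z ^+ n) = normc z ^+ n.
Proof. by elim: n => [|n IH]; rewrite ?expr0 ?normc1// !exprS normc_mul IH. Qed.

Lemma normc_real (x : R) : normc x%:C%C = `|x|.
Proof. by rewrite /= expr0n addr0 sqrtr_sqr. Qed.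

Lemma Re_le_normc z : `|complex.Re z| <= normc z.
Proof. by rewrite -lecR -norm_normc; exact: normc_ge_Re. Qed.

Lemma Im_le_normc z : `|complex.Im z| <= normc z.
Proof.
case: z => a b /=; rewrite -sqrtr_sqr ler_sqrt ?addr_ge0 ?sqr_ge0//.
by rewrite lerDr sqr_ge0.
Qed.

Lemma normc_le_ReIm z : normc z <= `|complex.Re z| + `|complex.Im z|.
Proof.
case: z => a b /=; rewrite -[leRHS]ger0_norm ?addr_ge0// -sqrtr_sqr.
rewrite ler_sqrt ?sqr_ge0// sqrrD !real_normK ?num_real//.
by rewrite addrAC lerDl mulrn_wge0// mulr_ge0.
Qed.

Lemma normc_sub_le z w : normc z - normc w <= normc (z - w).
Proof. by rewrite lerBlDr; apply: le_trans (normc_add _ _); rewrite subrK. Qed.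

End ComplexModulus.

Section ComplexTopology.
Variable R : realType.
Local Notation C := (R[i]).

(** The modulus of the library is complex-valued; real moduli keep all later
    estimates in the ordered field R. *)
Lemma continuousC_epsP (f : C -> C) z :
  {for z, continuous (f : C^o -> C^o)} <->
  forall e : R, 0 < e -> exists2 d : R, 0 < d &
    forall w, normc (w - z) < d -> normc (f w - f z) < e.
Proof.
split=> [/cvgrPdist_lt fz e e0|h].
  have /fz : 0 < e%:C%C :> C by rewrite ltcR.
  rewrite -nbhs_nearE -nbhs_ballE /= => -[d /= d0 dP].
  have /complex_realP[d' dE] : d \is Num.real by rewrite gtr0_real.
  move: d0; rewrite dE ltcR => d0.
  exists d' => // w wz.
  have := dP w; rewrite /ball /= dE !norm_normc !ltcR (normc_dist z) [X in X < e]normc_dist.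
  by move=> /(_ wz).
apply/(@cvgrPdist_lt _ C^o _ (nbhs (z : C^o)) _ f (f z)) => e e0.
have /complex_realP[e' eE] : e \is Num.real by rewrite gtr0_real.
move: e0; rewrite eE ltcR => /h [d d0 dP].
rewrite -nbhs_nearE -nbhs_ballE /=; exists d%:C%C; first by rewrite /= ltcR.
by move=> w; rewrite /ball /= !norm_normc !ltcR normc_dist [X in _ -> X < _]normc_dist; exact: dP.
Qed.

Lemma nearC_epsP (P : C -> Prop) (z : C) :
  (\forall w \near (z : C^o), P w) <->
  exists2 d : R, 0 < d & forall w, normc (w - z) < d -> P w.
Proof.
rewrite -nbhs_nearE -nbhs_ballE /=; split=> [[d /= d0 dP]|[d d0 dP]].
  have /complex_realP[d' dE] : d \is Num.real by rewrite gtr0_real.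
  move: d0; rewrite dE ltcR => d0; exists d' => // w wz; apply: dP.
  by rewrite /ball /= dE norm_normc ltcR normc_dist.
exists d%:C%C; first by rewrite /= ltcR.
by move=> w; rewrite /ball /= norm_normc ltcR normc_dist; exact: dP.
Qed.

(** Multiplying the difference quotient by w - z gives a first-order expansion
    that also makes sense at w = z. *)
Lemma derivableC_eps (f : C -> C) z : derivable (f : C^o -> C^o) z 1 ->
  exists c : C, forall e : R, 0 < e -> exists2 d : R, 0 < d &
    forall w, normc (w - z) < d ->
      normc (f w - f z - c * (w - z)) <= e * normc (w - z).
Proof.
move=> /cvg_ex[c /= /cvgrPdist_lt fz]; exists c => e e0.
have /fz : 0 < e%:C%C :> C by rewrite ltcR.
rewrite near_withinE => /nearC_epsP[d d0 dP]; exists d => // w wz.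
have [->|wNz] := eqVneq w z; first by rewrite !subrr mulr0 subrr normc0 mulr0.
have := dP (w - z); rewrite subr0 => /(_ wz); rewrite subr_eq0 => /(_ wNz).
have -> : (w - z) *: (1 : C^o) + z = w by rewrite scaler1 subrK.
rewrite norm_normc ltcR => h.
have -> : f w - f z - c * (w - z) = - (c - (w - z)^-1 * (f w - f z)) * (w - z).
  by rewrite [_^-1 * _]mulrC mulNr mulrBl divfK ?subr_eq0// opprB.
by rewrite normc_mul normc_opp ler_wpM2r ?normc_ge0// ltW.
Qed.

Lemma derivableC_continuous (f : C -> C) z : derivable (f : C^o -> C^o) z 1 ->
  {for z, continuous (f : C^o -> C^o)}.
Proof. by move=> /derivable1_diffP; exact: differentiable_continuous. Qed.

Lemma continuousC_mul (f g : C -> C) z :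
  {for z, continuous (f : C^o -> C^o)} -> {for z, continuous (g : C^o -> C^o)} ->
  {for z, continuous ((fun w => f w * g w) : C^o -> C^o)}.
Proof. by move=> fz gz; exact: (@continuousM _ C^o f g z fz gz). Qed.

Lemma continuousC_add (f g : C -> C) z :
  {for z, continuous (f : C^o -> C^o)} -> {for z, continuous (g : C^o -> C^o)} ->
  {for z, continuous ((fun w => f w + g w) : C^o -> C^o)}.
Proof.
by move=> fz gz; exact: (@continuousD _ C^o C^o (f : C^o -> C^o) (g : C^o -> C^o) z fz gz).
Qed.

End ComplexTopology.

(** * Integrals over real segments *)

Section SegmentIntegral.
Variable R : realType.
Local Notation C := (R[i]).
Local Notation mu := (@lebesgue_measure R).

(** Two-sided continuity at every point of the segment, endpoints included: all
    integrands below are restrictions of functions continuous near the segment. *)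
Definition cont_on (a b : R) (f : R -> R) :=
  forall t, a <= t <= b -> {for t, continuous f}.

Definition rint (a b : R) (f : R -> R) := \int[mu]_(t in `[a, b]) f t.

Lemma cont_on_within a b f : cont_on a b f -> {within `[a, b], continuous f}.
Proof.
move=> fc; apply: continuous_in_subspaceT => t; rewrite inE /= in_itv /=.
exact: fc.
Qed.

Lemma cont_on_integrable a b f : cont_on a b f ->
  mu.-integrable `[a, b] (EFin \o f).
Proof.
move=> /cont_on_within fc; apply: continuous_compact_integrable => //.
exact: segment_compact.
Qed.

Lemma rintD a b f g : cont_on a b f -> cont_on a b g ->
  rint a b (fun t => f t + g t) = rint a b f + rint a b g.
Proof. by move=> fc gc; apply: RintegralD => //; exact: cont_on_integrable. Qed.

Lemma rintZ a b c f : cont_on a b f ->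
  rint a b (fun t => c * f t) = c * rint a b f.
Proof. by move=> fc; apply: RintegralZl => //; exact: cont_on_integrable. Qed.

Lemma rint_cst a b c : a <= b -> rint a b (fun=> c) = c * (b - a).
Proof.
move=> ab; rewrite /rint Rintegral_cst//; congr (_ * _).
transitivity (fine (if a%:E < b%:E then b%:E - a%:E else 0)%E).
  by congr fine; exact: (@lebesgue_measure_itv R `[a, b]).
rewrite lte_fin.
have [//|] := ltP a b.
by rewrite le_eqVlt ltNge ab orbF => /eqP ->; rewrite subrr.
Qed.

Lemma rint_le a b f g : cont_on a b f -> cont_on a b g ->
  (forall t, a <= t <= b -> f t <= g t) -> rint a b f <= rint a b g.
Proof.
by move=> fc gc fg; apply: le_Rintegral => //; exact: cont_on_integrable.
Qed.

Lemma cont_on_cst a b c : cont_on a b (fun=> c).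
Proof. by move=> t _; exact: cst_continuous. Qed.

Lemma rint_split a m b f : a <= m <= b -> cont_on a b f ->
  rint a b f = rint a m f + rint m b f.
Proof.
move=> /andP[am mb] fc.
have := @Rintegral_itvB _ f (BLeft a) (BRight b) m (cont_on_integrable fc).
rewrite !bnd_simp => /(_ am mb) /eqP; rewrite subr_eq /rint => /eqP ->.
rewrite addrC; congr +%R; rewrite Rintegral_itv_obnd_cbnd//.
have : mu.-integrable `[m, b] (EFin \o f).
  apply: cont_on_integrable => t /andP[mt tb]; apply: fc.
  by rewrite (le_trans am mt).
apply: integrableS => //; apply: subset_itvr.
by rewrite bnd_simp.
Qed.

End SegmentIntegral.

(** * Contour integrals over rectangles *)

Section RectangleIntegral.
Variable R : realType.
Local Notation C := (R[i]).
Implicit Types (f g : C -> C) (phi psi : R -> C).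

Definition ccont_on (a b : R) phi :=
  cont_on a b (fun t => complex.Re (phi t)) /\
  cont_on a b (fun t => complex.Im (phi t)).

Definition cint (a b : R) phi : C :=
  (rint a b (fun t => complex.Re (phi t)) +i*
   rint a b (fun t => complex.Im (phi t)))%C.

Lemma cont_onZ a b c (f : R -> R) : cont_on a b f -> cont_on a b (fun t => c * f t).
Proof. by move=> fc t abt; apply: continuousM; [exact: cst_continuous|exact: fc]. Qed.

Lemma cintD a b phi psi : ccont_on a b phi -> ccont_on a b psi ->
  cint a b (fun t => phi t + psi t) = cint a b phi + cint a b psi.
Proof.
move=> [f1 f2] [g1 g2]; rewrite /cint; apply/eqP; rewrite eq_complex /=.
rewrite -!rintD//; apply/andP; split; apply/eqP; congr (rint a b _); apply/funext => t;
  by case: (phi t) (psi t) => ? ? [].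
Qed.

Lemma cintZ a b c phi : ccont_on a b phi ->
  cint a b (fun t => c * phi t) = c * cint a b phi.
Proof.
case: c => c d [f1 f2]; rewrite /cint; apply/eqP; rewrite eq_complex /=.
have cZ (e : R) (h : R -> R) := @cont_onZ a b e h.
have -> : c * rint a b (fun t => complex.Re (phi t)) - d * rint a b (fun t => complex.Im (phi t))
    = rint a b (fun t => c * complex.Re (phi t) + - d * complex.Im (phi t)).
  by rewrite rintD ?rintZ ?mulNr//; exact: cZ.
have -> : c * rint a b (fun t => complex.Im (phi t)) + d * rint a b (fun t => complex.Re (phi t))
    = rint a b (fun t => c * complex.Im (phi t) + d * complex.Re (phi t)).
  by rewrite rintD ?rintZ//; exact: cZ.
apply/andP; split; apply/eqP; congr (rint a b _); apply/funext => t;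
  by case: (phi t) => ? ? /=; rewrite ?mulNr.
Qed.

Lemma cint_cst a b c : a <= b -> cint a b (fun=> c) = c * (b - a)%:C%C.
Proof.
move=> ab; rewrite /cint !rint_cst//; apply/eqP; rewrite eq_complex /=; case: c => c d /=.
by rewrite !mulr0 subr0 add0r !eqxx.
Qed.

Lemma cint_split a m b phi : a <= m <= b -> ccont_on a b phi ->
  cint a b phi = cint a m phi + cint m b phi.
Proof.
move=> amb [f1 f2]; rewrite /cint !(rint_split amb)//.
Qed.

(** Bounding the real and the imaginary part separately costs a factor 2, which
    is harmless: only the order of magnitude of the integrals is ever used. *)
Lemma cint_bound a b phi M : a <= b -> ccont_on a b phi ->
  (forall t, a <= t <= b -> normc (phi t) <= M) ->
  normc (cint a b phi) <= 2 * M * (b - a).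
Proof.
move=> ab [f1 f2] fM.
have bnd (f : R -> R) : cont_on a b f -> (forall t, a <= t <= b -> `|f t| <= M) ->
    `|rint a b f| <= M * (b - a).
  move=> fc fb; rewrite ler_norml -mulNr -!rint_cst//.
  have cc c := @cont_on_cst R a b c.
  by apply/andP; split; apply: rint_le => // t /fb; rewrite ler_norml => /andP[].
apply: le_trans (normc_le_ReIm _) _; rewrite /cint /=.
rewrite -mulrA mulr2n mulrDl mul1r; apply: lerD; apply: bnd => // t abt.
  exact: le_trans (Re_le_normc _) (fM _ abt).
exact: le_trans (Im_le_normc _) (fM _ abt).
Qed.

Definition in_rect (x y a b : R) (z : C) :=
  (x <= complex.Re z <= x + a) && (y <= complex.Im z <= y + b).

(** The integral of f along the positively oriented boundary: bottom, right, top
    and left side. *)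
Definition contour (x y a b : R) f : C :=
  cint x (x + a) (fun t => f (t +i* y)%C)
  + 'i%C * cint y (y + b) (fun t => f ((x + a) +i* t)%C)
  - cint x (x + a) (fun t => f (t +i* (y + b))%C)
  - 'i%C * cint y (y + b) (fun t => f (x +i* t)%C).

#[global] Arguments contour : simpl never.

Definition on_sides (x y a b : R) (z : C) := in_rect x y a b z &&
  ((complex.Re z \in [:: x; x + a]) || (complex.Im z \in [:: y; y + b])).

Definition sides_cont x y a b f := forall z, on_sides x y a b z ->
  {for z, continuous (f : C^o -> C^o)}.

Definition rect_cont x y a b f := forall z, in_rect x y a b z ->
  {for z, continuous (f : C^o -> C^o)}.

Lemma ccont_on_hor x a y f :
  (forall t, x <= t <= x + a -> {for (t +i* y)%C, continuous (f : C^o -> C^o)}) ->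
  ccont_on x (x + a) (fun t => f (t +i* y)%C).
Proof.
move=> fc; split=> t /fc /continuousC_epsP ft; apply/cvgrPdist_lt => e /ft[d d0 dP];
  apply/nbhs_ballP; exists d => // s; rewrite /ball /= => ts;
  have := dP (s +i* y)%C;
  rewrite (_ : _ - _ = (s - t)%:C%C); try (by apply/eqP; rewrite eq_complex /= subrr !eqxx);
  rewrite normc_real distrC => /(_ ts); apply: le_lt_trans; rewrite distrC -raddfB.
exact: Re_le_normc. exact: Im_le_normc.
Qed.

Lemma ccont_on_ver y b x f :
  (forall t, y <= t <= y + b -> {for (x +i* t)%C, continuous (f : C^o -> C^o)}) ->
  ccont_on y (y + b) (fun t => f (x +i* t)%C).
Proof.
move=> fc; split=> t /fc /continuousC_epsP ft; apply/cvgrPdist_lt => e /ft[d d0 dP];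
  apply/nbhs_ballP; exists d => // s; rewrite /ball /= => ts;
  have := dP (x +i* s)%C;
  rewrite (_ : _ - _ = 'i%C * (s - t)%:C%C);
    try (by apply/eqP; rewrite eq_complex /= subrr !mul0r !mul1r ?subrr ?addr0 ?add0r !eqxx);
  rewrite normc_mul normc_real [normc 'i%C]/= expr0n expr1n add0r sqrtr1 mul1r;
  rewrite distrC => /(_ ts); apply: le_lt_trans; rewrite distrC -raddfB.
exact: Re_le_normc. exact: Im_le_normc.
Qed.

Section Sides.
Variables (x y a b : R) (f : C -> C).
Hypotheses (a0 : 0 <= a) (b0 : 0 <= b) (fc : sides_cont x y a b f).

Lemma rect_bottom : ccont_on x (x + a) (fun t => f (t +i* y)%C).
Proof. by apply: ccont_on_hor => t tx; apply: fc; rewrite /on_sides /in_rect /= !inE tx !lexx !lerDl b0 eqxx ?orbT. Qed.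

Lemma rect_top : ccont_on x (x + a) (fun t => f (t +i* (y + b))%C).
Proof. by apply: ccont_on_hor => t tx; apply: fc; rewrite /on_sides /in_rect /= !inE tx !lexx !lerDl ?b0 eqxx ?orbT. Qed.

Lemma rect_left : ccont_on y (y + b) (fun t => f (x +i* t)%C).
Proof. by apply: ccont_on_ver => t ty; apply: fc; rewrite /on_sides /in_rect /= !inE ty !lexx !lerDl ?a0 eqxx ?orbT. Qed.

Lemma rect_right : ccont_on y (y + b) (fun t => f ((x + a) +i* t)%C).
Proof. by apply: ccont_on_ver => t ty; apply: fc; rewrite /on_sides /in_rect /= !inE ty !lexx !lerDl ?a0 eqxx ?orbT. Qed.
End Sides.

Lemma contourD x y a b f g : 0 <= a -> 0 <= b ->
  sides_cont x y a b f -> sides_cont x y a b g ->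
  contour x y a b (fun z => f z + g z) = contour x y a b f + contour x y a b g.
Proof.
move=> a0 b0 fc gc; rewrite /contour !cintD; first by ring.
all: by first [exact: (rect_bottom b0 fc)|exact: (rect_top b0 fc)|exact: (rect_left a0 fc)|exact: (rect_right a0 fc)|
  exact: (rect_bottom b0 gc)|exact: (rect_top b0 gc)|exact: (rect_left a0 gc)|exact: (rect_right a0 gc)].
Qed.

Lemma contourZ x y a b c f : 0 <= a -> 0 <= b -> sides_cont x y a b f ->
  contour x y a b (fun z => c * f z) = c * contour x y a b f.
Proof.
move=> a0 b0 fc; rewrite /contour !cintZ; first by ring.
all: by first [exact: (rect_bottom b0 fc)|exact: (rect_top b0 fc)|exact: (rect_left a0 fc)|exact: (rect_right a0 fc)].
Qed.

Lemma contour_cst x y a b c : contour x y a b (fun=> c) = 0.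
Proof. by rewrite /contour; ring. Qed.

(** Opposite sides contribute the increments of z times their common length, and
    the two contributions are i a b and - i a b. *)
Lemma contour_id x y a b : 0 <= a -> 0 <= b -> contour x y a b (fun z => z) = 0.
Proof.
move=> a0 b0.
have idc : sides_cont x y a b (fun z => z) by move=> z _; exact: cvg_id.
have shift (u v : R) (phi : R -> C) (c : C) : 0 <= v -> ccont_on u (u + v) phi ->
    cint u (u + v) (fun t => phi t + c) = cint u (u + v) phi + c * v%:C%C.
  move=> v0 phic; rewrite cintD//; last by split; exact: cont_on_cst.
  by rewrite cint_cst ?lerDl// [u + v]addrC addrK.
have := shift x a (fun t => (t +i* y)%C) ('i%C * b%:C%C) a0 (rect_bottom b0 idc).
have -> : (fun t => (t +i* y)%C + 'i%C * b%:C%C) = (fun t => (t +i* (y + b))%C).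
  by apply/funext => t; apply/eqP; rewrite eq_complex /=; apply/andP; split; apply/eqP; ring.
have := shift y b (fun t => (x +i* t)%C) (a%:C%C) b0 (rect_left a0 idc).
have -> : (fun t => (x +i* t)%C + a%:C%C) = (fun t => ((x + a) +i* t)%C).
  by apply/funext => t; apply/eqP; rewrite eq_complex /=; apply/andP; split; apply/eqP; ring.
by rewrite /contour => -> ->; ring.
Qed.

Lemma contour_bound x y a b f M : 0 <= a -> 0 <= b -> sides_cont x y a b f ->
  (forall z, on_sides x y a b z -> normc (f z) <= M) ->
  normc (contour x y a b f) <= 4 * M * (a + b).
Proof.
move=> a0 b0 fc fM; rewrite /contour.
have ni (z : C) : normc ('i%C * z) = normc z.
  by rewrite normc_mul [normc 'i%C]/= expr0n expr1n add0r sqrtr1 mul1r.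
apply: (@le_trans _ _ (2 * M * a + 2 * M * b + 2 * M * a + 2 * M * b)); last by lra.
have sub (z w : C) : normc (z - w) <= normc z + normc w.
  by apply: le_trans (normc_add _ _) _; rewrite normc_opp.
have xa : x <= x + a by rewrite lerDl.
have yb : y <= y + b by rewrite lerDl.
have dA : x + a - x = a by ring.
have dB : y + b - y = b by ring.
have bnd (u v : R) (phi : R -> C) : u <= v -> ccont_on u v phi ->
   (forall t, u <= t <= v -> normc (phi t) <= M) -> normc (cint u v phi) <= 2 * M * (v - u).
  exact: cint_bound.
apply: le_trans (sub _ _) _; apply: lerD; last first.
  rewrite ni -[X in _ * X]dB; apply: bnd => //; first exact: (rect_left a0 fc).
  by move=> t ty; apply: fM; rewrite /on_sides /in_rect /= ?ty ?lexx ?xa// !inE eqxx.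
apply: le_trans (sub _ _) _; apply: lerD; last first.
  rewrite -[X in _ * X]dA; apply: bnd => //; first exact: (rect_top b0 fc).
  by move=> t tx; apply: fM; rewrite /on_sides /in_rect /= ?tx ?lexx ?yb// !inE eqxx !orbT.
apply: le_trans (normc_add _ _) _; apply: lerD.
  rewrite -[X in _ * X]dA; apply: bnd => //; first exact: (rect_bottom b0 fc).
  by move=> t tx; apply: fM; rewrite /on_sides /in_rect /= ?tx ?lexx ?yb// !inE eqxx !orbT.
rewrite ni -[X in _ * X]dB; apply: bnd => //; first exact: (rect_right a0 fc).
by move=> t ty; apply: fM; rewrite /on_sides /in_rect /= ?ty ?lexx ?xa// !inE eqxx !orbT.
Qed.

Lemma rect_sides_cont x y a b f : rect_cont x y a b f -> sides_cont x y a b f.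
Proof. by move=> fc z /andP[zr _]; exact: fc. Qed.

(** The inner sides of the four parts are run through twice, in opposite
    directions. *)
Lemma contour_split x y a b c d f : 0 <= a -> 0 <= b -> 0 <= c -> 0 <= d ->
  rect_cont x y (a + c) (b + d) f ->
  contour x y (a + c) (b + d) f =
    contour x y a b f + contour (x + a) y c b f
    + contour x (y + b) a d f + contour (x + a) (y + b) c d f.
Proof.
move=> a0 b0 c0 d0 fc; rewrite /contour !addrA.
have X : x <= x + a <= x + a + c by rewrite !lerDl a0.
have Y : y <= y + b <= y + b + d by rewrite !lerDl b0.
have ac0 := addr_ge0 a0 c0; have bd0 := addr_ge0 b0 d0.
have := rect_bottom bd0 (rect_sides_cont fc); rewrite !addrA => fB.
have := rect_top bd0 (rect_sides_cont fc); rewrite !addrA => fT.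
have := rect_left ac0 (rect_sides_cont fc); rewrite !addrA => fL.
have := rect_right ac0 (rect_sides_cont fc); rewrite !addrA => fR.
rewrite (cint_split X fB) (cint_split X fT) (cint_split Y fL) (cint_split Y fR).
ring.
Qed.

End RectangleIntegral.

(** * Goursat's theorem *)

Section Goursat.
Variable R : realType.
Local Notation C := (R[i]).
Implicit Types (f g : C -> C).

Definition rect_holo (x y a b : R) f := forall z, in_rect x y a b z ->
  derivable (f : C^o -> C^o) z 1.

Lemma rect_holo_cont x y a b f : rect_holo x y a b f -> rect_cont x y a b f.
Proof. by move=> fh z /fh; exact: derivableC_continuous. Qed.

Lemma in_rect_sub x y a b x' y' a' b' (z : C) :
  x <= x' -> y <= y' -> x' + a' <= x + a -> y' + b' <= y + b ->
  in_rect x' y' a' b' z -> in_rect x y a b z.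
Proof.
move=> xx yy xa yb /andP[/andP[z1 z2] /andP[z3 z4]].
by rewrite /in_rect (le_trans xx z1) (le_trans z2 xa) (le_trans yy z3) (le_trans z4 yb).
Qed.

Lemma in_rect_dist x y a b (z w : C) : in_rect x y a b z -> in_rect x y a b w ->
  normc (z - w) <= a + b.
Proof.
move=> /andP[/andP[z1 z2] /andP[z3 z4]] /andP[/andP[w1 w2] /andP[w3 w4]].
apply: le_trans (normc_le_ReIm _) _; rewrite !raddfB.
by apply: lerD; rewrite ler_norml; apply/andP; split; lra.
Qed.

Lemma quarter_le (s a b c d : R) : s <= a + b + c + d ->
  [\/ s / 4 <= a, s / 4 <= b, s / 4 <= c | s / 4 <= d].
Proof.
move=> h; have [|ha] := leP (s / 4) a; first by move=> _; apply: Or41.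
have [|hb] := leP (s / 4) b; first by move=> _; apply: Or42.
have [|hc] := leP (s / 4) c; first by move=> _; apply: Or43.
by apply: Or44; lra.
Qed.

Lemma contour_bisect x y a b f : 0 < a -> 0 < b -> rect_cont x y a b f ->
  exists p : R * R, [/\ x <= p.1, y <= p.2, p.1 + a / 2 <= x + a, p.2 + b / 2 <= y + b
    & normc (contour x y a b f) / 4 <= normc (contour p.1 p.2 (a / 2) (b / 2) f)].
Proof.
move=> a0 b0 fc.
have a2 : 0 <= a / 2 by lra.
have b2 : 0 <= b / 2 by lra.
have xa : x <= x + a / 2 by lra.
have yb : y <= y + b / 2 by lra.
have xa' : x + a / 2 <= x + a by lra.
have yb' : y + b / 2 <= y + b by lra.
have xa2 : x + a / 2 + a / 2 <= x + a by lra.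
have yb2 : y + b / 2 + b / 2 <= y + b by lra.
have aE : a / 2 + a / 2 = a by lra.
have bE : b / 2 + b / 2 = b by lra.
have := @contour_split R x y (a / 2) (b / 2) (a / 2) (b / 2) f a2 b2 a2 b2.
rewrite aE bE => /(_ fc) ->.
set A := contour x y _ _ _; set B := contour (x + _) y _ _ _.
set D := contour x (y + _) _ _ _; set E := contour (x + _) (y + _) _ _ _.
have H : normc (A + B + D + E) <= normc A + normc B + normc D + normc E.
  by do 3 (apply: le_trans (normc_add _ _) _; rewrite lerD2r).
set S := normc (A + B + D + E) in H *.
have mk x' y' : x <= x' -> y <= y' -> x' + a / 2 <= x + a -> y' + b / 2 <= y + b ->
    S / 4 <= normc (contour x' y' (a / 2) (b / 2) f) ->
    exists p : R * R, [/\ x <= p.1, y <= p.2, p.1 + a / 2 <= x + a, p.2 + b / 2 <= y + b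
      & S / 4 <= normc (contour p.1 p.2 (a / 2) (b / 2) f)].
  by move=> *; exists (x', y'); split.
case: (quarter_le H); exact: mk.
Qed.

Lemma exp2_lim (K e : R) : 0 < e -> exists n, K / 2 ^+ n < e.
Proof.
move=> e0; have [K0|K0] := leP K 0.
  exists 0%N; rewrite expr0 divr1; exact: le_lt_trans K0 e0.
exists (Num.bound (K / e)); rewrite ltr_pdivrMr ?exprn_gt0// mulrC -ltr_pdivrMr//.
apply: lt_trans (archi_boundP _) _; first by rewrite divr_ge0 ?ltW.
by rewrite -natrX ltr_nat ltn_expl.
Qed.

(** The left endpoints increase and stay below every right endpoint, so their
    supremum lies in all the intervals. *)
Lemma nested_point (u : nat -> R) (c : R) : 0 < c ->
  (forall n, u n <= u n.+1) -> (forall n, u n.+1 + c / 2 ^+ n.+1 <= u n + c / 2 ^+ n) ->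
  exists p, forall n, u n <= p <= u n + c / 2 ^+ n.
Proof.
move=> c0 uS vS.
have um : {homo u : m n / (m <= n)%N >-> m <= n}.
  by apply: homo_leq => //; exact: le_trans.
have vm : {homo (fun n => u n + c / 2 ^+ n) : m n / (m <= n)%N >-> n <= m}.
  by apply: homo_leq => // n m p /[swap]; exact: le_trans.
have c2 n : 0 <= c / 2 ^+ n by rewrite divr_ge0 ?exprn_ge0// ltW.
have ub n : ubound (range u) (u n + c / 2 ^+ n).
  move=> _ [m _ <-]; apply: le_trans (vm _ _ (leq_maxl n m)).
  by apply: le_trans (um _ _ (leq_maxr n m)) _; rewrite lerDl.
exists (sup (range u)) => n; apply/andP; split.
  apply: ub_le_sup; last by exists n.
  by exists (u 0%N + c / 2 ^+ 0).
by apply: ge_sup => //; exists (u 0%N), 0%N.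
Qed.

(** Bisection keeps at least a quarter of the integral in one of the four parts,
    so if the integral were nonzero it would decrease at most like the area along
    a sequence of nested rectangles. At their common point f is affine up to an
    error that is small compared with the distance, affine functions have integral
    zero, and the integral of the error is small compared with the area. *)
Theorem goursat x y a b f : 0 < a -> 0 < b -> rect_holo x y a b f ->
  contour x y a b f = 0.
Proof.
move=> a0 b0 fh; apply/eqP; rewrite -normc_eq0; apply/negP => /negP h.
set beta := normc _ in h; have {h}beta0 : 0 < beta by rewrite lt0r h normc_ge0.
have fc := rect_holo_cont fh.
pose an n := a / 2 ^+ n; pose bn n := b / 2 ^+ n.
have an0 n : 0 < an n by rewrite divr_gt0 ?exprn_gt0.
have bn0 n : 0 < bn n by rewrite divr_gt0 ?exprn_gt0.
have anS n : an n.+1 = an n / 2 by rewrite /an exprSr invfM mulrA.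
have bnS n : bn n.+1 = bn n / 2 by rewrite /bn exprSr invfM mulrA.
pose good n (p : R * R) := [/\ x <= p.1, y <= p.2, p.1 + an n <= x + a,
  p.2 + bn n <= y + b & beta / 4 ^+ n <= normc (contour p.1 p.2 (an n) (bn n) f)].
have step n (p : R * R) : good n p -> { q : R * R | good n.+1 q /\
    [/\ p.1 <= q.1, p.2 <= q.2, q.1 + an n.+1 <= p.1 + an n & q.2 + bn n.+1 <= p.2 + bn n]}.
  move=> [p1 p2 p3 p4 p5]; apply: cid.
  have pc : rect_cont p.1 p.2 (an n) (bn n) f.
    by move=> z zp; apply: fc; exact: in_rect_sub zp.
  have [q] := contour_bisect (an0 n) (bn0 n) pc.
  rewrite -anS -bnS => -[q1 q2 q3 q4 q5]; exists q; split=> //; split.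
  - exact: le_trans p1 q1.
  - exact: le_trans p2 q2.
  - exact: le_trans q3 p3.
  - exact: le_trans q4 p4.
  - apply: le_trans q5; rewrite exprSr invfM mulrA.
    by rewrite ler_pM2r// invr_gt0.
have good0 : good 0%N (x, y) by split; rewrite /an /bn ?expr0 ?divr1.
pose fix corner n : {p | good n p} :=
  if n is m.+1 then exist _ _ (svalP (step m _ (svalP (corner m)))).1
  else exist _ _ good0.
pose cx n := (sval (corner n)).1; pose cy n := (sval (corner n)).2.
have cS n : [/\ cx n <= cx n.+1, cy n <= cy n.+1, cx n.+1 + an n.+1 <= cx n + an n
    & cy n.+1 + bn n.+1 <= cy n + bn n].
  by have [_] := svalP (step n _ (svalP (corner n))).
have [px pxP] : exists p, forall n, cx n <= p <= cx n + a / 2 ^+ n.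
  by apply: nested_point => // n; have [] := cS n.
have [py pyP] : exists p, forall n, cy n <= p <= cy n + b / 2 ^+ n.
  by apply: nested_point => // n; have [] := cS n.
pose p : C := (px +i* py)%C.
have pin n : in_rect (cx n) (cy n) (an n) (bn n) p by rewrite /in_rect /= pxP pyP.
have pQ : in_rect x y a b p.
  by have := pin 0%N; rewrite /cx /cy /an /bn /= expr0 !divr1.
have [c cP] := derivableC_eps (fh p pQ).
(* This e makes the bound 4 e (a + b)^2 on the rescaled integral half of beta. *)
pose e := beta / (8 * (a + b) ^+ 2).
have ab0 : 0 < a + b by rewrite addr_gt0.
have e0 : 0 < e by rewrite divr_gt0// mulr_gt0// exprn_gt0.
have [d d0 dP] := cP e e0.
have [n abn] := exp2_lim (a + b) d0.
have abE : an n + bn n = (a + b) / 2 ^+ n by rewrite -mulrDl.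
have [g1 g2 g3 g4 g5] := svalP (corner n).
have sub z : in_rect (cx n) (cy n) (an n) (bn n) z -> in_rect x y a b z.
  exact: in_rect_sub.
pose lin z := c * z + (f p - c * p).
pose rem z := f z + -1 * lin z.
have idc : sides_cont (cx n) (cy n) (an n) (bn n) (fun z => z).
  by move=> z _; exact: cvg_id.
have cstc (k : C) : sides_cont (cx n) (cy n) (an n) (bn n) (fun=> k).
  by move=> z _; exact: cst_continuous.
have fnc : sides_cont (cx n) (cy n) (an n) (bn n) f by move=> z /andP[/sub zr _]; exact: fc.
have mulc (k : C) g : sides_cont (cx n) (cy n) (an n) (bn n) g ->
    sides_cont (cx n) (cy n) (an n) (bn n) (fun z => k * g z).
  by move=> gc z zn; apply: continuousC_mul; [exact: cst_continuous|exact: gc].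
have addc g g' : sides_cont (cx n) (cy n) (an n) (bn n) g ->
    sides_cont (cx n) (cy n) (an n) (bn n) g' ->
    sides_cont (cx n) (cy n) (an n) (bn n) (fun z => g z + g' z).
  by move=> gc gc' z zn; apply: continuousC_add; [exact: gc|exact: gc'].
have linc : sides_cont (cx n) (cy n) (an n) (bn n) lin.
  exact: (addc _ _ (mulc c _ idc) (cstc (f p - c * p))).
have an0' := ltW (an0 n); have bn0' := ltW (bn0 n).
have lin0 : contour (cx n) (cy n) (an n) (bn n) lin = 0.
  rewrite (contourD an0' bn0' (mulc c _ idc) (cstc (f p - c * p))).
  by rewrite (contourZ _ an0' bn0' idc) contour_id// contour_cst mulr0 addr0.
have remE : contour (cx n) (cy n) (an n) (bn n) f = contour (cx n) (cy n) (an n) (bn n) rem.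
  rewrite (contourD an0' bn0' fnc (mulc (-1) _ linc)).
  by rewrite (contourZ _ an0' bn0' linc) lin0 mulr0 addr0.
have : normc (contour (cx n) (cy n) (an n) (bn n) rem) <= 4 * (e * (an n + bn n)) * (an n + bn n).
  apply: (contour_bound an0' bn0' (addc _ _ fnc (mulc (-1) _ linc))).
  move=> z /andP[zn _]; have zp := in_rect_dist zn (pin n).
  rewrite -[f z + _]/(rem z); have -> : rem z = f z - f p - c * (z - p) by rewrite /rem /lin; ring.
  apply: le_trans (dP _ _) _; first by apply: le_lt_trans zp _; rewrite abE.
  by rewrite ler_pM2l.
rewrite -remE => h; have {g5} := le_trans g5 h.
rewrite abE; apply/negP; rewrite -ltNge.
have -> : 4 * (e * ((a + b) / 2 ^+ n)) * ((a + b) / 2 ^+ n) = beta / 2 / 4 ^+ n.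
  have -> : (4 : R) ^+ n = 2 ^+ n * 2 ^+ n by rewrite -exprMn; congr (_ ^+ n); lra.
  have p2 : (2 : R) ^+ n != 0 by rewrite expf_neq0.
  rewrite /e; field; rewrite p2 /=; apply/eqP; lra.
by rewrite ltr_pM2r ?invr_gt0 ?exprn_gt0//; lra.
Qed.

(** Of the four quarters only the one at the exceptional corner contributes, so
    the integral over the whole rectangle equals the integrals over arbitrarily
    small rectangles at this corner, where f is bounded. *)
Lemma goursat_corner (x y a b : R) f (p : C) : 0 < a -> 0 < b ->
  complex.Re p \in [:: x; x + a] -> complex.Im p \in [:: y; y + b] ->
  rect_cont x y a b f ->
  (forall z, in_rect x y a b z -> z != p -> derivable (f : C^o -> C^o) z 1) ->
  contour x y a b f = 0.
Proof.
move=> a0 b0 px py fc fd.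
(* The lower left corner of the rectangle of sides c that has p as a corner. *)
pose X c := if complex.Re p == x then x else x + (a - c).
pose Y c := if complex.Im p == y then y else y + (b - c).
have half n : contour x y a b f = contour (X (a / 2 ^+ n)) (Y (b / 2 ^+ n)) (a / 2 ^+ n) (b / 2 ^+ n) f.
  elim: n => [|n ->]; first by rewrite /X /Y expr0 !divr1 !subrr !addr0 !if_same.
  set c := a / 2 ^+ n; set d := b / 2 ^+ n.
  have c0 : 0 < c by rewrite divr_gt0 ?exprn_gt0.
  have d0 : 0 < d by rewrite divr_gt0 ?exprn_gt0.
  have ca : c <= a.
    by rewrite ler_pdivrMr ?exprn_gt0// ler_pMr// exprn_ege1// ler1n.
  have db : d <= b.
    by rewrite ler_pdivrMr ?exprn_gt0// ler_pMr// exprn_ege1// ler1n.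
  have -> : a / 2 ^+ n.+1 = c / 2 by rewrite exprSr invfM mulrA.
  have -> : b / 2 ^+ n.+1 = d / 2 by rewrite exprSr invfM mulrA.
  have c2 : 0 < c / 2 by lra.
  have d2 : 0 < d / 2 by lra.
  have Xc : x <= X c <= x + a - c by rewrite /X; case: ifP => _; lra.
  have Yd : y <= Y d <= y + b - d by rewrite /Y; case: ifP => _; lra.
  have sub x' y' z : X c <= x' <= X c + c / 2 -> Y d <= y' <= Y d + d / 2 ->
      in_rect x' y' (c / 2) (d / 2) z -> in_rect x y a b z.
    by move=> hx hy; apply: in_rect_sub; lra.
  have := @contour_split R (X c) (Y d) (c / 2) (d / 2) (c / 2) (d / 2) f
    (ltW c2) (ltW d2) (ltW c2) (ltW d2).
  have -> : c / 2 + c / 2 = c by lra.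
  have -> : d / 2 + d / 2 = d by lra.
  have cc : rect_cont (X c) (Y d) c d f.
    by move=> z zc; apply: fc; apply: in_rect_sub zc; lra.
  move=> /(_ cc) ->.
  have zero x' y' : X c <= x' <= X c + c / 2 -> Y d <= y' <= Y d + d / 2 ->
      ~~ in_rect x' y' (c / 2) (d / 2) p -> contour x' y' (c / 2) (d / 2) f = 0.
    move=> hx hy pN; apply: goursat => // z zc; apply: fd; first exact: (sub x' y').
    by apply: contraNneq pN => <-.
  have Xh : X (c / 2) = if complex.Re p == x then X c else X c + c / 2.
    by rewrite /X; case: ifP => _; lra.
  have Yh : Y (d / 2) = if complex.Im p == y then Y d else Y d + d / 2.
    by rewrite /Y; case: ifP => _; lra.
  have hx1 : X c <= X c <= X c + c / 2 by lra.
  have hx2 : X c <= X c + c / 2 <= X c + c / 2 by lra.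
  have hy1 : Y d <= Y d <= Y d + d / 2 by lra.
  have hy2 : Y d <= Y d + d / 2 <= Y d + d / 2 by lra.
  have pX1 : complex.Re p == x -> forall w, ~~ (X c + c / 2 <= complex.Re p <= w).
    by move=> E w; rewrite /X E (eqP E) negb_and -ltNge; apply/orP; left; lra.
  have pX2 : (complex.Re p == x) = false -> ~~ (X c <= complex.Re p <= X c + c / 2).
    move=> E; rewrite /X E negb_and -!ltNge; apply/orP; right.
    by move: px; rewrite !inE E => /eqP ->; lra.
  have pY1 : complex.Im p == y -> forall w, ~~ (Y d + d / 2 <= complex.Im p <= w).
    by move=> E w; rewrite /Y E (eqP E) negb_and -ltNge; apply/orP; left; lra.
  have pY2 : (complex.Im p == y) = false -> ~~ (Y d <= complex.Im p <= Y d + d / 2).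
    move=> E; rewrite /Y E negb_and -!ltNge; apply/orP; right.
    by move: py; rewrite !inE E => /eqP ->; lra.
  rewrite Xh Yh; case: ifPn => [Ex|/negbTE Ex]; case: ifPn => [Ey|/negbTE Ey].
  - rewrite (zero (X c + c / 2) (Y d))// ?(zero (X c) (Y d + d / 2))//
      ?(zero (X c + c / 2) (Y d + d / 2))// ?addr0//;
    by rewrite /in_rect ?(negbTE (pX1 Ex _)) ?(negbTE (pY1 Ey _)) ?andbF.
  - rewrite (zero (X c + c / 2) (Y d))// ?(zero (X c) (Y d))//
      ?(zero (X c + c / 2) (Y d + d / 2))// ?addr0 ?add0r//;
    by rewrite /in_rect ?(negbTE (pX1 Ex _)) ?(negbTE (pY2 Ey)) ?andbF.
  - rewrite (zero (X c) (Y d))// ?(zero (X c) (Y d + d / 2))//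
      ?(zero (X c + c / 2) (Y d + d / 2))// ?addr0 ?add0r//;
    by rewrite /in_rect ?(negbTE (pX2 Ex)) ?(negbTE (pY1 Ey _)) ?andbF.
  - rewrite (zero (X c) (Y d))// ?(zero (X c) (Y d + d / 2))//
      ?(zero (X c + c / 2) (Y d))// ?addr0 ?add0r//;
    by rewrite /in_rect ?(negbTE (pX2 Ex)) ?(negbTE (pY2 Ey)) ?andbF.
have pin : in_rect x y a b p.
  move: px py; rewrite /in_rect !inE => /orP[]/eqP-> /orP[]/eqP->;
  by rewrite ?lexx ?lerDl ?ltW.
have /continuousC_epsP/(_ 1 ltr01)[d d0 dP] := fc p pin.
apply/eqP; rewrite -normc_eq0 eq_le normc_ge0 andbT; apply/ler_addgt0Pr => e e0.
pose M := normc (f p) + 1.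
have M0 : 0 < M by rewrite ltr_pwDr// normc_ge0.
have m0 : 0 < Num.min d (e / (4 * M)) by rewrite lt_min d0 divr_gt0// mulr_gt0.
have [n hn] := exp2_lim (a + b) m0.
rewrite (half n) add0r; set c := a / 2 ^+ n; set h := b / 2 ^+ n.
have c0 : 0 < c by rewrite divr_gt0 ?exprn_gt0.
have h0 : 0 < h by rewrite divr_gt0 ?exprn_gt0.
have ca : c <= a by rewrite ler_pdivrMr ?exprn_gt0// ler_pMr// exprn_ege1// ler1n.
have hb : h <= b by rewrite ler_pdivrMr ?exprn_gt0// ler_pMr// exprn_ege1// ler1n.
have chE : c + h = (a + b) / 2 ^+ n by rewrite -mulrDl.
have Xc : x <= X c <= x + a - c by rewrite /X; case: ifP => _; lra.
have Yh : y <= Y h <= y + b - h by rewrite /Y; case: ifP => _; lra.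
have pn : in_rect (X c) (Y h) c h p.
  rewrite /in_rect; apply/andP; split.
    move: px; rewrite /X !inE; have [->|_ /= /eqP ->] := eqVneq (complex.Re p) x => /=; lra.
  move: py; rewrite /Y !inE; have [->|_ /= /eqP ->] := eqVneq (complex.Im p) y => /=; lra.
apply: (@le_trans _ _ (4 * M * (c + h))).
  apply: contour_bound; rewrite ?ltW//.
    by move=> z /andP[zc _]; apply: fc; apply: in_rect_sub zc; lra.
  move=> z /andP[zn _]; have zp := in_rect_dist zn pn.
  have : normc (f z - f p) < 1.
    apply: dP; apply: le_lt_trans zp _; rewrite chE; apply: lt_le_trans hn _.
    by rewrite ge_min lexx.
  by have := normc_sub_le (f z) (f p); rewrite /M; lra.
rewrite chE; have : (a + b) / 2 ^+ n <= e / (4 * M).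
  by apply: ltW; apply: lt_le_trans hn _; rewrite ge_min lexx orbT.
by rewrite ler_pdivlMr ?mulr_gt0// mulrC.
Qed.

(** Cutting the rectangle through p makes p a corner of each of the four parts. *)
Lemma goursat_point (x y a b : R) f (p : C) :
  x < complex.Re p < x + a -> y < complex.Im p < y + b ->
  rect_cont x y a b f ->
  (forall z, in_rect x y a b z -> z != p -> derivable (f : C^o -> C^o) z 1) ->
  contour x y a b f = 0.
Proof.
move=> px py fc fd.
pose a1 := complex.Re p - x; pose a2 := x + a - complex.Re p.
pose b1 := complex.Im p - y; pose b2 := y + b - complex.Im p.
have a10 : 0 < a1 by rewrite /a1; lra.
have a20 : 0 < a2 by rewrite /a2; lra.
have b10 : 0 < b1 by rewrite /b1; lra.
have b20 : 0 < b2 by rewrite /b2; lra.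
have aE : a1 + a2 = a by rewrite /a1 /a2; lra.
have bE : b1 + b2 = b by rewrite /b1 /b2; lra.
have := @contour_split R x y a1 b1 a2 b2 f (ltW a10) (ltW b10) (ltW a20) (ltW b20).
rewrite aE bE => /(_ fc) ->.
have corner x' y' c d : x <= x' -> y <= y' -> x' + c <= x + a -> y' + d <= y + b ->
    0 < c -> 0 < d -> complex.Re p \in [:: x'; x' + c] -> complex.Im p \in [:: y'; y' + d] ->
    contour x' y' c d f = 0.
  move=> hx hy hc hd c0 d0 pX pY; apply: (goursat_corner (p := p)) => //.
    by move=> z zc; apply: fc; exact: in_rect_sub zc.
  by move=> z zc; apply: fd; exact: in_rect_sub zc.
have xE : x + a1 = complex.Re p by rewrite /a1; ring.
have yE : y + b1 = complex.Im p by rewrite /b1; ring.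
have xE2 : complex.Re p + a2 = x + a by rewrite /a2; ring.
have yE2 : complex.Im p + b2 = y + b by rewrite /b2; ring.
rewrite xE yE.
rewrite !corner ?addr0// ?xE ?yE ?xE2 ?yE2 ?inE ?eqxx ?orbT//; lra.
Qed.

End Goursat.

(** * Holomorphic functions and the winding number of a square *)

Section Holomorphic.
Variable R : realType.
Local Notation C := (R[i]).
Local Notation holo f z := (derivable (f : C^o -> C^o) z 1).
Implicit Types (f g : C -> C).

Lemma holo_cst (c : C) z : holo (fun=> c) z.
Proof. exact: (@derivable_cst C C^o C^o c z 1). Qed.

Lemma holo_id z : holo (fun w : C => w) z.
Proof. exact: (@derivable_id C C^o z 1). Qed.

Lemma holoB f g z : holo f z -> holo g z -> holo (fun w => f w - g w) z.
Proof. by move=> fz gz; exact: (@derivableB C C^o C^o f g z 1 fz gz). Qed.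

Lemma holoM f g z : holo f z -> holo g z -> holo (fun w => f w * g w) z.
Proof. by move=> fz gz; exact: (@derivableM C C^o f g z 1 fz gz). Qed.

Lemma holoV f z : f z != 0 -> holo f z -> holo (fun w => (f w)^-1) z.
Proof. by move=> f0 fz; exact: (@derivableV C C^o f z 1 f0 fz). Qed.

Lemma holoX n (z : C) : holo (fun w : C => w ^+ n) z.
Proof.
elim: n => [|n IH]; first exact: holo_cst.
have -> : (fun w : C => w ^+ n.+1) = (fun w => w * w ^+ n).
  by apply/funext => w; rewrite exprS.
exact: (holoM (@holo_id z) IH).
Qed.

Lemma holo_near f g (z : C) d : 0 < d -> (forall w, normc (w - z) < d -> f w = g w) ->
  holo f z -> holo g z.
Proof.
move=> d0 fg; apply: (@near_eq_derivable C C^o C^o).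
by apply/nearC_epsP; exists d.
Qed.

Lemma holo_poly (p : {poly C}) z : holo (fun w : C => p.[w]) z.
Proof.
elim/poly_ind: p => [|p c IH].
  have -> : (fun w : C => (0 : {poly C}).[w]) = (fun=> 0).
    by apply/funext => w; rewrite horner0.
  exact: holo_cst.
have -> : (fun w : C => (p * 'X + c%:P).[w]) = (fun w => p.[w] * w - - c).
  by apply/funext => w; rewrite hornerMXaddC opprK.
exact: (holoB (holoM IH (@holo_id z)) (@holo_cst (- c) z)).
Qed.

Lemma holo_shift f (a z : C) : holo f (a + z) -> holo (fun w => f (a + w)) z.
Proof.
suff <- : holo (fun w => f (a + w)) z = holo f (a + z) by [].
rewrite /derivable; congr ((fun q : C^o -> C^o => cvg (q @ (0 : C^o)^')) _).
by apply/funext => h /=; rewrite addrCA.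
Qed.

(** On each of the four sides the integrand of the imaginary part is bounded below
    by m > 0, so the integral has positive imaginary part. *)
Lemma winding_gt0 (r : R) (w : C) : normc w < r ->
  contour (- r) (- r) (2 * r) (2 * r) (fun z => (z - w)^-1) != 0.
Proof.
move=> wr; have r0 : 0 < r := le_lt_trans (normc_ge0 _) wr.
have r2 : 0 <= 2 * r by lra.
pose s := r - normc w; have s0 : 0 < s by rewrite subr_gt0.
pose m := s / (16 * r ^+ 2).
have m0 : 0 < m by rewrite divr_gt0// mulr_gt0// exprn_gt0.
have rr : - r + 2 * r = r by lra.
have wRe := Re_le_normc w; have wIm := Im_le_normc w.
move: wRe wIm; rewrite !ler_norml => /andP[wr1 wr2] /andP[wi1 wi2].
have sc : sides_cont (- r) (- r) (2 * r) (2 * r) (fun z => (z - w)^-1).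
  move=> z /andP[_ zs]; apply: derivableC_continuous; apply: (@holoV (fun z => z - w)).
    apply/eqP => zw; have zE : z = w by apply/eqP; rewrite -subr_eq0 zw.
    move: zs; rewrite zE !inE rr.
    by case/orP => /orP[]/eqP; lra.
  exact: (holoB (@holo_id z) (@holo_cst w z)).
have ReV (z : C) : complex.Re z^-1 = complex.Re z / (complex.Re z ^+ 2 + complex.Im z ^+ 2) by case: z.
have ImV (z : C) : complex.Im z^-1 = - complex.Im z / (complex.Re z ^+ 2 + complex.Im z ^+ 2).
  by case: z => ? ? /=; rewrite mulNr.
have frac (n d : R) : s <= n -> 0 < d -> d <= 16 * r ^+ 2 -> m <= n / d.
  move=> sn d0 dr; rewrite /m; apply: ler_pM => //; first exact: ltW.
    by rewrite invr_ge0 mulr_ge0// sqr_ge0.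
  by rewrite lef_pV2 ?posrE// mulr_gt0// exprn_gt0.
have sq (u v : R) : - (2 * r) <= u <= 2 * r -> s <= `|v| -> - (2 * r) <= v <= 2 * r ->
   0 < u ^+ 2 + v ^+ 2 <= 16 * r ^+ 2.
  move=> ur sv vr; apply/andP; split.
    rewrite ltr_wpDl ?sqr_ge0// -real_normK ?num_real// exprn_gt0//.
    exact: lt_le_trans s0 sv.
  by nra.
have low u v (h : R -> R) c : u <= v -> cont_on u v h -> (forall t, u <= t <= v -> c <= h t) ->
    c * (v - u) <= rint u v h.
  by move=> uv hc hb; rewrite -rint_cst//; apply: rint_le => //; exact: cont_on_cst.
have upp u v (h : R -> R) c : u <= v -> cont_on u v h -> (forall t, u <= t <= v -> h t <= c) ->
    rint u v h <= c * (v - u).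
  by move=> uv hc hb; rewrite -rint_cst//; apply: rint_le => //; exact: cont_on_cst.
have [_ cB] := rect_bottom r2 sc; have [_ cT] := rect_top r2 sc.
have [cL _] := rect_left r2 sc; have [cR _] := rect_right r2 sc.
move: cB cT cL cR; rewrite rr => cB cT cL cR.
have rI : - r <= r by lra.
have len : r - - r = 2 * r by ring.
have sN (v : R) : s <= v -> s <= `|v| by move=> h; rewrite (le_trans h)// ler_norm.
have sN' (v : R) : s <= - v -> s <= `|v| by move=> h; rewrite (le_trans h)// -normrN ler_norm.
pose w1 := complex.Re w; pose w2 := complex.Im w.
have [b1 b2] : - (r - s) <= w1 <= r - s /\ - (r - s) <= w2 <= r - s.
  by rewrite /s /w1 /w2; split; apply/andP; split; lra.
have ReB := (fun z => raddfB (@complex.Re R) z w, fun z => raddfB (@complex.Im R) z w).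
have ReE p q : complex.Re ((p +i* q)%C - w)^-1 = (p - w1) / ((p - w1) ^+ 2 + (q - w2) ^+ 2).
  by rewrite ReV /w1 /w2 !ReB.
have ImE p q : complex.Im ((p +i* q)%C - w)^-1 = - (q - w2) / ((p - w1) ^+ 2 + (q - w2) ^+ 2).
  by rewrite ImV /w1 /w2 !ReB.
clearbody s w1 w2.
have B : m * (2 * r) <= rint (- r) r (fun t => complex.Im ((t +i* - r)%C - w)^-1).
  rewrite -len; apply: low => // t tr; rewrite ImE.
  have /andP[q1 q2] : 0 < (t - w1) ^+ 2 + (- r - w2) ^+ 2 <= 16 * r ^+ 2.
    by apply: sq; rewrite ?sN'; lra.
  by apply: frac => //; lra.
have T : rint (- r) r (fun t => complex.Im ((t +i* r)%C - w)^-1) <= - m * (2 * r).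
  rewrite -len; apply: upp => // t tr; rewrite ImE.
  have /andP[q1 q2] : 0 < (t - w1) ^+ 2 + (r - w2) ^+ 2 <= 16 * r ^+ 2.
    by apply: sq; rewrite ?sN; lra.
  by rewrite mulNr lerN2; apply: frac => //; lra.
have Rt : m * (2 * r) <= rint (- r) r (fun t => complex.Re ((r +i* t)%C - w)^-1).
  rewrite -len; apply: low => // t tr; rewrite ReE.
  have /andP[q1 q2] : 0 < (t - w2) ^+ 2 + (r - w1) ^+ 2 <= 16 * r ^+ 2.
    by apply: sq; rewrite ?sN; lra.
  by rewrite addrC in q1 q2; apply: frac => //; lra.
have L : rint (- r) r (fun t => complex.Re ((- r +i* t)%C - w)^-1) <= - m * (2 * r).
  rewrite -len; apply: upp => // t tr; rewrite ReE.
  have /andP[q1 q2] : 0 < (t - w2) ^+ 2 + (- r - w1) ^+ 2 <= 16 * r ^+ 2.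
    by apply: sq; rewrite ?sN'; lra.
  rewrite -[X in X / _]opprK mulNr lerN2 addrC; apply: frac => //; lra.
apply/eqP => /(congr1 (@complex.Im R)); rewrite /contour !rr /=.
rewrite !mul0r !mul1r !add0r.
have : 0 < m * (2 * r) by rewrite mulr_gt0//; lra.
move: B T Rt L; lra.
Qed.

End Holomorphic.

(** * Cauchy's estimate and the identity theorem *)

Section Identity.
Variable R : realType.
Local Notation C := (R[i]).
Local Notation holo f z := (derivable (f : C^o -> C^o) z 1).
Local Notation square f r := (rect_holo (- r) (- r) (2 * r) (2 * r) f).
Implicit Types (f g : C -> C).

Lemma square_sides (r : R) (z : C) : 0 < r ->
  on_sides (- r) (- r) (2 * r) (2 * r) z -> r <= normc z.
Proof.
move=> r0; have rr : - r + 2 * r = r by lra.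
have rN : `|- r| = r by rewrite normrN ger0_norm// ltW.
have rP : `|r| = r by rewrite ger0_norm// ltW.
rewrite /on_sides rr !inE => /andP[_ /orP[]].
  by case/orP => /eqP h; have := Re_le_normc z; rewrite h ?rN ?rP.
by case/orP => /eqP h; have := Im_le_normc z; rewrite h ?rN ?rP.
Qed.

(** The difference quotient g of f at w is continuous in the square and
    differentiable away from w, so its contour integral vanishes; this expresses
    f(w) times the winding number as the integral of f(z) / (z - w). *)
Lemma cauchy_bound (r : R) (w : C) : normc w < r -> exists2 K : R, 0 <= K &
  forall f M, square f r ->
    (forall z, on_sides (- r) (- r) (2 * r) (2 * r) z -> normc (f z) <= M) ->
    normc (f w) <= K * M.
Proof.
move=> wr; have r0 : 0 < r := le_lt_trans (normc_ge0 _) wr.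
have r2 : 0 <= 2 * r by lra.
have W0 := winding_gt0 wr.
set W := contour _ _ _ _ _ in W0.
pose s := r - normc w; have s0 : 0 < s by rewrite subr_gt0.
exists (16 * r / (s * normc W)).
  by rewrite divr_ge0// ?mulr_ge0 ?normc_ge0// ltW.
move=> f M fh fM.
have wRe := Re_le_normc w; have wIm := Im_le_normc w.
have inw : in_rect (- r) (- r) (2 * r) (2 * r) w.
  by move: wRe wIm; rewrite /in_rect !ler_norml => /andP[? ?] /andP[? ?]; lra.
have [c cP] := derivableC_eps (fh w inw).
pose g z := if z == w then c else (f z - f w) * (z - w)^-1.
have gd z : in_rect (- r) (- r) (2 * r) (2 * r) z -> z != w -> holo g z.
  move=> zr zw; have d0 : 0 < normc (w - z) by rewrite normc_gt0 subr_eq0 eq_sym.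
  apply: (@holo_near _ (fun z => (f z - f w) * (z - w)^-1) g z _ d0).
    move=> v vz; rewrite /g; case: eqP => // vw.
    by move: vz; rewrite vw ltxx.
  have zw0 : (fun z => z - w) z != 0 by rewrite subr_eq0.
  exact: (holoM (holoB (fh z zr) (@holo_cst _ (f w) z))
    (@holoV _ (fun z => z - w) z zw0 (holoB (@holo_id _ z) (@holo_cst _ w z)))).
have gc : rect_cont (- r) (- r) (2 * r) (2 * r) g.
  move=> z zr; have [->|zw] := eqVneq z w; last first.
    by apply: derivableC_continuous; exact: gd.
  apply/continuousC_epsP => e e0; have e20 : 0 < e / 2 by lra.
  have [d d0 dP] := cP _ e20; exists d => // v vw.
  rewrite /g eqxx; case: eqP => [_|/eqP vNw]; first by rewrite subrr normc0.
  have n0 : 0 < normc (v - w) by rewrite normc_gt0 subr_eq0.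
  rewrite -(ltr_pM2r n0) -normc_mul mulrBl divfK ?subr_eq0//.
  by apply: le_lt_trans (dP v vw) _; rewrite ltr_pM2r//; lra.
have g0 : contour (- r) (- r) (2 * r) (2 * r) g = 0.
  apply: (goursat_point (p := w)) => //; move: wRe wIm;
    rewrite !ler_norml => /andP[? ?] /andP[? ?]; lra.
have swr z : on_sides (- r) (- r) (2 * r) (2 * r) z -> s <= normc (z - w).
  move=> /(square_sides r0) zr; apply: le_trans (normc_sub_le z w).
  by rewrite /s lerB.
have zwN z : on_sides (- r) (- r) (2 * r) (2 * r) z -> z != w.
  by move=> /swr h; rewrite -subr_eq0 -normc_gt0; exact: lt_le_trans h.
have ic : sides_cont (- r) (- r) (2 * r) (2 * r) (fun z => (z - w)^-1).
  move=> z zs; apply: derivableC_continuous.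
  have zw0 : (fun z => z - w) z != 0 by rewrite subr_eq0 zwN.
  exact: (@holoV _ (fun z => z - w) z zw0 (holoB (@holo_id _ z) (@holo_cst _ w z))).
have fic : sides_cont (- r) (- r) (2 * r) (2 * r) (fun z => f w * (z - w)^-1).
  by move=> z zs; apply: continuousC_mul; [exact: cst_continuous|exact: ic].
have kc : sides_cont (- r) (- r) (2 * r) (2 * r) (fun z => g z + f w * (z - w)^-1).
  move=> z zs; apply: continuousC_add; last exact: fic.
  by apply: gc; case/andP: zs.
have E : contour (- r) (- r) (2 * r) (2 * r) (fun z => g z + f w * (z - w)^-1) = f w * W.
  by rewrite (contourD r2 r2 (rect_sides_cont gc) fic) g0 add0r (contourZ _ r2 r2 ic).
have := contour_bound r2 r2 kc (M := M / s).
rewrite E normc_mul => h.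
have {}h : normc (f w) * normc W <= 4 * (M / s) * (2 * r + 2 * r).
  apply: h => z zs; rewrite /g (negbTE (zwN z zs)) -mulrDl subrK normc_mul.
  have M0 : 0 <= M := le_trans (normc_ge0 _) (fM z zs).
  rewrite normcV ler_pM ?normc_ge0 ?invr_ge0 ?normc_ge0 ?fM//.
  by rewrite lef_pV2 ?posrE ?normc_gt0 ?subr_eq0 ?zwN// swr.
have nW : 0 < normc W by rewrite normc_gt0.
rewrite -(ler_pM2r nW); apply: le_trans h _.
rewrite le_eqVlt; apply/orP; left; apply/eqP; field.
by rewrite !gt_eqF.
Qed.

Lemma cont_on_bounded (a b : R) (f : R -> R) : a <= b -> cont_on a b f ->
  exists M, forall t, a <= t <= b -> `|f t| <= M.
Proof.
move=> ab /cont_on_within fc.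
have [c _ cP] := EVT_max ab fc; have [d _ dP] := EVT_min ab fc.
exists (`|f c| + `|f d|) => t tab.
have := cP t; have := dP t; rewrite in_itv /= tab => /(_ isT) h1 /(_ isT) h2.
rewrite ler_norml; apply/andP; split.
  by have := ler_norm (- f d); rewrite normrN; have := normr_ge0 (f c); lra.
by have := ler_norm (f c); have := normr_ge0 (f d); lra.
Qed.

Lemma ccont_on_bounded (a b : R) (phi : R -> C) : a <= b -> ccont_on a b phi ->
  exists M, forall t, a <= t <= b -> normc (phi t) <= M.
Proof.
move=> ab [/(cont_on_bounded ab)[M MP] /(cont_on_bounded ab)[N NP]].
exists (M + N) => t tab; apply: le_trans (normc_le_ReIm _) _.
by apply: lerD; [exact: MP|exact: NP].
Qed.

Lemma sides_bounded (x y a b : R) f : 0 <= a -> 0 <= b -> sides_cont x y a b f ->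
  exists M, forall z, on_sides x y a b z -> normc (f z) <= M.
Proof.
move=> a0 b0 fc; have xa : x <= x + a by rewrite lerDl.
have yb : y <= y + b by rewrite lerDl.
have [B BP] := ccont_on_bounded xa (rect_bottom b0 fc).
have [T TP] := ccont_on_bounded xa (rect_top b0 fc).
have [L LP] := ccont_on_bounded yb (rect_left a0 fc).
have [Q QP] := ccont_on_bounded yb (rect_right a0 fc).
exists (Num.max (Num.max B T) (Num.max L Q)) => -[u v] /andP[/andP[/= hu hv]].
rewrite !inE => /orP[]/orP[]/eqP ->; rewrite !le_max.
- by rewrite LP// ?orbT.
- by rewrite QP// ?orbT.
- by rewrite BP.
- by rewrite TP// ?orbT.
Qed.

Lemma expr_small (q e : R) : 0 <= q < 1 -> 0 < e -> exists n, q ^+ n < e.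
Proof.
move=> /andP[q0 q1] e0.
have : (GRing.exp q : nat -> R) @ \oo --> (0 : R) by apply: cvg_expr; rewrite ger0_norm.
move=> /cvgrPdist_lt/(_ e e0) [N _ /(_ N (leqnn N))] /=.
by rewrite sub0r normrN ger0_norm ?exprn_ge0// => h; exists N.
Qed.

(** As f vanishes near 0, the quotient f(z) / z^n is holomorphic in the square for
    every n. Cauchy's estimate for this quotient bounds f(w) by a constant times
    the n-th power of the ratio of the modulus of w to r, which is less than 1. *)
Lemma vanish_square f (r d : R) : 0 < d -> square f r ->
  (forall z, normc z < d -> f z = 0) -> forall w, normc w < r -> f w = 0.
Proof.
move=> d0 fh f0 w wr; have r0 : 0 < r := le_lt_trans (normc_ge0 _) wr.
have r2 : 0 <= 2 * r by lra.
have [->|w0] := eqVneq w 0; first by apply: f0; rewrite normc0.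
have [K K0 KP] := cauchy_bound wr.
have [M MP] := sides_bounded r2 r2 (rect_sides_cont (rect_holo_cont fh)).
pose fn n z := f z * (z ^+ n)^-1.
have fnh n : square (fn n) r.
  move=> z zr; have [z0|z0] := eqVneq z 0.
    apply: (@holo_near _ (fun=> 0) (fn n) z d d0); last exact: holo_cst.
    by move=> v; rewrite z0 subr0 /fn => /f0 ->; rewrite mul0r.
  have zn0 : (fun z : C => z ^+ n) z != 0 by rewrite expf_neq0.
  exact: (holoM (fh z zr) (@holoV _ (fun z => z ^+ n) z zn0 (@holoX _ n z))).
have bound n : normc (f w) <= K * M * (normc w / r) ^+ n.
  have wn0 : w ^+ n != 0 by rewrite expf_neq0.
  have -> : f w = fn n w * w ^+ n by rewrite /fn divfK.
  rewrite normc_mul normc_exp expr_div_n mulrA mulrAC.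
  apply: ler_wpM2r; first by rewrite exprn_ge0// normc_ge0.
  rewrite -mulrA; apply: (KP (fn n) (M / r ^+ n) (fnh n)) => z zs.
  rewrite /fn normc_mul normcV normc_exp; apply: ler_pM; rewrite ?normc_ge0//.
  - by rewrite invr_ge0 exprn_ge0// normc_ge0.
  - exact: MP.
  - by rewrite lef_pV2 ?posrE ?exprn_gt0 ?lerXn2r ?nnegrE ?normc_ge0 ?square_sides// ?(ltW r0)//
      (lt_le_trans r0)// square_sides.
apply/eqP; rewrite -normc_eq0 eq_le normc_ge0 andbT; apply/ler_addgt0Pr => e e0.
rewrite add0r; have q01 : 0 <= normc w / r < 1.
  by rewrite divr_ge0 ?normc_ge0 ?(ltW r0)//= ltr_pdivrMr// mul1r.
have e1 : 0 < e / (`|K * M| + 1) by rewrite divr_gt0// ltr_wpDl.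
have [n qn] := expr_small q01 e1.
apply: le_trans (bound n) _.
apply: (@le_trans _ _ ((`|K * M| + 1) * (normc w / r) ^+ n)).
  apply: ler_wpM2r; first by rewrite exprn_ge0//; case/andP: q01.
  by rewrite (le_trans (ler_norm _))// lerDl.
by rewrite mulrC -ler_pdivlMr ?ltr_wpDl// ltW.
Qed.

Lemma vanish_ball f (a : C) (rho d : R) : 0 < d ->
  (forall z, normc (z - a) < rho -> holo f z) ->
  (forall z, normc (z - a) < d -> f z = 0) ->
  forall w, normc (w - a) < rho / 4 -> f w = 0.
Proof.
move=> d0 fh f0 w wa; have ra : 0 < rho by have := normc_ge0 (w - a); lra.
have -> : w = a + (w - a) by rewrite addrC subrK.
apply: (@vanish_square (fun z => f (a + z)) (rho / 4) d d0) => //.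
  move=> z /andP[/andP[z1 z2] /andP[z3 z4]]; apply: holo_shift; apply: fh.
  rewrite addrC addKr; apply: le_lt_trans (normc_le_ReIm _) _.
  have h1 : `|complex.Re z| <= rho / 4 by rewrite ler_norml; lra.
  have h2 : `|complex.Im z| <= rho / 4 by rewrite ler_norml; lra.
  lra.
by move=> z zd; apply: f0; rewrite addrC addKr.
Qed.

(** The supremum s of the parameters at which f vanishes locally is attained, and
    it is 1: a disc around a point of the path just before s reaches beyond s. *)
Lemma identity_along_path f (gam : R -> C) (L d : R) : 0 < L ->
  (forall s t, 0 <= s <= 1 -> 0 <= t <= 1 -> normc (gam s - gam t) <= L * `|s - t|) ->
  (forall t, 0 <= t <= 1 -> exists2 rho, 0 < rho &
     forall z, normc (z - gam t) < rho -> holo f z) ->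
  0 < d -> (forall z, normc (z - gam 0) < d -> f z = 0) -> f (gam 1) = 0.
Proof.
move=> L0 gL gh d0 f0.
pose A : set R := [set t | 0 <= t <= 1 /\ exists2 d, 0 < d &
  forall z, normc (z - gam t) < d -> f z = 0].
have A0 : A 0 by split; [rewrite lexx ler01|exists d].
have ubA : ubound A 1 by move=> t [/andP[]].
have supA : has_sup A by split; [exists 0|exists 1].
set s := sup A.
have s01 : 0 <= s <= 1.
  apply/andP; split; first by apply: ub_le_sup => //; exists 1.
  by apply: ge_sup => //; exists 0.
have [rho rho0 rhoP] := gh s s01.
pose eta := rho / (16 * L).
have eta0 : 0 < eta by rewrite divr_gt0// mulr_gt0.
have Leta : L * eta = rho / 16 by rewrite /eta; field; rewrite gt_eqF.
have [t At] := sup_adherent eta0 supA; rewrite -/s => ts.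
have ts' : t <= s by apply: ub_le_sup => //; exists 1.
have [t01 [d' d'0 d'P]] := At.
have gts : normc (gam s - gam t) <= rho / 16.
  apply: le_trans (gL _ _ s01 t01) _; rewrite -Leta; apply: ler_wpM2l; first exact: ltW.
  by rewrite ler_norml; lra.
have van z : normc (z - gam s) < rho / 16 -> f z = 0.
  move=> zs; apply: (@vanish_ball f (gam t) (rho / 2) d' d'0) => //.
    move=> v vt; apply: rhoP.
    have -> : v - gam s = (v - gam t) + (gam t - gam s) by ring.
    by apply: le_lt_trans (normc_add _ _) _; rewrite (normc_dist (gam t)); lra.
  have -> : z - gam t = (z - gam s) + (gam s - gam t) by ring.
  by apply: le_lt_trans (normc_add _ _) _; lra.
have rho16 : 0 < rho / 16 by lra.
have [s1|s1] := eqVneq s 1.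
  by rewrite -s1; apply: van; rewrite subrr normc0.
have s1' : s < 1 by rewrite lt_neqAle s1; case/andP: s01.
pose t' := Num.min 1 (s + eta / 2).
have t'1 : t' <= 1 by rewrite /t' ge_min lexx.
have t'2 : t' <= s + eta / 2 by rewrite /t' ge_min lexx orbT.
have st' : s < t' by rewrite /t' lt_min s1' /=; lra.
have t'01 : 0 <= t' <= 1 by lra.
suff At' : A t'.
  have hA : has_ubound A by exists 1.
  by have := ub_le_sup hA At'; rewrite -/s leNgt st'.
split=> //; exists (rho / 32); first lra.
move=> z zt; apply: van.
have -> : z - gam s = (z - gam t') + (gam t' - gam s) by ring.
apply: le_lt_trans (normc_add _ _) _.
have : normc (gam t' - gam s) <= rho / 32.
  apply: le_trans (gL _ _ t'01 s01) _.
  have -> : rho / 32 = L * (eta / 2) by rewrite mulrA Leta; lra.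
  by apply: ler_wpM2l; rewrite ?ler_norml; lra.
lra.
Qed.

(** An interval is infinite; this is used to choose a path that avoids finitely
    many poles. *)
Lemma small_avoid (s : seq R) (e : R) : 0 < e ->
  exists2 k, 0 < k < e & k \notin s.
Proof.
move=> e0; suff [k k0 ks] : exists2 k, 0 < k < e & forall x, x \in s -> 0 < x -> k < x.
  exists k => //; apply/negP => /ks.
  by rewrite ltxx => h; have : false by apply: h; case/andP: k0.
elim: s => [|x s [k /andP[k0 ke] ks]]; first by exists (e / 2) => //; lra.
have [x0|x0] := leP x 0.
  exists k => [|y]; first by rewrite k0.
  by rewrite inE => /orP[/eqP -> |/ks//]; lra.
exists (Num.min k (x / 2)).
  by rewrite lt_min k0 gt_min ke /=; lra.
move=> y; rewrite inE => /orP[/eqP-> _|/ks h /h ky].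
  by rewrite gt_min; apply/orP; right; lra.
by rewrite gt_min ky.
Qed.

Lemma far_from (s : seq C) (c : C) : c \notin s ->
  exists2 rho : R, 0 < rho & forall z, normc (z - c) < rho -> z \notin s.
Proof.
elim: s => [|x s IH]; first by exists 1.
rewrite inE negb_or => /andP[cx /IH[rho rho0 rhoP]].
exists (Num.min rho (normc (x - c))).
  by rewrite lt_min rho0 normc_gt0 subr_eq0 eq_sym.
move=> z; rewrite lt_min => /andP[/rhoP zs zx]; rewrite inE negb_or zs andbT.
by apply: contraTneq zx => ->; rewrite ltxx.
Qed.

(** The point -1 is reached from 0 along a parabola of height k, which stays in
    the disc when k is small. A pole lies on the parabola for at most one k, so
    some k avoids them all. *)
Lemma continuation_zero f (e d : R) (poles : seq C) : 1 < e -> 0 < d ->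
  (forall z, normc z < e -> z \notin poles -> holo f z) -> -1 \notin poles ->
  (forall z, normc z < d -> f z = 0) -> f (-1) = 0.
Proof.
move=> e1 d0 fh pN1 f0.
(* The only height for which the parabola can meet p. *)
pose kap (p : C) := complex.Im p / (- complex.Re p * (1 + complex.Re p)).
have e10 : 0 < e - 1 by lra.
have [k /andP[k0 ke] kN] := small_avoid [seq kap p | p <- poles] e10.
pose gam (t : R) : C := (- t +i* (k * t * (1 - t)))%C.
have gam0 : gam 0 = 0 by apply/eqP; rewrite eq_complex /= oppr0 mulr0 mul0r eqxx.
have gam1 : gam 1 = -1 by apply/eqP; rewrite eq_complex /= subrr mulr0 oppr0 !eqxx.
have kp : 0 < k + 1 by lra.
rewrite -gam1; apply: (@identity_along_path f gam (k + 1) d kp) => //.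
- move=> s t s01 t01; apply: le_trans (normc_le_ReIm _) _.
  have -> : complex.Re (gam s - gam t) = - (s - t) by rewrite raddfB /=; ring.
  have -> : complex.Im (gam s - gam t) = k * ((s - t) * (1 - s - t)) by rewrite raddfB /=; ring.
  rewrite normrN !normrM (ger0_norm (ltW k0)).
  have : `|1 - s - t| <= 1 by rewrite ler_norml; lra.
  move=> h; rewrite mulrDl mul1r addrC lerD2r; apply: ler_wpM2l; first exact: ltW.
  by rewrite -[leRHS]mulr1; apply: ler_wpM2l.
- move=> t t01.
  have [->|t0] := eqVneq t 0.
    exists (d / 2); first lra.
    move=> z; rewrite gam0 subr0 => zd.
    have d2 : 0 < d / 2 by lra.
    apply: (@holo_near _ (fun=> 0) f z _ d2); last exact: holo_cst.
    move=> v vz; rewrite f0//; have -> : v = (v - z) + z by ring.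
    by apply: le_lt_trans (normc_add _ _) _; lra.
  have gN : gam t \notin poles.
    have [->|t1] := eqVneq t 1; first by rewrite gam1.
    apply: contra kN => gp; apply/mapP; exists (gam t) => //.
    rewrite /kap /= opprK; field.
    by rewrite t0 subr_eq0 eq_sym t1.
  have [rho rho0 rhoP] := far_from gN.
  have ge : normc (gam t) < e.
    apply: le_lt_trans (normc_le_ReIm _) _; rewrite /= normrN ger0_norm; last by lra.
    have tt : 0 <= t * (1 - t) <= 1 by nra.
    by rewrite -mulrA ger0_norm; nra.
  exists (Num.min rho (e - normc (gam t))); first by rewrite lt_min rho0 subr_gt0.
  move=> z; rewrite lt_min => /andP[zr ze]; apply: fh; last exact: rhoP.
  have -> : z = (z - gam t) + gam t by ring.
  by apply: le_lt_trans (normc_add _ _) _; lra.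
- by move=> z; rewrite gam0 subr0; exact: f0.
Qed.

End Identity.

(** * Quotients of polynomials as power series *)

Section PowerSeriesQuotient.
Variable F : fieldType.
Implicit Types (g h : {poly F}) (u : nat -> F).

Definition convol h u n := \sum_(i < n.+1) h`_i * u (n - i)%N.

(** The power series with coefficients u is the quotient g / h. *)
Definition represents g h u := h != 0 /\ forall n, convol h u n = g`_n.

Lemma convol_MXaddC h (c : F) u n : convol (h * 'X + c%:P) u n =
  c * u n + (if n is m.+1 then convol h u m else 0).
Proof.
rewrite /convol big_ord_recl /= !coefD coefMX coefC /= add0r subn0; congr +%R.
case: n => [|n]; first by rewrite big_ord0.
by apply: eq_bigr => i _; rewrite coefD coefMX coefC /= addr0 /bump /= add1n subSS.
Qed.

(** The error w of the claimed identity satisfies s w_0 = 0 and s w_(n+1) = w_n,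
    hence vanishes, whether or not s is 0. *)
Lemma represents_cancel g h u s :
  represents (g * ('X - s%:P)) (h * ('X - s%:P)) u -> represents g h u.
Proof.
move=> [h0 hu]; split; first by apply: contraNneq h0 => ->; rewrite mul0r.
have E n : convol (h * ('X - s%:P)) u n = (if n is m.+1 then convol h u m else 0) - s * convol h u n.
  rewrite /convol mulr_sumr; case: n => [|n].
    by rewrite !big_ord1 sub0r !mulrBr coefB coefMX coefMC /= sub0r mulNr [_ * s]mulrC mulrA.
  have -> : \sum_(i < n.+2) (h * ('X - s%:P))`_i * u (n.+1 - i)%N =
     \sum_(i < n.+2) (h * 'X)`_i * u (n.+1 - i)%N - \sum_(i < n.+2) s * (h`_i * u (n.+1 - i)%N).
    rewrite -sumrB; apply: eq_bigr => i _.
    by rewrite mulrBr coefB coefMC mulrBl mulrA [s * _]mulrC.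
  congr (_ - _); rewrite big_ord_recl coefMX /= mul0r add0r.
  by apply: eq_bigr => i _; rewrite coefMX /bump /= add1n subSS.
have G n : (g * ('X - s%:P))`_n = (if n is m.+1 then g`_m else 0) - s * g`_n.
  by rewrite mulrBr coefB coefMX coefMC [_ * s]mulrC; case: n.
pose w n := convol h u n - g`_n.
have w0 : s * w 0%N = 0.
  by have := hu 0%N; rewrite E G /w mulrBr !sub0r => /oppr_inj ->; rewrite subrr.
have wS n : s * w n.+1 = w n.
  have := hu n.+1; rewrite E G /w mulrBr => /eqP; rewrite subr_eq addrAC eq_sym subr_eq => /eqP e.
  by apply/eqP; rewrite subr_eq addrAC eq_sym subr_eq [_ + g`_n]addrC e addrC.
suff w_eq0 n : w n = 0 by move=> n; apply/eqP; rewrite -subr_eq0 -/(w n) w_eq0.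
have [s0|s0] := eqVneq s 0; first by rewrite -wS s0 mul0r.
elim: n => [|n IH]; apply/eqP; rewrite -(mulrI_eq0 _ (mulfI s0)).
  by rewrite w0.
by rewrite wS IH.
Qed.

(** Over a field that is not algebraically closed only the common factors X - s
    can be removed, which is enough at a prescribed point s. *)
Lemma represents_reduce1 g h u s : represents g h u -> exists g' h',
  represents g' h' u /\ ((g'.[s] != 0) || (h'.[s] != 0)).
Proof.
have [n] := ubnP (size h); elim: n g h => // n IH g h hn gh.
have [/eqP gs|gs] := boolP (g.[s] == 0); last by exists g, h; split=> //; rewrite gs.
have [/eqP hs|hs] := boolP (h.[s] == 0); last by exists g, h; split=> //; rewrite hs orbT.
have /factor_theorem[g' gE] : root g s by apply/rootP.
have /factor_theorem[h' hE] : root h s by apply/rootP.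
have := gh; rewrite [in X in X -> _]gE [in X in X -> _]hE => /represents_cancel gh'.
have h'0 : h' != 0 by case: gh'.
have sz : size h = (size h').+1 by rewrite hE size_Mmonic ?monicXsubC// size_XsubC addn2.
by apply: IH gh'; rewrite -ltnS -sz.
Qed.

Lemma represents_reduce g h u (s : F) : represents g h u -> h.[s] != 0 -> exists g' h',
  [/\ represents g' h' u, forall z, (g'.[z] != 0) || (h'.[z] != 0), h'.[s] != 0
    & g'.[s] / h'.[s] = g.[s] / h.[s]].
Proof.
have [n] := ubnP (size h); elim: n g h => // n IH g h hn gh hs.
have [h_co|] := pselect (forall z, (g.[z] != 0) || (h.[z] != 0)); first by exists g, h.
move=> /existsNP[z /negP]; rewrite negb_or !negbK => /andP[gz hz].
have /factor_theorem[g' gE] : root g z by [].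
have /factor_theorem[h' hE] : root h z by [].
have := gh; rewrite [in X in X -> _]gE [in X in X -> _]hE => /represents_cancel gh'.
have h'0 : h' != 0 by case: gh'.
have sz : size h = (size h').+1 by rewrite hE size_Mmonic ?monicXsubC// size_XsubC addn2.
have := hs; rewrite [in X in X -> _]hE hornerM mulf_eq0 negb_or => /andP[hs' zs].
have [|g2 [h2 [r1 r2 r3 r4]]] := IH g' h' _ gh' hs'; first by rewrite -ltnS -sz.
exists g2, h2; split => //; rewrite r4 gE hE !hornerM; field.
by rewrite hs' zs.
Qed.

End PowerSeriesQuotient.

(** * Values of a rational power series *)

Section ConvolutionLimit.
Variable R : realType.
Local Notation C := (R[i]).

Lemma cvgC_epsP (s : nat -> C) (l : C) :
  ((s : nat -> C^o) @ \oo --> (l : C^o)) <->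
  forall e : R, 0 < e -> exists N, forall n, (N <= n)%N -> normc (s n - l) < e.
Proof.
split=> [/cvgrPdist_lt h e e0|h].
  have /h [N _ NP] : 0 < e%:C%C :> C by rewrite ltcR.
  by exists N => n nN; rewrite -ltcR -norm_normc distrC; exact: (NP n nN).
apply/(@cvgrPdist_lt _ C^o) => e e0.
have /complex_realP[e' eE] : e \is Num.real by rewrite gtr0_real.
move: e0; rewrite eE ltcR => /h [N NP].
by exists N => // n /NP; rewrite -ltcR -norm_normc distrC.
Qed.

Lemma cvgC_unique (s : nat -> C) (l l' : C) :
  ((s : nat -> C^o) @ \oo --> (l : C^o)) -> ((s : nat -> C^o) @ \oo --> (l' : C^o)) ->
  l = l'.
Proof.
move=> /cvgC_epsP h /cvgC_epsP h'; apply/eqP; rewrite -subr_eq0 -normc_eq0.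
rewrite eq_le normc_ge0 andbT; apply/ler_addgt0Pr => e e0; rewrite add0r.
have e2 : 0 < e / 2 by lra.
have [N NP] := h _ e2; have [M MP] := h' _ e2.
have := NP (maxn N M) (leq_maxl _ _); have := MP (maxn N M) (leq_maxr _ _).
set x := s _; have -> : l - l' = (x - l') - (x - l) by ring.
move=> h1 h2; apply: le_trans (normc_add _ _) _; rewrite normc_opp; lra.
Qed.

(** Induction on h: passing from h to h X + c shifts the series by one term, and
    the resulting error is a multiple of a n z^n, which tends to 0. *)
Lemma convol_limit (h : {poly C}) (a : nat -> C) (z : C) :
  (forall e : R, 0 < e -> exists N, forall n, (N <= n)%N -> normc (a n * z ^+ n) < e) ->
  forall e : R, 0 < e -> exists N, forall n, (N <= n)%N ->
    normc (\sum_(m < n) convol h a m * z ^+ m - h.[z] * \sum_(m < n) a m * z ^+ m) < e.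
Proof.
move=> a0; elim/poly_ind: h => [|h c IH] e e0.
  exists 0%N => n _; rewrite horner0 mul0r subr0 big1 ?normc0// => i _.
  by rewrite /convol big1 ?mul0r// => j _; rewrite coef0 mul0r.
have e1 : 0 < e / (2 * (normc z + 1)).
  by rewrite divr_gt0// mulr_gt0// ltr_wpDl// normc_ge0.
have e2 : 0 < e / (2 * (normc (z * h.[z]) + 1)).
  by rewrite divr_gt0// mulr_gt0// ltr_wpDl// normc_ge0.
have [N NP] := IH _ e1; have [M MP] := a0 _ e2.
exists (maxn N M).+1 => -[//|n]; rewrite ltnS geq_max => /andP[Nn Mn].
have := NP n Nn; have := MP n Mn.
set D := _ - _ => Tn Dn.
have -> : \sum_(m < n.+1) convol (h * 'X + c%:P) a m * z ^+ m -
    (h * 'X + c%:P).[z] * \sum_(m < n.+1) a m * z ^+ m =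
    z * D - z * h.[z] * (a n * z ^+ n).
  have -> : \sum_(m < n.+1) convol (h * 'X + c%:P) a m * z ^+ m =
      c * (\sum_(m < n.+1) a m * z ^+ m) + z * \sum_(m < n) convol h a m * z ^+ m.
    rewrite mulr_sumr; under eq_bigr do rewrite convol_MXaddC mulrDl -mulrA.
    rewrite big_split /=; congr +%R; rewrite big_ord_recl mul0r add0r mulr_sumr.
    by apply: eq_bigr => i _; rewrite /bump /= ?add1n exprS; ring.
  by rewrite hornerMXaddC /D big_ord_recr /=; ring.
apply: le_lt_trans (normc_add _ _) _; rewrite normc_opp !normc_mul.
move: Dn Tn; rewrite !ltr_pdivlMr ?mulr_gt0 ?ltr_wpDl ?normc_ge0// !normc_mul.
have := normc_ge0 z; have := normc_ge0 D; have := normc_ge0 h.[z].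
have := normc_ge0 (a n); have := normc_ge0 (z ^+ n).
set x := normc z; set y := normc D; set w := normc h.[z].
set p := normc (a n); set q := normc (z ^+ n) => *.
have pq0 : 0 <= p * q by rewrite mulr_ge0.
nra.
Qed.

Lemma represents_limit (g h : {poly C}) (a : nat -> C) (z : C) : represents g h a ->
  (forall e : R, 0 < e -> exists N, forall n, (N <= n)%N -> normc (a n * z ^+ n) < e) ->
  forall e : R, 0 < e -> exists N, forall n, (N <= n)%N ->
    normc (g.[z] - h.[z] * \sum_(m < n) a m * z ^+ m) < e.
Proof.
move=> [_ gh] a0 e e0; have [N NP] := convol_limit h a0 e0.
exists (maxn N (size g)) => n; rewrite geq_max => /andP[Nn gn].
have := NP n Nn; congr (normc (_ - _) < _); rewrite (horner_coef_wide _ gn).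
by apply: eq_bigr => i _; rewrite gh.
Qed.

End ConvolutionLimit.

(** * Meromorphic continuation of a rational power series *)

Section Continuation.
Variable R : realType.
Local Notation C := (R[i]).
Variable u : nat -> R.
Local Notation uC := (fun n => (u n)%:C%C).

Lemma series_terms0 (z : C) (l : C) :
  series (fun n => uC n * z ^+ n : C^o) @ \oo --> (l : C^o) ->
  forall e : R, 0 < e -> exists N, forall n, (N <= n)%N -> normc (uC n * z ^+ n) < e.
Proof.
move=> /cvgC_epsP h e e0; have e2 : 0 < e / 2 by lra.
have [N NP] := h _ e2; exists N => n Nn.
have := NP n Nn; have := NP n.+1 (leqW Nn).
rewrite !seriesEord /= big_ord_recr /=; set S := \sum_(_ < _) _ => h1 h2.
have -> : (u n)%:C%C * z ^+ n = (S + (u n)%:C%C * z ^+ n - l) - (S - l) by ring.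
by apply: le_lt_trans (normc_add _ _) _; rewrite normc_opp; lra.
Qed.

(** The function h G - g vanishes where the series converges, so the identity
    theorem makes it vanish at -1. *)
Lemma continuation_value_eq (g h : {poly C}) (v : C) : represents g h uC ->
  continuation_value u v -> h.[-1] * v = g.[-1].
Proof.
move=> gh [r0 [eps [G [poles [eps1 pP GP Gs ->]]]]].
have [e e1 eP] : exists2 e : R, 1 < e & (e%:E <= eps)%E.
  case: eps eps1 {pP GP Gs} => [x|_|//]; first by rewrite lte_fin => x1; exists x.
  by exists 2; [lra|rewrite leey].
have [d d0 dP] : exists2 d : R, 0 < d & (d%:E <= Order.min (conv_radius u) eps)%E.
  have : (0 < Order.min (conv_radius u) eps)%E.
    by rewrite lt_min r0 (lt_trans _ eps1)// lte_fin.
  case: (Order.min _ _) => [x|_|//]; first by rewrite lte_fin => x0; exists x.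
  by exists 1; rewrite ?leey.
pose f z := h.[z] * G z - g.[z].
have f0 z : normc z < d -> f z = 0.
  move=> zd; have zD : disc (Order.min (conv_radius u) eps) z.
    by rewrite /disc /=; apply: lt_le_trans dP; rewrite lte_fin.
  have Gz := Gs z zD; apply/eqP; rewrite subr_eq0; apply/eqP.
  apply: (@cvgC_unique R (fun n => h.[z] * series (fun n => uC n * z ^+ n : C^o) n)).
    apply/cvgC_epsP => e' e'0.
    have b0 : 0 < e' / (normc h.[z] + 1) by rewrite divr_gt0// ltr_wpDl// normc_ge0.
    have [N NP] := (cvgC_epsP _ _).1 Gz _ b0; exists N => n /NP.
    rewrite -mulrBr normc_mul ltr_pdivlMr ?ltr_wpDl ?normc_ge0// => h1.
    apply: le_lt_trans h1; rewrite mulrC; apply: ler_wpM2l; first exact: normc_ge0.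
    by rewrite lerDl.
  apply/cvgC_epsP => e' e'0.
  have [N NP] := represents_limit gh (series_terms0 Gz) e'0; exists N => n /NP.
  by rewrite seriesEord normc_dist.
have : f (-1) = 0.
  apply: (@continuation_zero R f e d poles) => //.
    move=> z ze zp; have zD : disc eps z.
      by rewrite /disc /=; apply: lt_le_trans eP; rewrite lte_fin.
    exact: (holoB (holoM (@holo_poly R h z) (GP z zD zp)) (@holo_poly R g z)).
  by apply/negP => /pP[_]; rewrite eqxx.
by move/eqP; rewrite subr_eq0 => /eqP.
Qed.

Lemma conv_radius_gt0 (c K : R) : 0 <= c -> 0 < K ->
  (forall n, `|u n| <= c * K ^+ n) -> (0 < conv_radius u)%E.
Proof.
move=> c0 K0 uK; pose r := (2 * K)^-1.
have r0 : 0 < r by rewrite invr_gt0 mulr_gt0.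
apply: (@lt_le_trans _ _ r%:E); first by rewrite lte_fin.
apply: ereal_sup_ubound; exists r => //; split; first exact: ltW.
apply: (@series_le_cvg _ _ (geometric c 2^-1)).
- by move=> n; rewrite mulr_ge0 ?exprn_ge0// ltW.
- by move=> n; rewrite mulr_ge0// exprn_ge0// invr_ge0.
- move=> n; rewrite /geometric /=.
  apply: (@le_trans _ _ (c * K ^+ n * r ^+ n)).
    by apply: ler_wpM2r; [rewrite exprn_ge0// ltW|exact: uK].
  rewrite -mulrA -exprMn /r invfM mulrCA divff ?mulr1//.
  by rewrite gt_eqF.
- apply: is_cvg_geometric_series; rewrite ger0_norm ?invr_ge0//; lra.
Qed.

Lemma conv_radius_terms0 (z : C) : ((normc z)%:E < conv_radius u)%E ->
  forall e : R, 0 < e -> exists N, forall n, (N <= n)%N -> normc (uC n * z ^+ n) < e.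
Proof.
move=> /ereal_sup_gt[_ [r [r0 /cvg_series_cvg_0 ur] <-]]; rewrite lte_fin => zr e e0.
have /cvgrPdist_lt/(_ e e0)[N _ NP] := ur; exists N => n /NP /=.
rewrite sub0r normrN normc_mul normc_exp normc_real.
apply: le_lt_trans; apply: le_trans (ler_norm _).
by apply: ler_wpM2l => //; apply: lerXn2r; rewrite ?nnegrE ?normc_ge0// ltW.
Qed.

(** In lowest terms the poles of g / h are the roots of h. Inside the disc of
    convergence h has no root, since g would vanish there as well; hence the
    partial sums converge to g / h there. *)
Lemma represents_continuation (g h : {poly C}) (c K : R) : represents g h uC ->
  (forall z, (g.[z] != 0) || (h.[z] != 0)) -> h.[-1] != 0 ->
  0 <= c -> 0 < K -> (forall n, `|u n| <= c * K ^+ n) ->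
  continuation_value u (g.[-1] / h.[-1]).
Proof.
move=> gh coprime hN1 c0 K0 uK; split; first exact: (conv_radius_gt0 c0 K0 uK).
have h0 : h != 0 by case: gh.
have [rs hE] := closed_field_poly_normal h.
have rsP z : (z \in rs) = (h.[z] == 0).
  rewrite -rootE hE rootZ ?lead_coef_eq0//.
  by rewrite root_prod_XsubC.
exists +oo%E, (fun z => g.[z] / h.[z]), rs; split => //; first by rewrite ltry.
- move=> s srs; have hs : h.[s] = 0 by apply/eqP; rewrite -rsP.
  split; first by rewrite /disc /= ltry.
    by apply: contraNneq hN1 => <-; rewrite hs.
  have gs : g.[s] != 0 by have := coprime s; rewrite hs eqxx orbF.
  move=> M; rewrite /is_pole near_withinE; apply/nearC_epsP.
  pose k := normc g.[s] / 2; have k0 : 0 < k by rewrite divr_gt0// normc_gt0.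
  have M0 : 0 < `|M| + 1 by rewrite ltr_wpDl.
  have [d1 d10 d1P] := (continuousC_epsP _ _).1 (derivableC_continuous (@holo_poly R g s)) _ k0.
  have kM : 0 < k / (`|M| + 1) by rewrite divr_gt0.
  have [d2 d20 d2P] := (continuousC_epsP _ _).1 (derivableC_continuous (@holo_poly R h s)) _ kM.
  have sN : s \notin [seq x <- rs | x != s] by rewrite mem_filter eqxx.
  have [d3 d30 d3P] := far_from sN.
  exists (Num.min d1 (Num.min d2 d3)); first by rewrite !lt_min d10 d20 d30.
  move=> w; rewrite !lt_min => /and3P[/d1P gw /d2P hw /d3P].
  rewrite mem_filter => wN ws; move: wN; rewrite ws /= rsP => hw0.
  rewrite hs subr0 in hw.
  have gk : k < normc g.[w].
    by have := normc_sub_le g.[s] g.[w]; rewrite normc_dist /k in gw *; lra.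
  have nh : 0 < normc h.[w] by rewrite normc_gt0.
  rewrite normc_mul normcV ltr_pdivlMr//; apply: lt_trans gk.
  move: hw; rewrite ltr_pdivlMr// => hw; apply: le_lt_trans hw.
  rewrite mulrC; apply: ler_wpM2l; first exact: ltW.
  by rewrite (le_trans (ler_norm _))// lerDl.
- move=> z _; rewrite rsP => hz.
  exact: (holoM (@holo_poly R g z) (@holoV _ (fun z => h.[z]) z hz (@holo_poly R h z))).
- move=> z; rewrite /disc /= lt_min => /andP[zr _].
  have t0 := conv_radius_terms0 zr.
  have lim := represents_limit gh t0.
  have hz : h.[z] != 0.
    apply/eqP => hz; have := coprime z; rewrite hz eqxx orbF => /eqP; apply.
    apply/eqP; rewrite -normc_eq0 eq_le normc_ge0 andbT; apply/ler_addgt0Pr => e e0.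
    have [N /(_ N (leqnn N))] := lim _ e0.
    by rewrite hz mul0r subr0 add0r => /ltW.
  apply/cvgC_epsP => e e0.
  have eh : 0 < e * normc h.[z] by rewrite mulr_gt0// normc_gt0.
  have [N NP] := lim _ eh; exists N => n /NP; rewrite seriesEord.
  set S := \sum_(_ < _) _ => hn.
  have nh : 0 < normc h.[z] by rewrite normc_gt0.
  rewrite -(ltr_pM2r nh) -normc_mul mulrBl divfK// normc_dist [S * _]mulrC.
  exact: hn.
Qed.

End Continuation.

(** * Maps of submodules and of homology modules *)

Section RestrictedMaps.
Variables (A : pzRingType) (V W : lmodType A) (S : submodule V) (T : submodule W).
Variables (f : {linear V -> W}) (fST : forall v, v \in S -> f v \in T).

Definition submod_map :=
  fun v : submod S => Submod (fST (submodP v)) : submod T.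

Fact submod_map_linear : linear submod_map.
Proof. by move=> a u v; apply: val_inj; rewrite /= linearP. Qed.
HB.instance Definition _ := GRing.isLinear.Build A (submod S) (submod T) *:%R
  submod_map submod_map_linear.

End RestrictedMaps.

Section Corestriction.
Variables (A : pzRingType) (V W : lmodType A) (T : submodule W).
Variables (f : {linear V -> W}) (fT : forall v, f v \in T).

Definition submod_lift := fun v : V => Submod (fT v) : submod T.

Fact submod_lift_linear : linear submod_lift.
Proof. by move=> a u v; apply: val_inj; rewrite /= linearP. Qed.
HB.instance Definition _ := GRing.isLinear.Build A V (submod T) *:%R
  submod_lift submod_lift_linear.

End Corestriction.

Section LinearFunctions.
Variables (A : pzRingType) (U V W : lmodType A).

Lemma linear_comp (f : {linear U -> V}) (g : {linear V -> W}) :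
  linear (fun v => g (f v)).
Proof. by move=> a u v; rewrite !linearP. Qed.

Lemma linear_sub (f g : U -> V) : linear f -> linear g -> linear (fun v => f v - g v).
Proof. by move=> fl gl a u v; rewrite fl gl scalerBr opprD addrACA. Qed.

Lemma linear_idfun : linear (fun v : U => v).
Proof. by []. Qed.

End LinearFunctions.

Section HomologyMaps.
Variables (A : pzRingType) (V W : nat -> lmodType A).
Variables (d : forall n, {linear V n.+1 -> V n}) (e : forall n, {linear W n.+1 -> W n}).
Variable phi : forall n, {linear V n -> W n}.
Hypothesis phi_d : forall n v, phi n (d n v) = e n (phi n.+1 v).

Lemma cycle_map_subproof n v : v \in Submodule (@cycle_submod_closed A V d n) ->
  phi n v \in Submodule (@cycle_submod_closed A W e n).
Proof. by case: n v => [//|n] v /eqP dv; apply/eqP; rewrite -phi_d dv linear0. Qed.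

Definition cycle_map n : {linear cycles d n -> cycles e n} :=
  submod_map (@cycle_map_subproof n).

Lemma homology_map_subproof n (z : cycles d n) :
  z \in Submodule (@boundary_submod_closed A V d n) ->
  cycle_map n z \in Submodule (@boundary_submod_closed A W e n).
Proof.
move=> /asboolP[v dv]; apply/asboolP; exists (phi n.+1 v).
by rewrite /= -phi_d dv.
Qed.

Definition homology_map n : {linear homology d n -> homology e n} :=
  quotmod_map (@homology_map_subproof n).

(** If phi v = e w, then psi (phi v) = d (psi w), which differs from v by a boundary. *)
Lemma homology_map_inj (psi : forall n, {linear W n -> V n}) n :
  (forall w, psi n (e n w) = d n (psi n.+1 w)) ->
  (forall v, v \in Submodule (@cycle_submod_closed A V d n) ->
     exists w, psi n (phi n v) - v = d n w) ->
  forall c, homology_map n c = 0 -> c = 0.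
Proof.
move=> psi_d htpy c; rewrite -(quotmod_repr c).
set z := repr _; rewrite [LHS]quotmod_map_pi => h.
have : quotmod_pi (Submodule (@boundary_submod_closed A W e n)) (cycle_map n z) =
    quotmod_pi _ 0 by rewrite h linear0.
move=> /quotmod_piP; rewrite subr0 => /asboolP[w /= ew].
rewrite -[RHS](linear0 (quotmod_pi _)); apply/quotmod_piP; rewrite subr0.
have [v hv] := htpy _ (submodP z).
apply/asboolP; exists (psi n.+1 w - v).
by rewrite linearB -psi_d ew -hv opprB addrC subrK.
Qed.

End HomologyMaps.

(** * Comparison of projective resolutions *)

Section Naturality.
Variables (R : realType) (J : category).
Implicit Types F G H : presheaf R J.

Definition nat_comp F G H (q : nattrans G H) (p : nattrans F G) : nattrans F H.
Proof.
refine (@NatTrans R J F H (fun x => (q x \o p x)%FUN) _).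
by move=> x y u m; rewrite /= !nat_natural.
Defined.

Definition nat_id F : nattrans F F.
Proof. exact: (@NatTrans R J F F (fun x => idfun)). Defined.

Definition nat_sub F G (p q : nattrans F G) : nattrans F G.
Proof.
refine (@NatTrans R J F G (fun x => (p x \- q x)%R) _).
by move=> x y u m; rewrite /= !nat_natural linearB.
Defined.

Section Image.
Variables (F G : presheaf R J) (p : nattrans F G).

Definition image_pred x : {pred G x} := fun m => `[< exists m', p x m' = m >].

Fact image_submod_closed x : submod_closed (image_pred (x := x)).
Proof.
split; first by apply/asboolP; exists 0; rewrite linear0.
move=> a u v /asboolP[u' uE] /asboolP[v' vE]; apply/asboolP.
by exists (a *: u' + v'); rewrite linearP uE vE.
Qed.

Definition image_submod x := Submodule (@image_submod_closed x).

Lemma image_map_subproof x y (u : @hom J x y) m :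
  m \in image_submod y -> psh_map G u m \in image_submod x.
Proof.
move=> /asboolP[m' <-]; apply/asboolP; exists (psh_map F u m').
by rewrite nat_natural.
Qed.

Definition image_psh : presheaf R J.
Proof.
refine (@Presheaf R J (fun x => submod (image_submod x))
  (fun x y u => submod_map (@image_map_subproof x y u)) _ _).
- by move=> x m; apply: val_inj; rewrite /= psh_map1.
- by move=> x y z g f m; apply: val_inj; rewrite /= psh_mapM.
Defined.

Lemma image_lift (Q : presheaf R J) (q : nattrans Q G) :
  (forall x m, exists m', p x m' = q x m) ->
  exists q' : nattrans Q image_psh, forall x m, submod_val (q' x m) = q x m.
Proof.
move=> qp; have qI x m : q x m \in image_submod x by apply/asboolP; exact: qp.
unshelve eexists.
  refine (@NatTrans R J Q image_psh (fun x => submod_lift (qI x)) _).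
  by move=> x y u m; apply: val_inj; rewrite /= nat_natural.
by [].
Qed.

End Image.

(** Both maps corestrict to the image of p, onto which p is an epimorphism. *)
Lemma projective_lift (P F G : presheaf R J) (p : nattrans F G) (q : nattrans P G) :
  projective P -> (forall x m, exists m', p x m' = q x m) ->
  { r : nattrans P F | forall x m, p x (r x m) = q x m }.
Proof.
move=> Pproj qp; apply: cid.
have [p' p'E] : exists p' : nattrans F (image_psh p), forall x m, submod_val (p' x m) = p x m.
  by apply: image_lift => x m; exists m.
have [q' q'E] := image_lift qp.
have p'epi : epi_nat p'.
  move=> x m; have /asboolP[m' pm'] := submodP m.
  by exists m'; apply: val_inj; rewrite /= p'E pm'.
have [r rE] := Pproj _ _ p' q' p'epi.
by exists r => x m; rewrite -p'E rE q'E.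
Qed.

Section Comparison.
Variables (F : presheaf R J) (P Q : proj_resolution F).

Lemma res_dd (S : proj_resolution F) n x m : res_d S n x (res_d S n.+1 x m) = 0.
Proof. by apply/res_exact; exists m. Qed.

Lemma res_aug_d (S : proj_resolution F) x m : res_aug S x (res_d S 0 x m) = 0.
Proof. by apply/res_exact0; exists m. Qed.

(** What the construction of the next component needs from the current one; it
    follows from commutation with the differentials, so the components can be
    built by recursion one at a time. *)
Definition extendable n (phi : nattrans (P n) (Q n)) :=
  forall x m, exists m', res_d Q n x m' = phi x (res_d P n x m).

Lemma chain_map_step n (phi : nattrans (P n) (Q n)) : extendable phi ->
  { psi : nattrans (P n.+1) (Q n.+1) | extendable psi /\
    forall x m, res_d Q n x (psi x m) = phi x (res_d P n x m) }.
Proof.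
move=> ext.
have [psi psiE] := projective_lift (q := nat_comp phi (res_d P n)) (@res_projective _ _ _ P n.+1) ext.
exists psi; split => // x m; apply/res_exact.
by rewrite psiE /= res_dd linear0.
Qed.

Lemma chain_map_exists : exists phi : forall n, nattrans (P n) (Q n),
  (forall x m, res_aug Q x (phi 0%N x m) = res_aug P x m) /\
  forall n x m, res_d Q n x (phi n.+1 x m) = phi n x (res_d P n x m).
Proof.
have [phi0 phi0E] := projective_lift (q := res_aug P) (@res_projective _ _ _ P 0)
  (fun x m => res_aug_epi Q (res_aug P x m)).
have ext0 : extendable phi0.
  by move=> x m; apply/res_exact0; rewrite phi0E res_aug_d.
pose fix state n : {phi : nattrans (P n) (Q n) | extendable phi} :=
  if n is m.+1 return {phi : nattrans (P n) (Q n) | extendable phi}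
  then exist _ _ (svalP (chain_map_step (svalP (state m)))).1
  else exist _ phi0 ext0.
exists (fun n => sval (state n)); split=> // n x m.
exact: (svalP (chain_map_step (svalP (state n)))).2.
Qed.

Section Homotopy.
Variables (phi psi : forall n, nattrans (P n) (Q n)).
Hypothesis aug_eq : forall x m, res_aug Q x (phi 0%N x m) = res_aug Q x (psi 0%N x m).
Hypothesis phi_d : forall n x m, res_d Q n x (phi n.+1 x m) = phi n x (res_d P n x m).
Hypothesis psi_d : forall n x m, res_d Q n x (psi n.+1 x m) = psi n x (res_d P n x m).

(** The condition on the current component of a homotopy under which the next one
    exists. *)
Definition homotopy_upto n (s : nattrans (P n) (Q n.+1)) :=
  forall x m, res_d Q n x (s x (res_d P n x m)) =
    phi n x (res_d P n x m) - psi n x (res_d P n x m).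

Lemma homotopy_step n (s : nattrans (P n) (Q n.+1)) : homotopy_upto s ->
  { t : nattrans (P n.+1) (Q n.+2) | homotopy_upto t /\
    forall x m, res_d Q n.+1 x (t x m) = phi n.+1 x m - psi n.+1 x m - s x (res_d P n x m) }.
Proof.
move=> sH.
pose q := nat_sub (nat_sub (phi n.+1) (psi n.+1)) (nat_comp s (res_d P n)).
have qE x m : exists m', res_d Q n.+1 x m' = q x m.
  apply/res_exact; rewrite /q /= !linearB /= phi_d psi_d sH subrr //.
have [t tE] := projective_lift (@res_projective _ _ _ P n.+1) qE.
exists t; split => // x m; rewrite tE /q /= res_dd linear0 subr0 //.
Qed.

Lemma homotopy_exists : exists s : forall n, nattrans (P n) (Q n.+1),
  (forall x m, res_d Q 0 x (s 0%N x m) = phi 0%N x m - psi 0%N x m) /\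
  forall n x m, res_d Q n.+1 x (s n.+1 x m) =
    phi n.+1 x m - psi n.+1 x m - s n x (res_d P n x m).
Proof.
pose q0 := nat_sub (phi 0%N) (psi 0%N).
have q0E x m : exists m', res_d Q 0 x m' = q0 x m.
  by apply/res_exact0; rewrite /q0 /= linearB /= aug_eq subrr.
have [s0 s0E] := projective_lift (@res_projective _ _ _ P 0) q0E.
have H0 : homotopy_upto s0 by move=> x m; rewrite s0E.
pose fix state n : {s : nattrans (P n) (Q n.+1) | homotopy_upto s} :=
  if n is m.+1 return {s : nattrans (P n) (Q n.+1) | homotopy_upto s}
  then exist _ _ (svalP (homotopy_step (svalP (state m)))).1
  else exist _ s0 H0.
exists (fun n => sval (state n)); split=> [x m|n x m]; first exact: s0E.
exact: (svalP (homotopy_step (svalP (state n)))).2.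
Qed.
End Homotopy.

End Comparison.
End Naturality.

(** * The splitting functor followed by induction to the von Neumann algebra *)

Section Splitting.
Variables (R : realType) (J : category) (x : J).
Local Notation N := (vN R (aut x)).
Implicit Types F G : presheaf R J.

Definition tensor_gen (M : rightrep R (aut x)) (m : M) : tensor_vN M :=
  quotmod_pi (gen_submod (@tensor_rels R (aut x) M)) << m >>.

Lemma tensor_gen_ext (M : rightrep R (aut x)) (W : lmodType N^c) (f g : tensor_vN M -> W) :
  linear f -> linear g -> (forall m, f (tensor_gen m) = g (tensor_gen m)) -> f =1 g.
Proof.
move=> fl gl fg c; rewrite -(quotmod_repr c).
set t := repr _.
pose fL : {linear tensor_vN M -> W} := HB.pack f (GRing.isLinear.Build _ _ _ _ f fl).
pose gL : {linear tensor_vN M -> W} := HB.pack g (GRing.isLinear.Build _ _ _ _ g gl).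
rewrite -[f _]/(fL _) -[g _]/(gL _).
rewrite -[t]freeg_sumE !linear_sum; apply: eq_bigr => m _.
have -> : << coeff m t *g m >> = coeff m t *: << m >> :> {freeg M / N^c}.
  by apply/eqP/freeg_eqP => k; rewrite coeffZ !coeffU mul1r.
rewrite !linearZ; congr (_ *: _); exact: fg.
Qed.

Lemma tensor_genD (M : rightrep R (aut x)) (m m' : M) :
  tensor_gen (m + m') = tensor_gen m + tensor_gen m'.
Proof.
rewrite /tensor_gen -linearD; apply/quotmod_piP; rewrite opprD addrA.
by apply/asboolP => S; apply; left; exists m, m'.
Qed.

Lemma tensor_gen_map (M M' : rightrep R (aut x)) (f : repmor M M') m :
  tensor_vN_map f (tensor_gen m) = tensor_gen (f m).
Proof. by rewrite [LHS]quotmod_map_pi; congr quotmod_pi; exact: tensor_preU. Qed.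

(** The functor S_x followed by the tensor product with N(x). *)
Definition TS F : lmodType N^c := tensor_vN (splitting x F).
Definition TS_map F G (p : nattrans F G) : {linear TS F -> TS G} :=
  tensor_vN_map (split_map x p).
(** The element [m] tensor 1; these elements generate the module. *)
Definition TS_gen F (m : F x) : TS F :=
  tensor_gen (quotmod_pi (gen_submod (@split_image R J x F)) m : splitting x F).

Lemma TS_ext F (W : lmodType N^c) (f g : TS F -> W) : linear f -> linear g ->
  (forall m, f (TS_gen m) = g (TS_gen m)) -> f =1 g.
Proof.
move=> fl gl fg; apply: tensor_gen_ext => // m.
by rewrite -(quotmod_repr m); exact: fg.
Qed.

Lemma TS_genD F (m m' : F x) : TS_gen (m + m') = TS_gen m + TS_gen m'.
Proof. by rewrite /TS_gen linearD; exact: tensor_genD. Qed.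

Lemma TS_gen0 F : TS_gen (0 : F x) = 0.
Proof. by apply: (addrI (TS_gen 0)); rewrite -TS_genD !addr0. Qed.

Lemma TS_genB F (m m' : F x) : TS_gen (m - m') = TS_gen m - TS_gen m'.
Proof. by apply: (addIr (TS_gen m')); rewrite -TS_genD !subrK. Qed.

Lemma TS_map_gen F G (p : nattrans F G) m : TS_map p (TS_gen m) = TS_gen (p x m).
Proof. by rewrite /TS_map /TS_gen tensor_gen_map; congr tensor_gen; exact: split_map_funE. Qed.

End Splitting.

(** * Independence of the resolution *)

Section Invariance.
Variables (R : realType) (J : category).

Lemma vN_dim_mono (G : groupType) (M M' : lmodType (vN R G)^c) (f : {linear M -> M'}) :
  (forall m, f m = 0 -> m = 0) -> (vN_dim M <= vN_dim M')%E.
Proof.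
move=> f0; apply: le_ereal_sup => t [k [E [g [EE gE tE]]]].
exists k, E, (f \o g)%FUN; split=> // v vE /= /f0; exact: gE.
Qed.

(** The functor TS is additive, so it carries the homotopy between the composite
    of the comparison maps and the identity to one of module complexes. The first
    comparison map is therefore injective in homology, and the dimension is
    monotone under injections. *)
Lemma l2_betti_le (F : presheaf R J) (P Q : proj_resolution F) x n :
  (l2_betti P x n <= l2_betti Q x n)%E.
Proof.
have [phi [phi_aug phi_d]] := chain_map_exists P Q.
have [psi [psi_aug psi_d]] := chain_map_exists Q P.
have [s [s0 sS]] := @homotopy_exists R J F P P
  (fun n => nat_comp (psi n) (phi n)) (fun n => nat_id (P n))
  ltac:(by move=> y m; rewrite /= psi_aug phi_aug)
  ltac:(by move=> k y m; rewrite /= psi_d phi_d) ltac:(by []).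
have phiT k v : TS_map x (phi k) (TS_map x (res_d P k) v) =
    TS_map x (res_d Q k) (TS_map x (phi k.+1) v).
  move: v; apply: TS_ext; try exact: linear_comp.
  by move=> m; rewrite !TS_map_gen phi_d.
have psiT k v : TS_map x (psi k) (TS_map x (res_d Q k) v) =
    TS_map x (res_d P k) (TS_map x (psi k.+1) v).
  move: v; apply: TS_ext; try exact: linear_comp.
  by move=> m; rewrite !TS_map_gen psi_d.
apply: (@vN_dim_mono _ _ _ (homology_map phiT n)).
apply: (@homology_map_inj _ _ _ _ _ (fun k => TS_map x (phi k)) phiT
  (fun k => TS_map x (psi k))) => [w|v].
  exact: psiT.
case: n v => [|n] v vcyc.
  exists (TS_map x (s 0%N) v); move: v {vcyc}; apply: TS_ext.
  - by apply: linear_sub; [exact: linear_comp|exact: linear_idfun].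
  - exact: linear_comp.
  - by move=> m; rewrite !TS_map_gen s0 TS_genB.
have dv : TS_map x (res_d P n) v = 0 by apply/eqP.
exists (TS_map x (s n.+1) v).
have E w : TS_map x (psi n.+1) (TS_map x (phi n.+1) w) - w
    - TS_map x (s n) (TS_map x (res_d P n) w) = TS_map x (res_d P n.+1) (TS_map x (s n.+1) w).
  move: w; apply: TS_ext.
  - by do ?apply: linear_sub; try exact: linear_comp; exact: linear_idfun.
  - exact: linear_comp.
  - by move=> m; rewrite !TS_map_gen sS !TS_genB.
by rewrite -E dv linear0 subr0.
Qed.

Lemma l2_betti_eq (F : presheaf R J) (P Q : proj_resolution F) x n :
  l2_betti P x n = l2_betti Q x n.
Proof. have PQ := l2_betti_le P Q x n; have QP := l2_betti_le Q P x n.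
move: (l2_betti P x n) (l2_betti Q x n) PQ QP => b c bc cb.
by apply: le_anti; rewrite bc cb. Qed.

End Invariance.

(** * The von Neumann dimension for the trivial group *)

(** If E = L M is a rank factorization, idempotency forces M L = 1, and the traces
    of L M and M L agree. *)
Lemma mxtrace_idempotent (F : fieldType) n (E : 'M[F]_n) :
  E *m E = E -> \tr E = (\rank E)%:R.
Proof.
move=> EE; have E0 := mulmx_base E.
suff h : row_base E *m col_base E = 1%:M by rewrite -{1}E0 mxtrace_mulC h mxtrace1.
have : col_base E *m (row_base E *m col_base E) *m row_base E = col_base E *m 1%:M *m row_base E.
  by rewrite mulmx1 E0 mulmxA E0 -mulmxA E0 EE.
move/(row_free_inj (row_base_free E)).
by move/(row_full_inj (col_base_full E)).
Qed.

Section TrivialGroup.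
Variables (R : realType) (G : groupType).
Hypothesis G1 : forall g : G, g = 1%g.
Local Notation N := (vN R G).
Local Notation C := (R[i]).

Lemma l2_trivial (f : l2 R G) : f = (f 1%g) *: delta1 R G.
Proof.
apply: val_inj; apply/funext => g /=.
rewrite (G1 g); transitivity (f 1%g * (1%g == 1%g :> G)%:R); last by [].
by rewrite eqxx mulr1.
Qed.

(** The Hilbert space is a line, so every operator is multiplication by its trace. *)
Lemma vN_trivialE (T : N) (f : l2 R G) : T f = vN_trace T *: f.
Proof.
have TZ c (h : l2 R G) : T (c *: h) = c *: T h.
  pose TL : {linear l2 R G -> l2 R G} := HB.pack (T : l2 R G -> l2 R G)
    (GRing.isLinear.Build _ _ _ _ (T : l2 R G -> l2 R G) (vN_linear T)).
  exact: (linearZ_LR TL).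
rewrite [in LHS](l2_trivial f) TZ [T _]l2_trivial /vN_trace scalerA mulrC -scalerA.
by rewrite -l2_trivial.
Qed.

Lemma vN_trace1 : vN_trace (1 : N) = 1.
Proof. by rewrite /vN_trace /= eqxx. Qed.

Lemma vN_traceM (S T : N) : vN_trace (S * T) = vN_trace S * vN_trace T.
Proof. by rewrite {1}/vN_trace /= vN_trivialE. Qed.

Lemma vN_trace_inj (S T : N) : vN_trace S = vN_trace T -> S = T.
Proof.
move=> ST; apply: val_inj; apply/funext => f.
by rewrite [LHS]vN_trivialE [RHS]vN_trivialE ST.
Qed.

Lemma vN_traceZ c : vN_trace (c *: (1 : N)) = c.
Proof.
transitivity (c * (1%g == 1%g :> G)%:R); first by [].
by rewrite eqxx mulr1.
Qed.

(** For the trivial group the trace is a ring isomorphism onto the complex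
    numbers, which reduces matrices over N(1) to complex matrices. *)
Definition ctrace (T : N^c) : C := vN_trace T.

Fact ctrace_zmod : zmod_morphism ctrace.
Proof. by []. Qed.
Fact ctrace_monoid : monoid_morphism ctrace.
Proof. by split; [exact: vN_trace1|move=> S T; rewrite /ctrace vN_traceM mulrC]. Qed.
HB.instance Definition _ := GRing.isZmodMorphism.Build N^c C ctrace ctrace_zmod.
HB.instance Definition _ := GRing.isMonoidMorphism.Build N^c C ctrace ctrace_monoid.

(** An idempotent E has trace its rank. The map f is injective on the row space of
    E and has values in a line, so the rank is at most 1; the identity matrix of
    size 1 attains the bound. *)
Lemma vN_dim_line (M : lmodType N^c) (g : M) :
  (forall m, exists c : N^c, m = c *: g) -> (forall c : N^c, c *: g = 0 -> c = 0) ->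
  vN_dim M = 1%E.
Proof.
move=> gen free; apply: le_anti; apply/andP; split.
  apply: ge_ereal_sup => _ [k [E [f [EE finj ->]]]].
  pose E' := map_mx ctrace E.
  have EE' : E' *m E' = E' by rewrite -map_mxM EE.
  have trE : \sum_(i < k) vN_trace (E i i) = (\rank E')%:R.
    by rewrite -mxtrace_idempotent//; apply: eq_bigr => i _; rewrite mxE.
  have /choice[c cP] : forall i, exists c : N^c, f (delta_mx 0 i) = c *: g by move=> i; exact: gen.
  pose c' : 'cV[C]_k := \col_i ctrace (c i).
  have fE (v : 'rV[N^c]_k) : f v = (\sum_i v 0 i * c i) *: g.
    rewrite {1}(row_sum_delta v) linear_sum scaler_suml; apply: eq_bigr => i _.
    by rewrite linearZ /= cP scalerA.
  have ker0 : (E' :&: kermx c')%MS = 0.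
    apply/eqP; rewrite -submx0; apply/row_subP => i.
    set w := row i _.
    have /submxP[u uE] : (w <= E')%MS by apply: submx_trans (row_sub _ _) (capmxSl _ _).
    have wc : w *m c' = 0.
      by apply/sub_kermxP; apply: submx_trans (row_sub _ _) (capmxSr _ _).
    have wE : w *m E' = w by rewrite uE -mulmxA EE'.
    pose v : 'rV[N^c]_k := map_mx (fun a => (a *: (1 : N)) : N^c) w.
    have vw : map_mx ctrace v = w.
      by apply/rowP => j; rewrite !mxE /ctrace vN_traceZ.
    have v0 : v = 0.
      apply: finj.
        apply/rowP => j; apply: vN_trace_inj.
        have := congr1 (fun A : 'rV[C]_k => A 0 j) wE.
        by rewrite -[in LHS]vw -map_mxM mxE -[in RHS]vw [in RHS]mxE.
      rewrite fE; suff -> : \sum_i v 0 i * c i = 0 by rewrite scale0r.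
      have wc0 : \sum_j w 0 j * c' j 0 = 0.
        by have := congr1 (fun A : 'M[C]_1 => A 0 0) wc; rewrite !mxE.
      apply: vN_trace_inj; transitivity (ctrace (\sum_i v 0 i * c i)); first by [].
      rewrite rmorph_sum -[RHS]/(ctrace 0) rmorph0 -[RHS]wc0.
      by apply: eq_bigr => j _; rewrite rmorphM /= -[in RHS]vw !mxE.
    by rewrite -vw v0 map_mx0 sub0mx.
  have rk : (\rank E' <= 1)%N.
    rewrite -(mxrank_mul_ker E' c') ker0 mxrank0 addn0.
    exact: rank_leq_col.
  rewrite trE lee_fin; case: (\rank E') rk => [|[|]] //= _; rewrite ?raddf0 //.
apply: ereal_sup_ubound.
have fl : linear (fun v : 'rV[N^c]_1 => v 0 0 *: g).
  by move=> a u v; rewrite !mxE scalerDl scalerA.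
pose f : {linear 'rV[N^c]_1 -> M} := HB.pack (fun v : 'rV[N^c]_1 => v 0 0 *: g)
  (GRing.isLinear.Build _ _ _ _ _ fl).
exists 1%N, 1%:M, f; split.
- exact: mulmx1.
- by move=> v _ /free v0; apply/rowP => i; rewrite ord1 v0 mxE.
- by rewrite big_ord1 mxE eqxx /= vN_trace1.
Qed.

Lemma vN_dim_zero (M : lmodType N^c) : (forall m : M, m = 0) -> vN_dim M = 0%E.
Proof.
move=> M0; apply: le_anti; apply/andP; split.
  apply: ge_ereal_sup => _ [k [E [f [EE finj ->]]]].
  have E0 : E = 0.
    apply/row_matrixP => i; rewrite row0; apply: finj; last exact: M0.
    by rewrite -row_mul EE.
  by rewrite E0 big1 // => i _; rewrite mxE.
apply: ereal_sup_ubound; exists 0%N, 0, (\0%R : {linear 'rV[N^c]_0 -> M}); split.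
- exact: mul0mx.
- by move=> v _ _; apply/rowP => -[].
- by rewrite big_ord0.
Qed.

End TrivialGroup.

(** * Complexes concentrated in one degree *)

Section ConcentratedComplex.
Variables (A : pzRingType) (V : nat -> lmodType A) (d : forall n, {linear V n.+1 -> V n}).

Lemma homology_zero n : (forall v : V n, v = 0) -> forall h : homology d n, h = 0.
Proof.
move=> V0 h; rewrite -(quotmod_repr h) -(linear0 (quotmod_pi _)); congr quotmod_pi.
by apply: val_inj => /=; exact: V0.
Qed.

Lemma homology_line n (g : V n) : (forall k, k <> n -> forall v : V k, v = 0) ->
  (forall m, exists c : A, m = c *: g) -> (forall c : A, c *: g = 0 -> c = 0) ->
  exists h : homology d n,
    (forall m, exists c : A, m = c *: h) /\ (forall c : A, c *: h = 0 -> c = 0).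
Proof.
move=> V0 gen free.
have gc : g \in Submodule (@cycle_submod_closed A V d n).
  case: n g V0 gen free => [//|n] g V0 _ _; apply/eqP; apply: V0.
  by apply/eqP; rewrite neq_ltn ltnSn.
pose z : cycles d n := Submod gc.
exists (quotmod_pi (Submodule (@boundary_submod_closed A V d n)) z); split=> [m|c].
  rewrite -(quotmod_repr m); have [c cP] := gen (submod_val (repr m)).
  by exists c; rewrite -linearZ; congr quotmod_pi; apply: val_inj.
rewrite -linearZ -(linear0 (quotmod_pi _)) => /quotmod_piP; rewrite subr0 => /asboolP[v /= dv].
apply: free; rewrite -[_ *: g]dv (V0 n.+1 _ v) ?linear0//.
by apply/eqP; rewrite neq_ltn ltnSn orbT.
Qed.

End ConcentratedComplex.

(** * The splitting functor at an object without automorphisms *)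

Section TensorOfSplitting.
Variables (R : realType) (J : category) (x : J) (F : presheaf R J).
Local Notation N := (vN R (aut x)).
Local Notation C := (R[i]).
Local Notation im := (gen_submod (@split_image R J x F)).

Lemma tensor_genZ (m : splitting x F) (c : C) :
  tensor_gen (c *: m) = (c *: (1 : N) : N^c) *: tensor_gen m.
Proof.
rewrite /tensor_gen -linearZ; apply/quotmod_piP.
have -> : (c *: (1 : N) : N^c) *: << m >> = << (c *: (1 : N) : N^c) *g m >> :> {freeg (splitting x F) / N^c}.
  by apply/eqP/freeg_eqP => k; rewrite coeffZ !coeffU mul1r.
by apply/asboolP => S; apply; right; left; exists c, m.
Qed.

Lemma TS_zero : (forall m, m \in im) -> forall t : TS x F, t = 0.
Proof.
move=> Fim; apply: (TS_ext (f := fun t => t) (g := fun=> 0)) => // [a u v|m].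
  by rewrite scaler0 addr0.
have E : quotmod_pi im m = quotmod_pi im 0 by apply/quotmod_piP; rewrite subr0.
by rewrite /TS_gen E; exact: TS_gen0.
Qed.

Hypothesis aut1 : forall g : aut x, g = 1%g.
Variables (b : F x) (lam : {linear F x -> C^o}).
Hypothesis lam_im : forall y (u : @hom J x y) m, ~ invertible u -> lam (psh_map F u m) = 0.
Hypothesis lam_b : lam b = 1.
Hypothesis b_gen : forall m, m - lam m *: b \in im.

Lemma TS_gen_line (t : TS x F) : exists c : N^c, t = c *: TS_gen b.
Proof.
have h (m : splitting x F) : exists c : N^c, tensor_gen m = c *: TS_gen b.
  rewrite -(quotmod_repr m); set m0 := repr _.
  exists (lam m0 *: (1 : N)); rewrite /TS_gen -tensor_genZ; congr tensor_gen.
  by rewrite -linearZ; apply/quotmod_piP; exact: b_gen.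
rewrite -(quotmod_repr t); set s := repr _.
rewrite -[s]freeg_sumE linear_sum.
apply: (big_ind (fun t : TS x F => exists c : N^c, t = c *: TS_gen b)).
- by exists 0; rewrite scale0r.
- by move=> _ _ [c ->] [c' ->]; exists (c + c'); rewrite scalerDl.
- move=> m _; have [c cE] := h m.
  have -> : << coeff m s *g m >> = coeff m s *: << m >> :> {freeg (splitting x F) / N^c}.
    by apply/eqP/freeg_eqP => k; rewrite coeffZ !coeffU mul1r.
  rewrite linearZ /=; exists (coeff m s * c); rewrite -scalerA -cE //.
Qed.

Lemma lam_kills m : m \in im -> lam m = 0.
Proof.
pose K := [pred m | lam m == 0].
have Kcl : submod_closed K.
  split; first by rewrite inE linear0.
  move=> a u v; rewrite !inE => /eqP u0 /eqP v0.
  by rewrite linearP u0 v0 scaler0 addr0.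
move=> /asboolP/(_ (Submodule Kcl)) h; apply/eqP; apply: h => _ [y [u [m' [uN ->]]]].
by rewrite inE lam_im.
Qed.

Definition lamq (q : splitting x F) : C := lam (repr (q : Quotient.quot im)).

Lemma lamqE m : lamq (quotmod_pi im m) = lam m.
Proof.
apply/eqP; rewrite /lamq -subr_eq0 -linearB; apply/eqP; apply: lam_kills.
by apply/quotmod_piP; rewrite quotmod_repr.
Qed.

Lemma lamqP a u v : lamq (a *: u + v) = a * lamq u + lamq v.
Proof.
rewrite -(quotmod_repr u) -(quotmod_repr v).
by rewrite -[_ *: _ + _]linearP !lamqE linearP.
Qed.

(** The form lam annihilates the image of the non-invertible morphisms, and hence
    induces a map to N(1) that sends the generator to 1. *)
Lemma TS_gen_free (c : N^c) : c *: TS_gen b = 0 -> c = 0.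
Proof.
pose L : {linear {freeg (splitting x F) / N^c} -> (N^c)^o} :=
  fglift (fun m : splitting x F => lamq m *: (1 : N) : (N^c)^o).
have LU (a : N^c) m : L << a *g m >> = a * (lamq m *: (1 : N) : N^c).
  exact: liftU.
rewrite /TS_gen /tensor_gen -linearZ -(linear0 (quotmod_pi _)) => /quotmod_piP.
rewrite subr0.
pose K : {pred {freeg (splitting x F) / N^c}} := fun r => L r == 0.
have Kcl : submod_closed K.
  split; first by rewrite unfold_in /K linear0.
  move=> a u v; rewrite !unfold_in /K => /eqP u0 /eqP v0.
  by rewrite linearP u0 v0 scaler0 addr0.
move=> /asboolP/(_ (Submodule Kcl)) h.
have {h} : c *: << quotmod_pi im b >> \in Submodule Kcl.
  apply: h => r rr; rewrite unfold_in /= /K.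
  have lamq0 : lamq 0 = 0 by have := lamqE 0; rewrite !linear0.
  have lamqD m m' : lamq (m + m') = lamq m + lamq m'.
    by have := lamqP 1 m m'; rewrite scale1r mul1r.
  have lamqZ a m : lamq (a *: m) = a * lamq m.
    by have := lamqP a m 0; rewrite lamq0 !addr0.
  case: rr => [[m [m' ->]]|[[a [m ->]]|[g [m ->]]]].
  - rewrite !linearB /= !LU !mul1r lamqD scalerDl.
    by rewrite [X in X - _]addrAC subrr add0r subrr.
  - rewrite linearB /= !LU mul1r lamqZ subr_eq0; apply/eqP; apply: (vN_trace_inj aut1).
    rewrite vN_traceZ [RHS](vN_traceM aut1) !vN_traceZ mulrC //.
  - rewrite linearB /= !LU mul1r.
    have -> : rep_act (splitting x F) g m = m by rewrite (aut1 g); exact: rep_act1.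
    rewrite subr_eq0; apply/eqP; apply: (vN_trace_inj aut1).
    rewrite [RHS](vN_traceM aut1) vN_traceZ.
    have -> : vN_trace (vN_group R g) = 1.
      by rewrite (aut1 g) /vN_trace /= invg1 mul1g eqxx.
    by rewrite ?mulr1 ?mul1r.
rewrite unfold_in /= /K linearZ /= LU lamqE lam_b mul1r scale1r => /eqP.
by rewrite [_ *: _]mulr1.
Qed.

End TensorOfSplitting.

(** * Morphisms of the subdivision *)

Section Arrows.
Variable C : category.

Definition arrow := {x : C & {y : C & @hom C x y}}.

(** Morphisms with their endpoints: equations between morphisms whose endpoints
    are only provably equal are stated for arrows. *)
Definition arr (x y : C) (f : @hom C x y) : arrow := existT _ x (existT _ y f).

Lemma arr_inj (x y : C) (f g : @hom C x y) : arr f = arr g -> f = g.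
Proof.
have dec (T : Type) : forall a b : T, {a = b} + {a <> b} by move=> a b; exact: pselect.
move=> fg; have fg' := inj_pair2_eq_dec _ (dec _) _ _ _ _ fg.
exact: (inj_pair2_eq_dec _ (dec _) _ _ _ _ fg').
Qed.

Definition arrow_is_id (a : arrow) : Prop := is_id (projT2 (projT2 a)).

Lemma is_id_arr (x y x' y' : C) (f : @hom C x y) (g : @hom C x' y') :
  arr f = arr g -> is_id f -> is_id g.
Proof. by move=> fg; rewrite -[is_id f]/(arrow_is_id (arr f)) fg. Qed.

Lemma arr_cmp_idl (x y z : C) (g : @hom C y z) (f : @hom C x y) :
  is_id g -> arr (cmp g f) = arr f.
Proof. by case; rewrite cmp1m. Qed.

Lemma arr_cmp_idr (x y z : C) (g : @hom C y z) (f : @hom C x y) :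
  is_id f -> arr (cmp g f) = arr g.
Proof. by move=> fi; case: fi g => g; rewrite cmpm1. Qed.

End Arrows.

Lemma functor_ext (C D : category) (F G : functor C D) :
  (forall (x y : C) (f : @hom C x y), arr (fmap F f) = arr (fmap G f)) -> F = G.
Proof.
case: F G => [Fo Ff F1 FM] [Go Gf G1 GM] /= FG.
have oE : Fo = Go by apply/funext => x; exact: (congr1 (@projT1 _ _) (FG x x (idm x))).
move: Ff Gf F1 FM G1 GM FG; rewrite oE => Ff Gf F1 FM G1 GM FG.
have fE : Ff = Gf.
  by do 3 (apply: functional_extensionality_dep => ?); apply: arr_inj; exact: FG.
by move: F1 FM G1 GM; rewrite fE => *; congr Functor; exact: Prop_irrelevance.
Qed.

Section Ordinals.

Lemma ordcat_arr p (i j i' j' : ordcat p) (f : @hom (ordcat p) i j)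
  (g : @hom (ordcat p) i' j') : i = i' -> j = j' -> arr f = arr g.
Proof. by move=> ii jj; move: f g; rewrite ii jj => f g; rewrite (bool_irrelevance f g). Qed.

Lemma ordcat_functor_ext p q (F G : functor (ordcat p) (ordcat q)) :
  (forall i, F i = G i) -> F = G.
Proof. by move=> FG; apply: functor_ext => i j f; exact: ordcat_arr. Qed.

Definition ord_functor p q (h : 'I_p.+1 -> 'I_q.+1)
    (hm : forall i j : 'I_p.+1, (i <= j)%N -> (h i <= h j)%N) :
    functor (ordcat p) (ordcat q) :=
  @Functor (ordcat p) (ordcat q) h (fun i j ij => hm i j ij)
    (fun=> bool_irrelevance _ _) (fun _ _ _ _ _ => bool_irrelevance _ _).

Variables (C : category) (q : nat) (Y : chain q C).

Lemma is_id_same (i j : ordcat q) (ij : @hom (ordcat q) i j) :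
  i = j -> is_id (fmap Y ij).
Proof.
move=> E; move: ij; rewrite -E => ij.
have -> : ij = idm i by exact: bool_irrelevance.
by rewrite fmap1; exact: IsId.
Qed.

(** If f took the same value at two consecutive indices, the chain Y f would
    contain an identity there. *)
Lemma nondegenerate_lt p (f : functor (ordcat p) (ordcat q)) (i j : 'I_p.+1) :
  nondegenerate (fcomp Y f) -> (i < j)%N -> (f i < f j)%N.
Proof.
move=> nd.
have succ (a b : 'I_p.+1) : b = a.+1 :> nat -> (f a < f b)%N.
  move=> ba; have ab : (a <= b)%N by rewrite ba.
  have fab := ordcat_mono f ab; rewrite ltn_neqAle fab andbT.
  apply/negP => /eqP fE; apply: (nd a b ab ba); apply: is_id_same.
  exact: val_inj.
case: j => j jp /=; elim: j jp => // j IH jp.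
rewrite ltnS leq_eqVlt => /orP[/eqP ij|ij].
  by apply: succ; rewrite /= ij.
have jp' : (j < p.+1)%N by apply: ltnW.
exact: ltn_trans (IH jp' ij) (succ (Ordinal jp') (Ordinal jp) erefl).
Qed.

Lemma nondegenerate_gap p (f : functor (ordcat p) (ordcat q)) (i j : 'I_p.+1) :
  nondegenerate (fcomp Y f) -> (i <= j)%N -> (f i + (j - i) <= f j)%N.
Proof.
move=> nd; case: j => j jp /=; elim: j jp => [|j IH] jp.
  rewrite leqn0 => /eqP i0; rewrite i0 addn0.
  by have -> : i = Ordinal jp by apply: val_inj.
rewrite leq_eqVlt => /orP[/eqP ij|ij].
  by have -> : i = Ordinal jp by [exact: val_inj]; rewrite /= subnn addn0.
have jp' : (j < p.+1)%N by apply: ltnW.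
rewrite subSn// addnS; apply: leq_ltn_trans (IH jp' ij) _.
exact: nondegenerate_lt.
Qed.

Lemma nondegenerate_len p (f : functor (ordcat p) (ordcat q)) :
  nondegenerate (fcomp Y f) -> (p <= q)%N.
Proof.
move=> nd; have := nondegenerate_gap nd (leq0n (ord_max : 'I_p.+1)) (i := ord0).
rewrite subn0 => h; have := ltn_ord (f ord_max : 'I_q.+1); rewrite ltnS.
by apply: leq_trans; apply: leq_trans h; exact: leq_addl.
Qed.

Lemma nondegenerate_id p (f : functor (ordcat p) (ordcat q)) (i : 'I_p.+1) :
  nondegenerate (fcomp Y f) -> p = q -> f i = i :> nat.
Proof.
move=> nd pq.
have h1 := nondegenerate_gap nd (leq0n i) (i := ord0).
have h2 := nondegenerate_gap nd (leq_ord i) (j := ord_max).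
have := ltn_ord (f ord_max : 'I_q.+1); have := ltn_ord i.
move: h1 h2; rewrite /= subn0; lia.
Qed.

End Ordinals.

Section SubdivisionMorphisms.
Variable C : category.
Implicit Types X Y : ndchain C.

Lemma premor_nondegenerate X Y (f : sd_premor X Y) : nondegenerate (fcomp Y (sval f)).
Proof. by rewrite (svalP f); exact: ndchainP. Qed.

Lemma sd_hom_len X Y : sd_hom X Y -> (len X <= len Y)%N.
Proof. by move=> u; exact: (nondegenerate_len (@premor_nondegenerate _ _ (repr u))). Qed.

Lemma sd_premor_id X (f : sd_premor X X) : f = sd_preid X.
Proof.
apply: sd_premorP; apply: ordcat_functor_ext => i; apply: val_inj => /=.
exact: (nondegenerate_id _ (@premor_nondegenerate _ _ f)).
Qed.

Lemma sd_hom_id X (u : sd_hom X X) : u = sd_id X.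
Proof. by rewrite -[u]reprK /sd_id (sd_premor_id (repr u)). Qed.

Lemma sd_hom_len_eq X Y : sd_hom X Y -> len X = len Y -> X = Y.
Proof.
move=> /repr; case: X Y => [n F Fnd] [m G Gnd] /= f nm; subst m.
have fE : sval f = fid (ordcat n).
  apply: ordcat_functor_ext => i; apply: val_inj => /=.
  exact: (nondegenerate_id _ (@premor_nondegenerate _ _ f)).
have := svalP f; rewrite fE /= fcompf1 => GF; subst F.
by congr NDChain; exact: Prop_irrelevance.
Qed.

(** Since premorphisms are strictly increasing, a morphism between chains of the
    same length is the identity. *)
Lemma sd_invertibleP X Y (u : @hom (op_cat (Sd C)) Y X) :
  invertible u <-> len X = len Y.
Proof.
split=> [[v _]|lE].
  by apply/eqP; rewrite eqn_leq (sd_hom_len u) (sd_hom_len v).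
have XY := sd_hom_len_eq u lE; subst Y.
by rewrite (sd_hom_id u); exact: (@invertible_id (op_cat (Sd C)) X).
Qed.

Lemma sd_aut1 X (g : @aut (op_cat (Sd C)) X) : g = 1%g.
Proof. by apply: aut_inj; rewrite (sd_hom_id (sval g)). Qed.

Lemma sd_isomorphic X Y : @isomorphic (op_cat (Sd C)) X Y -> X = Y.
Proof.
move=> /asboolP[u ui]; symmetry; apply: (sd_hom_len_eq u).
by apply/esym; have /sd_invertibleP := ui => ->.
Qed.

End SubdivisionMorphisms.

(** * Faces and cones of simplices *)

Section Faces.
Variable q : nat.
Implicit Types p : nat.

Lemma lift_mono p (k : 'I_p.+2) (i j : 'I_p.+1) : (i <= j)%N -> (fintype.lift k i <= fintype.lift k j)%N.
Proof. by rewrite /= /bump; lia. Qed.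

Definition coface p (k : 'I_p.+2) : functor (ordcat p) (ordcat p.+1) :=
  ord_functor (@lift_mono p k).

Definition face p (k : 'I_p.+2) (f : functor (ordcat p.+1) (ordcat q)) :
  functor (ordcat p) (ordcat q) := fcomp f (coface k).

Definition cone_fun p (f : functor (ordcat p) (ordcat q)) (i : 'I_p.+2) : 'I_q.+1 :=
  if unlift ord0 i is Some j then f j else ord0.

Lemma cone_fun0 p (f : functor (ordcat p) (ordcat q)) : cone_fun f ord0 = ord0.
Proof. by rewrite /cone_fun unlift_none. Qed.

Lemma cone_funS p (f : functor (ordcat p) (ordcat q)) j : cone_fun f (fintype.lift ord0 j) = f j.
Proof. by rewrite /cone_fun liftK. Qed.

Lemma cone_mono p (f : functor (ordcat p) (ordcat q)) (i j : 'I_p.+2) :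
  (i <= j)%N -> (cone_fun f i <= cone_fun f j)%N.
Proof.
have [i' ->|->] := unliftP ord0 i; last by rewrite cone_fun0.
have [j' ->|->] := unliftP ord0 j; last by rewrite /= /bump.
rewrite !cone_funS /= /bump /= !add1n ltnS => ij; exact: ordcat_mono.
Qed.

(** The simplex f with a new first vertex 0. *)
Definition cone p (f : functor (ordcat p) (ordcat q)) :
  functor (ordcat p.+1) (ordcat q) := ord_functor (@cone_mono p f).

Lemma face0_cone p (f : functor (ordcat p) (ordcat q)) : face ord0 (cone f) = f.
Proof. by apply: ordcat_functor_ext => i /=; exact: cone_funS. Qed.

Lemma faceS_cone p (f : functor (ordcat p.+1) (ordcat q)) (k : 'I_p.+2) :
  face (fintype.lift ord0 k) (cone f) = cone (face k f).
Proof.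
apply: ordcat_functor_ext => i /=; have [j ->|->] := unliftP ord0 i.
  have -> : fintype.lift (fintype.lift ord0 k) (fintype.lift ord0 j) = fintype.lift ord0 (fintype.lift k j).
    by apply: val_inj; rewrite /= /bump; lia.
  by rewrite !cone_funS.
have -> : fintype.lift (fintype.lift ord0 k) ord0 = ord0 by apply: val_inj.
by rewrite !cone_fun0.
Qed.

Definition vertex0 : functor (ordcat 0) (ordcat q) :=
  @ord_functor 0 q (fun=> ord0) (fun _ _ _ => leqnn 0).

Lemma faceS_cone0 (f : functor (ordcat 0) (ordcat q)) :
  face (fintype.lift ord0 ord0) (cone f) = vertex0.
Proof.
apply: ordcat_functor_ext => i /=.
have -> : fintype.lift (fintype.lift ord0 ord0) i = ord0 by apply: val_inj; case: i => [[|m] im].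
exact: cone_fun0.
Qed.

End Faces.

Lemma cone_coface0 p : cone (coface (ord0 : 'I_p.+2)) = fid (ordcat p.+1).
Proof.
apply: ordcat_functor_ext => i /=; have [j ->|->] := unliftP ord0 i.
  by rewrite cone_funS.
by rewrite cone_fun0.
Qed.

Lemma face_push q q' p (h : functor (ordcat q) (ordcat q')) (k : 'I_p.+2)
  (f : functor (ordcat p.+1) (ordcat q)) : face k (fcomp h f) = fcomp h (face k f).
Proof. by rewrite /face fcompA. Qed.

(** * Normalized chains *)

Section SimplicialChains.
Variables (R : realType) (I : category).
Local Notation C := (R[i]).

Section Chains.
Variables (n q : nat) (Y : functor (ordcat q) I).
Local Notation simplex := (functor (ordcat n) (ordcat q)).

(** The relation that generates the equivalence of premorphisms of the
    subdivision, for maps whose source need not be a nondegenerate chain. *)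
Definition simplex_rel (f g : simplex) := forall i : 'I_n.+1,
  is_id (@fmap _ _ Y (Order.min (f i) (g i)) (Order.max (f i) (g i)) (min_le_max _ _)).

Definition chain_rels : set {freeg {classic simplex} / C} :=
  [set r | (exists f g : {classic simplex}, simplex_rel f g /\ r = << f >> - << g >>)
        \/ (exists f : {classic simplex}, ~ nondegenerate (fcomp Y f) /\ r = << f >>)].

(** The simplices of [q] modulo the relation above, with the degenerate ones set
    to zero: the normalized chains of the simplicial set that represents the
    morphisms of the subdivision into Y. The chain Y may be degenerate, so that
    every simplex f of Y has its own chains, those of Y f. *)
Definition chains : lmodType C := quotmod (gen_submod chain_rels).

Definition sx (f : simplex) : chains := quotmod_pi _ << (f : {classic simplex}) >>.

Lemma sx_rel f g : simplex_rel f g -> sx f = sx g.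
Proof.
move=> fg; apply/quotmod_piP; apply/asboolP => S; apply.
by left; exists f, g.
Qed.

Lemma sx_degenerate f : ~ nondegenerate (fcomp Y f) -> sx f = 0.
Proof.
move=> fd; rewrite /sx -(linear0 (quotmod_pi _)); apply/quotmod_piP; rewrite subr0.
by apply/asboolP => S; apply; right; exists f.
Qed.

Lemma chains_ind (P : chains -> Prop) : P 0 -> (forall u v, P u -> P v -> P (u + v)) ->
  (forall (c : C) f, P (c *: sx f)) -> forall v, P v.
Proof.
move=> P0 PD PS v; rewrite -(quotmod_repr v); set t := repr _.
rewrite -[t]freeg_sumE linear_sum; apply: big_ind => // f _.
have -> : << coeff f t *g f >> = coeff f t *: << f >> :> {freeg {classic simplex} / C}.
  by apply/eqP/freeg_eqP => k; rewrite coeffZ !coeffU mul1r.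
rewrite linearZ; exact: PS.
Qed.

Lemma chains_ext (W : lmodType C) (f g : {linear chains -> W}) :
  (forall s, f (sx s) = g (sx s)) -> f =1 g.
Proof.
move=> fg v; elim/chains_ind: v => [|u v fu fv|c s]; first by rewrite !linear0.
  by rewrite !linearD fu fv.
by rewrite !linearZ_LR fg.
Qed.

Variables (W : lmodType C) (phi : simplex -> W).
Hypothesis phi_rel : forall f g, simplex_rel f g -> phi f = phi g.
Hypothesis phi_deg : forall f, ~ nondegenerate (fcomp Y f) -> phi f = 0.

Let L : {linear {freeg {classic simplex} / C} -> W} := fglift (phi : {classic simplex} -> W).

Let LU f : L << (f : {classic simplex}) >> = phi f.
Proof. by transitivity ((1 : C) *: phi f); [exact: liftU|exact: scale1r]. Qed.

Lemma chains_lift_kills r : r \in gen_submod chain_rels -> L r = 0.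
Proof.
pose K : {pred {freeg {classic simplex} / C}} := fun r => L r == 0.
have Kcl : submod_closed K.
  split; first by rewrite unfold_in /K linear0.
  move=> a u v; rewrite !unfold_in /K => /eqP u0 /eqP v0.
  by rewrite linearP u0 v0 scaler0 addr0.
move=> /asboolP/(_ (Submodule Kcl)) h; apply/eqP; apply: h => {}r.
rewrite unfold_in /= /K => -[[f [g [fg ->]]]|[f [fd ->]]].
  by rewrite linearB !LU (phi_rel fg) subrr.
by rewrite LU phi_deg.
Qed.

Definition chains_lift_fun (v : chains) : W :=
  L (repr (v : Quotient.quot (gen_submod chain_rels))).

Lemma chains_lift_pi r : chains_lift_fun (quotmod_pi _ r) = L r.
Proof.
apply/eqP; rewrite -subr_eq0 -linearB; apply/eqP/chains_lift_kills.
by apply/quotmod_piP; rewrite quotmod_repr.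
Qed.

Lemma chains_lift_linear : linear chains_lift_fun.
Proof.
move=> a u v; rewrite -(quotmod_repr u) -(quotmod_repr v) -linearP.
by rewrite !chains_lift_pi linearP.
Qed.

Lemma chains_lift_exists : { f : {linear chains -> W} | forall s, f (sx s) = phi s }.
Proof.
pose f : {linear chains -> W} :=
  HB.pack chains_lift_fun (GRing.isLinear.Build _ _ _ _ _ chains_lift_linear).
by exists f => s; rewrite [LHS]chains_lift_pi LU.
Qed.

Definition chains_lift : {linear chains -> W} := sval chains_lift_exists.

Lemma chains_lift_sx f : chains_lift (sx f) = phi f.
Proof. exact: (svalP chains_lift_exists). Qed.

End Chains.

Lemma is_id_min_max q (Y : functor (ordcat q) I) (a b : 'I_q.+1) (ab : @hom (ordcat q) a b) :
  is_id (fmap Y ab) ->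
  is_id (@fmap _ _ Y (Order.min a b) (Order.max a b) (min_le_max _ _)) /\
  is_id (@fmap _ _ Y (Order.min b a) (Order.max b a) (min_le_max _ _)).
Proof.
have ab' : (a <= b)%O by rewrite leEord.
by move=> h; split; apply: is_id_eq h; rewrite ?(min_l ab') ?(max_r ab') ?(min_r ab') ?(max_l ab').
Qed.

Lemma nondegenerateN n (X : functor (ordcat n) I) : ~ nondegenerate X ->
  exists (i j : ordcat n) (ij : @hom (ordcat n) i j), j = i.+1 :> nat /\ is_id (fmap X ij).
Proof.
move=> Xd; apply: contrapT => h; apply: Xd => i j ij ji Xid; apply: h.
by exists i, j, ij.
Qed.

Section Maps.
Variables (q : nat) (Y : functor (ordcat q) I).
Local Notation Q n := (chains n Y).

Lemma face_rel n (k : 'I_n.+2) (f g : functor (ordcat n.+1) (ordcat q)) :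
  simplex_rel Y f g -> simplex_rel Y (face k f) (face k g).
Proof. by move=> fg i; exact: fg. Qed.

Definition bd_simplex n (f : functor (ordcat n.+1) (ordcat q)) : Q n :=
  \sum_(k < n.+2) (-1) ^+ k *: sx Y (face k f).

Lemma bd_rel n (f g : functor (ordcat n.+1) (ordcat q)) :
  simplex_rel Y f g -> bd_simplex f = bd_simplex g.
Proof.
by move=> fg; apply: eq_bigr => k _; congr (_ *: _); apply: sx_rel; exact: face_rel.
Qed.

(** The faces that keep both endpoints of an identity of Y f are degenerate, and
    the two that omit one of them are related and have opposite signs. *)
Lemma bd_degenerate n (f : functor (ordcat n.+1) (ordcat q)) :
  ~ nondegenerate (fcomp Y f) -> bd_simplex f = 0.
Proof.
move=> /nondegenerateN[i [j [ij [ji Yid]]]].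
have iNj : j != i by rewrite -val_eqE /= ji; lia.
rewrite /bd_simplex (bigD1 i)//= (bigD1 j)//= big1 ?addr0; last first.
  move=> k /andP[ki kj]; rewrite sx_degenerate ?scaler0// => nd.
  have [i' iE _] := unlift_some ki; have [j' jE _] := unlift_some kj.
  have kiN : (k : nat) <> i by move=> E; move: ki; rewrite (val_inj E) eqxx.
  have kjN : (k : nat) <> j by move=> E; move: kj; rewrite (val_inj E) eqxx.
  have iv : (i : nat) = bump k i' := congr1 val iE.
  have jv : (j : nat) = bump k j' := congr1 val jE.
  have ji' : j' = i'.+1 :> nat by move: ji kiN kjN iv jv; rewrite /bump; lia.
  have ij' : (i' <= j')%N by rewrite ji'.
  apply: (nd i' j' ij' ji'); exact: is_id_eq iE jE Yid.
rewrite (sx_rel (f := face i f) (g := face j f)).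
  by rewrite -scalerDl ji exprS mulN1r subrr scale0r.
move=> l; have [li|li] := eqVneq (l : nat) i.
  have -> : face i f l = f j.
    by congr (fob f _); apply: val_inj; rewrite /= /bump; lia.
  have -> : face j f l = f i.
    by congr (fob f _); apply: val_inj; rewrite /= /bump; lia.
  exact: (is_id_min_max (Y := Y) (ab := fmap f ij) Yid).2.
have E : face i f l = face j f l.
  congr (fob f _); apply: val_inj; rewrite /= /bump; move: li; lia.
by apply: is_id_same; rewrite E minxx maxxx.
Qed.

Definition bd n : {linear Q n.+1 -> Q n} := chains_lift (@bd_rel n) (@bd_degenerate n).

Lemma bd_sx n (f : functor (ordcat n.+1) (ordcat q)) :
  bd n (sx Y f) = \sum_(k < n.+2) (-1) ^+ k *: sx Y (face k f).
Proof. exact: chains_lift_sx. Qed.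

Lemma cone_rel n (f g : functor (ordcat n) (ordcat q)) :
  simplex_rel Y f g -> sx Y (cone f) = sx Y (cone g).
Proof.
move=> fg; apply: sx_rel => i /=; have [j ->|->] := unliftP ord0 i.
  rewrite !cone_funS; exact: fg.
by apply: is_id_same; rewrite !cone_fun0 minxx maxxx.
Qed.

Lemma cone_degenerate n (f : functor (ordcat n) (ordcat q)) :
  ~ nondegenerate (fcomp Y f) -> sx Y (cone f) = 0.
Proof.
move=> /nondegenerateN[i [j [ij [ji Yid]]]]; apply: sx_degenerate => nd.
have ij' : (fintype.lift ord0 i <= fintype.lift ord0 j)%N by exact: lift_mono.
have ji' : fintype.lift ord0 j = (fintype.lift ord0 i).+1 :> nat by rewrite /= /bump; lia.
apply: (nd _ _ ij' ji').
have H := @is_id_eq _ _ Y _ _ _ _ (fmap f ij) (fmap (cone f) (ij' : @hom (ordcat n.+1) _ _)).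
by apply: H Yid; rewrite /= cone_funS.
Qed.

Definition cone_map n : {linear Q n -> Q n.+1} :=
  chains_lift (@cone_rel n) (@cone_degenerate n).

Lemma cone_map_sx n (f : functor (ordcat n) (ordcat q)) : cone_map n (sx Y f) = sx Y (cone f).
Proof. exact: chains_lift_sx. Qed.

Lemma augment_degenerate (f : functor (ordcat 0) (ordcat q)) :
  ~ nondegenerate (fcomp Y f) -> (1 : C^o) = 0.
Proof.
move=> /nondegenerateN[i [j [ij [ji _]]]]; move: ji.
by rewrite !ord1.
Qed.

Definition augmentation : {linear Q 0 -> C^o} :=
  chains_lift (phi := fun=> 1) (fun _ _ _ => erefl) augment_degenerate.

Lemma augment_sx f : augmentation (sx Y f) = 1.
Proof. exact: chains_lift_sx. Qed.

Lemma bd_cone0 v : bd 0 (cone_map 0 v) = v - augmentation v *: sx Y (vertex0 q).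
Proof.
elim/chains_ind: v => [|u v fu fv|c s].
- by rewrite !linear0 scale0r subr0.
- by rewrite !linearD fu fv scalerDl opprD addrACA.
- rewrite !linearZ_LR cone_map_sx bd_sx augment_sx !big_ord_recl big_ord0 addr0 /=.
  rewrite face0_cone (faceS_cone0 s) expr0 scale1r expr1 scaleN1r scalerBr.
  by rewrite scalerN; congr (_ - _ *: _); exact: (esym (mulr1 c)).
Qed.

(** Together with the formula in degree 0: the cone from the vertex 0 contracts the
    augmented complex. *)
Lemma bd_cone n v : bd n.+1 (cone_map n.+1 v) = v - cone_map n (bd n v).
Proof.
elim/chains_ind: v => [|u v fu fv|c s].
- by rewrite !linear0 addr0.
- by rewrite !linearD fu fv addrACA.
- rewrite !linearZ_LR cone_map_sx !bd_sx big_ord_recl face0_cone expr0 scale1r.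
  rewrite -scalerDr; congr (_ *: (_ + _)).
  rewrite -[RHS]/(- _) (linear_sum (cone_map n)) -sumrN; apply: eq_bigr => k _.
  rewrite (linearZ_LR (cone_map n)) cone_map_sx -scaleNr faceS_cone; congr (_ *: _).
  by rewrite /= /bump /= add1n exprS mulN1r.
Qed.

Lemma augment_bd v : augmentation (bd 0 v) = 0.
Proof.
elim/chains_ind: v => [|u v fu fv|c s].
- by rewrite !linear0.
- by rewrite !linearD fu fv addr0.
- rewrite !linearZ_LR bd_sx !big_ord_recl big_ord0 addr0 linearD !linearZ_LR !augment_sx.
  by rewrite expr0 expr1 scale1r scaleN1r subrr scaler0.
Qed.

End Maps.

Section Push.
Variables (q q' : nat) (Y : functor (ordcat q) I) (Y' : functor (ordcat q') I).
Variables (h : functor (ordcat q) (ordcat q')) (hY : fcomp Y' h = Y).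

Lemma push_rel n (f g : functor (ordcat n) (ordcat q)) :
  simplex_rel Y f g -> sx Y' (fcomp h f) = sx Y' (fcomp h g).
Proof.
move=> fg; apply: sx_rel => i; move: (fg i) => /=; move: (f i) (g i) => a b.
have mE : Order.min (h a) (h b) = h (Order.min a b).
  have [ab|/ltW ba] := leP a b; first by rewrite min_l // leEord ordcat_mono.
  by rewrite min_r // leEord ordcat_mono.
have ME : Order.max (h a) (h b) = h (Order.max a b).
  have [ab|/ltW ba] := leP a b; first by rewrite max_r // leEord ordcat_mono.
  by rewrite max_l // leEord ordcat_mono.
rewrite -hY /=.
exact: is_id_eq (esym mE) (esym ME).
Qed.

Lemma push_degenerate n (f : functor (ordcat n) (ordcat q)) :
  ~ nondegenerate (fcomp Y f) -> sx Y' (fcomp h f) = 0.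
Proof. by move=> fd; apply: sx_degenerate; rewrite fcompA hY. Qed.

Definition push n : {linear chains n Y -> chains n Y'} :=
  chains_lift (@push_rel n) (@push_degenerate n).

Lemma push_sx n (f : functor (ordcat n) (ordcat q)) : push n (sx Y f) = sx Y' (fcomp h f).
Proof. exact: chains_lift_sx. Qed.

Lemma push_bd n v : push n (bd Y n v) = bd Y' n (push n.+1 v).
Proof.
elim/chains_ind: v => [|u v fu fv|c s].
- by rewrite !linear0.
- by rewrite !linearD fu fv.
- rewrite !linearZ_LR push_sx !bd_sx linear_sum; congr (_ *: _); apply: eq_bigr => k _.
  by rewrite linearZ_LR push_sx face_push.
Qed.

Lemma push_augment v : augmentation Y' (push 0 v) = augmentation Y v.
Proof.
elim/chains_ind: v => [|u v fu fv|c s].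
- by rewrite !linear0.
- by rewrite !linearD fu fv.
- by rewrite !linearZ_LR push_sx !augment_sx.
Qed.

End Push.

(** Every simplex is the image of the top simplex of its own chain, which is a
    cone, so the contraction gives the equation by induction on the degree. *)
Lemma bd_bd n q (Y : functor (ordcat q) I) v : bd Y n (bd Y n.+1 v) = 0.
Proof.
elim: n q Y v => [|n IH] q Y v; elim/chains_ind: v => [|u v fu fv|c s];
  rewrite ?linear0 ?linearD ?fu ?fv ?addr0// !linearZ_LR.
- have -> : sx Y s = push (erefl (fcomp Y s)) 2 (cone_map _ 1 (sx _ (coface ord0))).
    by rewrite cone_map_sx cone_coface0 push_sx fcompf1.
  rewrite -!push_bd bd_cone linearB bd_cone0 augment_bd scale0r subr0 subrr.
  by rewrite linear0 scaler0.
- have -> : sx Y s = push (erefl (fcomp Y s)) n.+3 (cone_map _ n.+2 (sx _ (coface ord0))).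
    by rewrite cone_map_sx cone_coface0 push_sx fcompf1.
  by rewrite -!push_bd bd_cone linearB bd_cone IH linear0 subr0 subrr linear0 scaler0.
Qed.

End SimplicialChains.

(** * A projective resolution of the constant functor *)

Section SubdivisionResolution.
Variables (R : realType) (I : category).
Local Notation C := (R[i]).
Local Notation J := (op_cat (Sd I)).
Implicit Types X Y Z : ndchain I.

(** Both sides of the square formed by f i, f j, g i and g j that join f to g are
    sent to identities by Y. *)
Lemma simplex_rel_fcomp n q (Y : functor (ordcat q) I) (f g : functor (ordcat n) (ordcat q)) :
  simplex_rel Y f g -> fcomp Y f = fcomp Y g.
Proof.
move=> fg; apply: functor_ext => i j ij /=; move: (fg i) (fg j).
have := ordcat_mono f ij; have := ordcat_mono g ij.
move: (fmap f ij) (fmap g ij); move: (f i) (f j) (g i) (g j) => a b c d ab cd _ _.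
have gen (x y z t : ordcat q) (xy : @hom (ordcat q) x y)
    (zt : @hom (ordcat q) z t) (xz : @hom (ordcat q) x z)
    (yt : @hom (ordcat q) y t) : is_id (fmap Y xz) -> is_id (fmap Y yt) ->
    arr (fmap Y xy) = arr (fmap Y zt).
  move=> xzi yti; rewrite -(arr_cmp_idl _ yti) -fmapM -(arr_cmp_idr (fmap Y zt) xzi) -fmapM.
  by congr arr; congr fmap; exact: bool_irrelevance.
have mm1 (x y : ordcat q) (xy : @hom (ordcat q) x y) :
    is_id (@fmap _ _ Y (Order.min x y) (Order.max x y) (min_le_max _ _)) -> is_id (fmap Y xy).
  have xy' : ((x : 'I_q.+1) <= y)%O by rewrite leEord.
  by apply: is_id_eq; [exact: min_l|exact: max_r].
have mm2 (x y : ordcat q) (yx : @hom (ordcat q) y x) :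
    is_id (@fmap _ _ Y (Order.min x y) (Order.max x y) (min_le_max _ _)) -> is_id (fmap Y yx).
  have yx' : ((y : 'I_q.+1) <= x)%O by rewrite leEord.
  by apply: is_id_eq; [exact: min_r|exact: max_l].
have [ac|/ltnW ca] := leqP a c; have [bd|/ltnW db] := leqP b d => h1 h2.
- exact: gen (mm1 _ _ ac h1) (mm1 _ _ bd h2).
- have ad : @hom (ordcat q) a d by exact: leq_trans ac cd.
  have dd : is_id (fmap Y (leqnn d : @hom (ordcat q) d d)) by exact: is_id_same.
  have aa : is_id (fmap Y (leqnn a : @hom (ordcat q) a a)) by exact: is_id_same.
  rewrite -(gen _ _ _ _ ad ab _ _ aa (mm2 _ _ db h2)); exact: gen (mm1 _ _ ac h1) dd.
- have cb : @hom (ordcat q) c b by exact: leq_trans ca ab.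
  have bb : is_id (fmap Y (leqnn b : @hom (ordcat q) b b)) by exact: is_id_same.
  have cc : is_id (fmap Y (leqnn c : @hom (ordcat q) c c)) by exact: is_id_same.
  rewrite -(gen _ _ _ _ cb ab _ _ (mm2 _ _ ca h1) bb); exact: gen cc (mm1 _ _ bd h2).
- by symmetry; exact: gen (mm2 _ _ ca h1) (mm2 _ _ db h2).
Qed.

Lemma push_equiv X Y (p p' : sd_premor Y X) n (v : chains R n Y) :
  clos_refl_sym_trans _ (@sd_rel I Y X) p p' ->
  push R (svalP p) n v = push R (svalP p') n v.
Proof.
move=> pp; elim: pp v => [{}p {}p' h|//|a b _ IH|a b c _ IH1 _ IH2] v.
- by move: v; apply: chains_ext => f; rewrite !push_sx; apply: sx_rel => i; exact: h.
- by rewrite IH.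
- by rewrite IH1 IH2.
Qed.

Definition sd_push X Y (u : sd_hom Y X) n : {linear chains R n Y -> chains R n X} :=
  push R (svalP (repr u)) n.

Lemma sd_push_pi X Y (p : sd_premor Y X) n (v : chains R n Y) :
  sd_push (\pi_(sd_hom Y X) (p : {classic _})) n v = push R (svalP p) n v.
Proof. by apply: push_equiv; have /asboolP := sd_equiv_repr (p : {classic _}). Qed.

Lemma sd_push_pi_sx X Y (p : sd_premor Y X) n (f : functor (ordcat n) (ordcat (len Y))) :
  sd_push (\pi_(sd_hom Y X) (p : {classic _})) n (sx R Y f) = sx R X (fcomp (sval p) f).
Proof. by rewrite sd_push_pi push_sx. Qed.

(** Presheaves on the opposite of the subdivision are covariant functors on the
    subdivision, and a morphism acts on simplices by composition. *)
Definition chains_psh (n : nat) : presheaf R J.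
Proof.
refine (@Presheaf R J (fun X => chains R n X) (fun X Y (u : sd_hom Y X) => sd_push u n) _ _).
- move=> X; apply: (@chains_ext _ _ _ _ _ _ (sd_push (sd_id X) n) idfun) => f.
  by rewrite /sd_id sd_push_pi_sx /= fcomp1f.
- move=> X Y Z g f.
  apply: (@chains_ext _ _ _ _ _ _ (sd_push (sd_cmp f g) n)
    ((sd_push f n : chains R n Y -> _) \o (sd_push g n : chains R n Z -> _))) => s.
  by rewrite /sd_cmp sd_push_pi_sx /= /sd_push !push_sx /= fcompA.
Defined.

Definition bd_nat (n : nat) : nattrans (chains_psh n.+1) (chains_psh n).
Proof.
refine (@NatTrans R J (chains_psh n.+1) (chains_psh n) (fun X => bd R X n) _).
by move=> X Y u m; rewrite /= /sd_push push_bd.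
Defined.

Definition aug_nat : nattrans (chains_psh 0) (const_presheaf R J).
Proof.
refine (@NatTrans R J (chains_psh 0) (const_presheaf R J) (fun X => augmentation R X) _).
by move=> X Y u m; rewrite /= /sd_push push_augment.
Defined.

Section Projective.
Variables (n : nat) (F F' : presheaf R J) (p : nattrans F F') (q : nattrans (chains_psh n) F').
Hypothesis p_epi : epi_nat p.

Lemma top_simplex_lift (Z : functor (ordcat n) I) (nd : nondegenerate Z) :
  { m : F (NDChain nd) | p (NDChain nd) m = q (NDChain nd) (sx R Z (fid (ordcat n))) }.
Proof. by apply: cid; exact: p_epi. Qed.

(** A nondegenerate simplex f of Y is the image of the top simplex of the object
    Y f under the morphism f, so a map out of the normalized chains is determined
    by its values on top simplices, and these can be prescribed: the functor is a
    sum of representable functors. *)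
Definition lift_simplex Y (f : functor (ordcat n) (ordcat (len Y))) : F Y :=
  match pselect (nondegenerate (fcomp Y f)) with
  | left nd => @psh_map R J F Y (NDChain nd)
      (\pi_(sd_hom (NDChain nd) Y) (exist _ f erefl : {classic sd_premor (NDChain nd) Y}))
      (sval (top_simplex_lift nd))
  | right _ => 0
  end.

Lemma lift_simplexE Y (Z : functor (ordcat n) I) (nd : nondegenerate Z)
    (f : functor (ordcat n) (ordcat (len Y))) (fZ : fcomp Y f = Z) :
  lift_simplex f = @psh_map R J F Y (NDChain nd)
      (\pi_(sd_hom (NDChain nd) Y) (exist _ f fZ : {classic sd_premor (NDChain nd) Y}))
      (sval (top_simplex_lift nd)).
Proof.
subst Z; rewrite /lift_simplex; case: pselect => // nd'.
by rewrite (Prop_irrelevance nd' nd).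
Qed.

Lemma lift_simplex_degenerate Y (f : functor (ordcat n) (ordcat (len Y))) :
  ~ nondegenerate (fcomp Y f) -> lift_simplex f = 0.
Proof. by rewrite /lift_simplex; case: pselect. Qed.

Lemma lift_simplex_rel Y (f g : functor (ordcat n) (ordcat (len Y))) :
  simplex_rel Y f g -> lift_simplex f = lift_simplex g.
Proof.
move=> fg; have E := simplex_rel_fcomp fg.
have [nd|nd] := pselect (nondegenerate (fcomp Y g)).
  rewrite (lift_simplexE nd E) (lift_simplexE nd erefl); congr (psh_map F _ _).
  by apply/eqP/sd_homP/rst_step.
by rewrite !lift_simplex_degenerate// E.
Qed.

Lemma chains_projective_lift : exists r : nattrans (chains_psh n) F,
  forall X m, p X (r X m) = q X m.
Proof.
pose r X : {linear chains R n X -> F X} :=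
  chains_lift (@lift_simplex_rel X) (@lift_simplex_degenerate X).
have rE X f : r X (sx R X f) = lift_simplex f by exact: chains_lift_sx.
unshelve eexists.
  refine (@NatTrans R J (chains_psh n) F r _) => X Y u.
  rewrite -[u]reprK; move: (repr u) => {}u.
  apply: (@chains_ext _ _ _ _ _ _ (r X \o sd_push (\pi_(sd_hom Y X) u) n)
    (psh_map F (\pi_(sd_hom Y X) u : @hom J X Y) \o r Y)) => f /=.
  rewrite sd_push_pi_sx !rE.
  have E : fcomp X (fcomp (sval u) f) = fcomp Y f by rewrite fcompA (svalP u).
  have [nd|nd] := pselect (nondegenerate (fcomp Y f)); last first.
    by rewrite !lift_simplex_degenerate ?linear0// E.
  rewrite (lift_simplexE nd E) (lift_simplexE nd erefl) -psh_mapM.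
  congr (psh_map F _ _); rewrite /= /sd_cmp.
  rewrite (sd_equiv_cmp (sd_equiv_repr _) (sd_equiv_repr _)).
  by congr (\pi_(sd_hom _ _) _); exact: sd_premorP.
move=> X /=.
apply: (@chains_ext _ _ _ _ _ _ (p X \o r X) (q X)) => f /=; rewrite rE.
have [nd|nd] := pselect (nondegenerate (fcomp X f)); last first.
  by rewrite lift_simplex_degenerate// (sx_degenerate R nd) !linear0.
rewrite (lift_simplexE nd erefl) nat_natural (svalP (top_simplex_lift nd)) -nat_natural.
by congr (q X _); rewrite /= sd_push_pi_sx /= fcompf1.
Qed.

End Projective.

Lemma chains_projective (n : nat) : projective (chains_psh n).
Proof. by move=> F F' p q; exact: chains_projective_lift. Qed.

Definition chains_resolution : proj_resolution (const_presheaf R J).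
Proof.
refine (@ProjResolution R J (const_presheaf R J) chains_psh bd_nat aug_nat
  chains_projective _ _ _).
- by move=> X c; exists ((c : C) *: sx R X (vertex0 _)); rewrite /= linearZ_LR augment_sx; exact: mulr1.
- move=> X m; split=> /= [m0|[m' <-]]; last exact: augment_bd.
  by exists (cone_map R X 0 m); rewrite bd_cone0 m0 scale0r subr0.
- move=> n X m; split=> /= [m0|[m' <-]]; last exact: bd_bd.
  by exists (cone_map R X n.+1 m); rewrite bd_cone m0 linear0 subr0.
Defined.

(** A nondegenerate simplex f of X is the image of the top simplex of X f under a
    morphism that is not invertible, as the lengths differ. *)
Lemma chains_split_zero n X : n <> len X ->
  forall m : chains R n X, m \in gen_submod (@split_image R J X (chains_psh n)).
Proof.
move=> nX m; elim/chains_ind: m => [|u v uS vS|c f]; first exact: rpred0.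
  exact: rpredD.
apply: rpredZ; have [nd|nd] := pselect (nondegenerate (fcomp X f)); last first.
  by rewrite (sx_degenerate R nd) rpred0.
apply/asboolP => S; apply.
pose u : sd_hom (NDChain nd) X :=
  \pi_(sd_hom (NDChain nd) X) (exist _ f erefl : {classic sd_premor (NDChain nd) X}).
exists (NDChain nd), u, (sx R (NDChain nd) (fid (ordcat n))); split.
  by move=> /sd_invertibleP /= Xn; apply: nX.
by rewrite /= sd_push_pi_sx /= fcompf1.
Qed.

Section Top.
Variable X : ndchain I.
Local Notation n := (len X).

Definition top_coef (f : functor (ordcat n) (ordcat n)) : C^o :=
  (`[< nondegenerate (fcomp X f) >])%:R.

Lemma top_coef_rel f g : simplex_rel X f g -> top_coef f = top_coef g.
Proof. by move=> fg; rewrite /top_coef (simplex_rel_fcomp fg). Qed.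

Lemma top_coef_degenerate f : ~ nondegenerate (fcomp X f) -> top_coef f = 0.
Proof. by move=> fd; rewrite /top_coef; case: asboolP. Qed.

(** In degree len X the top simplex is the only nondegenerate simplex of X, and
    this form is its coordinate. *)
Definition top_form : {linear chains R n X -> C^o} :=
  chains_lift top_coef_rel top_coef_degenerate.

Definition top_simplex : chains R n X := sx R X (fid (ordcat n)).

Lemma top_form_top : top_form top_simplex = 1.
Proof.
rewrite [LHS]chains_lift_sx /top_coef; case: asboolP => // -[].
by rewrite fcompf1; exact: ndchainP.
Qed.

Lemma top_simplex_spans m : m = top_form m *: top_simplex.
Proof.
elim/chains_ind: m => [|u v uE vE|c f].
- by rewrite linear0 scale0r.
- by rewrite linearD scalerDl -uE -vE.
- rewrite linearZ_LR -[RHS]scalerA; congr (_ *: _).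
  rewrite chains_lift_sx /top_coef; case: asboolP => fd.
    rewrite scale1r; congr (sx R X _); apply: ordcat_functor_ext => i; apply: val_inj => /=.
    exact: (nondegenerate_id _ fd).
  by rewrite scale0r (sx_degenerate R fd).
Qed.

Lemma top_form_split Y (u : @hom J X Y) (m : chains R n Y) :
  ~ invertible u -> top_form (sd_push u n m) = 0.
Proof.
move=> uN; elim/chains_ind: m => [|v w vE wE|c f].
- by rewrite !linear0.
- by rewrite !linearD vE wE addr0.
- rewrite !linearZ_LR /sd_push push_sx chains_lift_sx top_coef_degenerate ?scaler0//.
  rewrite fcompA (svalP (repr u)) => nd; apply: uN; apply/sd_invertibleP.
  by apply/eqP; rewrite eqn_leq (sd_hom_len u) (nondegenerate_len nd).
Qed.

End Top.

Lemma chains_betti X (n : nat) : l2_betti chains_resolution X n = (n == len X)%:R%:E.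
Proof.
have z k : k <> len X -> forall t : TS (X : J) (chains_psh k), t = 0.
  by move=> kX; apply: TS_zero; exact: chains_split_zero.
have [nX|/eqP nX] := eqVneq n (len X); last first.
  apply: vN_dim_zero => h; exact: (homology_zero (z _ nX)).
rewrite nX; have aut1 := @sd_aut1 I X.
pose g0 := @TS_gen R J X (chains_psh (len X)) (top_simplex X).
have gen t : exists c, t = c *: g0.
  apply: (@TS_gen_line R J X (chains_psh (len X)) (top_simplex X) (top_form X)) => m.
  by rewrite {1}(top_simplex_spans m) subrr rpred0.
have free c : c *: g0 = 0 -> c = 0.
  apply: (@TS_gen_free R J X (chains_psh (len X)) aut1 (top_simplex X) (top_form X)).
    exact: top_form_split.
  exact: top_form_top.
have [h [h1 h2]] := @homology_line _ _ (fun k => @TS_map R J X _ _ (bd_nat k)) (len X) g0 z gen free.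
exact: (vN_dim_line aut1 h1 h2).
Qed.

End SubdivisionResolution.

(** * Counting nondegenerate chains *)

Lemma finite_enum (T : choiceType) (A : set T) : finite_set A ->
  exists s : seq T, uniq s /\ forall x, (x \in s) <-> A x.
Proof.
move=> Afin; exists (fset_set A); split; first exact: fset_uniq.
by move=> x; rewrite in_fset_set//; split=> [/set_mem|/mem_set].
Qed.

Lemma arr_fmap (C D : category) (F : functor C D) (x y x' y' : C)
  (f : @hom C x y) (g : @hom C x' y') : arr f = arr g -> arr (fmap F f) = arr (fmap F g).
Proof. by move=> /(congr1 (fun a : arrow C => arr (fmap F (projT2 (projT2 a))))). Qed.

Section ConsChain.
Variables (I : category) (n : nat) (Z : chain n I) (x : I) (f : @hom I x (Z ord0)).

Definition cons_ob (i : 'I_n.+2) : I :=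
  match i with
  | @Ordinal _ m p =>
    match m return (m < n.+2)%N -> I with
    | 0 => fun=> x
    | k.+1 => fun p => Z (@Ordinal n.+1 k p)
    end p
  end.

Definition cons_hom (i j : 'I_n.+2) (ij : (i <= j)%N) : @hom I (cons_ob i) (cons_ob j).
Proof.
case: i j ij => [[|k] p] [[|l] r] //= ij.
- exact: idm.
- exact: cmp (fmap Z (leq0n l : @hom (ordcat n) ord0 (Ordinal (r : (l < n.+1)%N)))) f.
- exact (@fmap _ _ Z (Ordinal (p : (k < n.+1)%N)) (Ordinal (r : (l < n.+1)%N)) ij).
Defined.

Definition cons_chain : chain n.+1 I.
Proof.
refine (@Functor (ordcat n.+1) I cons_ob cons_hom _ _).
- by case=> [[|k] p] //=; rewrite -fmap1; congr fmap; exact: bool_irrelevance.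
- move=> [[|i] p] [[|j] r] [[|k] s] g h //=; rewrite ?cmpm1 //.
  + by rewrite cmpA -fmapM; congr (cmp (fmap Z _) f); exact: bool_irrelevance.
  + by rewrite -fmapM; congr fmap; exact: bool_irrelevance.
Defined.

Lemma cons_chain_tail : fcomp cons_chain (coface ord0) = Z.
Proof.
apply: functor_ext => -[i p] [j r] ij.
transitivity (arr (@fmap _ _ cons_chain (Ordinal (p : (i.+1 < n.+2)%N)) (Ordinal (r : (j.+1 < n.+2)%N)) ij)).
  by apply: (arr_fmap cons_chain); apply: ordcat_arr; exact: val_inj.
by [].
Qed.

Definition step01 : @hom (ordcat n.+1) ord0 (fintype.lift ord0 ord0) := leq0n _.

Lemma cons_chain_head : arr (fmap cons_chain step01) = arr f.
Proof.
transitivity (arr (cmp (fmap Z (leq0n 0 : @hom (ordcat n) ord0 (Ordinal (ltn0Sn n)))) f)).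
  transitivity (arr (@fmap _ _ cons_chain ord0 (Ordinal (ltn0Sn n : (1 < n.+2)%N)) (leq0n 1))).
    by apply: (arr_fmap cons_chain); apply: ordcat_arr => //; exact: val_inj.
  by [].
apply: arr_cmp_idl; apply: is_id_same; exact: val_inj.
Qed.

Lemma cons_chain_nondegenerate : nondegenerate cons_chain <-> nondegenerate Z /\ ~ is_id f.
Proof.
split=> [nd|[nd fN]].
  split=> [i j ij ji Zid|fid].
    have ij' : (fintype.lift ord0 i <= fintype.lift ord0 j)%N by exact: lift_mono.
    apply: (nd _ _ ij'); first by rewrite /= /bump ji.
    apply: is_id_arr Zid; transitivity (arr (fmap (fcomp cons_chain (coface ord0)) ij)).
      by rewrite cons_chain_tail.
    by apply: (arr_fmap cons_chain); exact: ordcat_arr.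
  apply: (nd _ _ step01) => //; apply: is_id_arr fid; exact/esym/cons_chain_head.
move=> [[|i] p] [[|j] r] ij //= ji; last first.
  by apply: nd; case: ji.
case: j r ij ji => // r ij _ cid; apply: fN; apply: is_id_arr cid.
by apply: arr_cmp_idl; apply: is_id_same; exact: val_inj.
Qed.

End ConsChain.

Lemma cons_chainK (I : category) (n : nat) (X : chain n.+1 I) :
  X = cons_chain (Z := fcomp X (coface ord0)) (fmap X (step01 n)).
Proof.
apply: functor_ext => -[[|i] p] [[|j] r] ij //=.
- transitivity (arr (fmap X (idm (ord0 : ordcat n.+1)))); last by rewrite fmap1.
  by apply: arr_fmap; apply: ordcat_arr; exact: val_inj.
- rewrite -fmapM; apply: arr_fmap; apply: ordcat_arr; exact: val_inj.
- by apply: arr_fmap; apply: ordcat_arr; exact: val_inj.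
Qed.

Section Counting.
Variable I : category.
Hypothesis finI : finite_category I.

Definition into (y : I) := {x : I & @hom I x y}.

Lemma finite_into (y : I) : finite_set [set f : {classic into y} | ~ is_id (projT2 f)].
Proof.
apply: (@sub_finite_set _ _ (\bigcup_(x in [set: I]) ((fun f : @hom I x y => existT _ x f : into y) @` setT))).
  by move=> [x f] _; exists x => //; exists f.
apply: bigcup_finite; first exact: finI.1.
by move=> x _; apply: finite_image; exact: finI.2.
Qed.

Definition nonid_into (y : I) : seq {classic into y} := sval (cid (finite_enum (finite_into y))).

Lemma nonid_intoP y : uniq (nonid_into y) /\
  forall f : {classic into y}, (f \in nonid_into y) <-> ~ is_id (projT2 f).
Proof. exact: (svalP (cid (finite_enum (finite_into y)))). Qed.

Definition objects : seq {classic I} := sval (cid (@finite_enum {classic I} setT finI.1)).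

Lemma objectsP : uniq objects /\ forall x : {classic I}, x \in objects.
Proof.
have [h1 h2] := svalP (cid (@finite_enum {classic I} setT finI.1)).
by split=> // x; apply/h2.
Qed.

Definition point_chain (x : I) : chain 0 I :=
  @Functor (ordcat 0) I (fun=> x) (fun _ _ _ => idm x) (fun=> erefl)
    (fun _ _ _ _ _ => esym (cmp1m (idm x))).

Let into_eq n (Z : {classic chain n I}) : eqType := {classic into ((Z : chain n I) ord0)}.

Fixpoint nd_chains n : seq {classic chain n I} :=
  match n return seq {classic chain n I} with
  | 0 => [seq (point_chain x : {classic chain 0 I}) | x <- objects]
  | m.+1 => [seq (cons_chain (projT2 f) : {classic chain m.+1 I}) |
      Z <- nd_chains m, f <- nonid_into ((Z : chain m I) ord0)]
  end.

Lemma chain0E (X : chain 0 I) : X = point_chain (X ord0).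
Proof.
apply: functor_ext => i j ij /=; transitivity (arr (fmap X (idm (ord0 : ordcat 0)))).
  by apply: arr_fmap; apply: ordcat_arr; apply: val_inj; [case: i ij => [[]]|case: j ij => [[]]].
by rewrite fmap1.
Qed.

Let nd_chainsP n (X : {classic chain n.+1 I}) := @allpairsPdep {classic chain n I} (@into_eq n)
  {classic chain n.+1 I} (fun Z f => cons_chain (projT2 f)) (nd_chains n)
  (fun Z => nonid_into ((Z : chain n I) ord0)) X.

Lemma mem_nd_chains n (X : {classic chain n I}) : (X \in nd_chains n) <-> nondegenerate X.
Proof.
elim: n X => [|n IH] X.
  split=> [_ [[|i] //] ip [[|j] //] jp //|_].
  rewrite [X]chain0E; apply: (map_f (fun x : {classic I} => (point_chain x : {classic chain 0 I}))).
  exact: objectsP.2.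
split.
  move=> /nd_chainsP[Z [f [ZL fN ->]]]; apply/cons_chain_nondegenerate; split.
    exact/IH.
  exact: ((nonid_intoP _).2 f).1.
move=> nd; have E := cons_chainK X.
have [ndZ ndf] : nondegenerate (fcomp X (coface ord0)) /\ ~ is_id (fmap X (step01 n)).
  by apply/cons_chain_nondegenerate; rewrite -E.
apply/nd_chainsP; exists (fcomp X (coface ord0)), 
  (existT (fun x => @hom I x (X (fintype.lift ord0 ord0))) _ (fmap X (step01 n))); split => //.
  exact/IH.
exact: ((nonid_intoP _).2 _).2.
Qed.

Lemma uniq_nd_chains n : uniq (nd_chains n).
Proof.
elim: n => [|n IH] /=.
  have inj : injective (fun x : {classic I} => (point_chain x : {classic chain 0 I})).
    by move=> x y /(congr1 (fun X : chain 0 I => X ord0)).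
  by have := map_inj_uniq inj objects; rewrite objectsP.1 => h; exact: h.
apply: (@allpairs_uniq_dep {classic chain n I} (@into_eq n) {classic chain n.+1 I}) => //.
  by move=> Z _; exact: (nonid_intoP _).1.
move=> [Z [x f]] [Z' [x' f']] _ _ /= E.
have ZZ : Z = Z' by rewrite -(cons_chain_tail f) -(cons_chain_tail f') E.
subst Z'; have ff : arr f = arr f'.
  by rewrite -(cons_chain_head f) -(cons_chain_head f') E.
have xx := congr1 (@projT1 _ _) ff; rewrite /= in xx; subst x'.
by rewrite (arr_inj ff).
Qed.

Lemma nd_chains_finite n : finite_set [set X : {classic chain n I} | nondegenerate X].
Proof.
apply: (@sub_finite_set _ _ [set` nd_chains n]); last exact: finite_seq.
by move=> X /mem_nd_chains.
Qed.

Lemma size_nd_chains n : num_nondegenerate I n = size (nd_chains n).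
Proof.
rewrite /num_nondegenerate; apply/perm_size/uniq_perm.
- exact: fset_uniq.
- exact: uniq_nd_chains.
- move=> X; rewrite in_fset_set; last exact: nd_chains_finite.
  by apply/idP/idP => [/set_mem/mem_nd_chains|/mem_nd_chains/mem_set].
Qed.

Definition weight n (phi : I -> rat) : rat := \sum_(Z <- nd_chains n) phi ((Z : chain n I) ord0).

Definition transfer (phi : I -> rat) (y : I) : rat := \sum_(f <- nonid_into y) phi (projT1 f).

(** Summing over the first morphism turns a weight on the first object into its
    transfer, so the numbers of chains are matrix coefficients of powers. *)
Lemma weightS n phi : weight n.+1 phi = weight n (transfer phi).
Proof. by rewrite /weight /= big_allpairs_dep. Qed.

Lemma weight1 n : weight n (fun=> 1) = (num_nondegenerate I n)%:R.
Proof. by rewrite size_nd_chains /weight big_const_seq count_predT iter_addr_0. Qed.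

Lemma num_nondegenerate_growth : exists c K : nat, (0 < K)%N /\
  forall n, (num_nondegenerate I n <= c * K ^ n)%N.
Proof.
pose K := (\sum_(y <- objects) size (nonid_into y)).+1.
exists (num_nondegenerate I 0), K; split => //; elim=> [|n IH]; first by rewrite expn0 muln1.
rewrite expnSr mulnA; apply: leq_trans (leq_mul IH (leqnn K)).
rewrite !size_nd_chains /= size_allpairs_dep sumnE big_map.
rewrite -sum1_size big_distrl /= leq_sum// => Z _; rewrite mul1n /K.
apply: leqW; rewrite (bigD1_seq ((Z : chain n I) ord0 : {classic I}))/=; first exact: leq_addr.
  exact: objectsP.2.
exact: objectsP.1.
Qed.

Section Transfer.
Variables (k : nat) (x0 : {classic I}).
Hypothesis sz : size objects = k.+1.

Definition obj_index (x : I) : 'I_k.+1 := inord (index (x : {classic I}) objects).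

Lemma obj_indexK (x : I) : nth x0 objects (obj_index x) = x.
Proof.
rewrite inordK ?nth_index//; first exact: objectsP.2.
by rewrite -sz index_mem; exact: objectsP.2.
Qed.

Definition transfer_mx : 'M[rat]_k.+1 := \matrix_(i, j)
  \sum_(f <- nonid_into (nth x0 objects j : I)) (obj_index (projT1 f) == i)%:R.

Definition row_fun (v : 'rV[rat]_k.+1) (x : I) : rat := v 0 (obj_index x).

Lemma transfer_row_fun v : transfer (row_fun v) = row_fun (v *m transfer_mx).
Proof.
apply/funext => y; rewrite /row_fun mxE; under eq_bigr do rewrite mxE mulr_sumr.
rewrite exchange_big /= obj_indexK; apply: eq_bigr => f _.
rewrite (bigD1 (obj_index (projT1 f)))//= eqxx mulr1 big1 ?addr0// => i iN.
by rewrite eq_sym (negbTE iN) mulr0.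
Qed.

Definition start_form (v : 'rV[rat]_k.+1) : rat := weight 0 (row_fun v).

Lemma start_form_linear : linear (start_form : _ -> rat^o).
Proof.
move=> a u v; rewrite /start_form /weight scaler_sumr -big_split /=.
by apply: eq_bigr => Z _; rewrite /row_fun !mxE.
Qed.

Lemma num_nondegenerate_mx n :
  (num_nondegenerate I n)%:R = start_form (const_mx 1 *m transfer_mx ^+ n).
Proof.
rewrite -weight1; have -> : (fun=> 1) = row_fun (const_mx 1) :> (I -> rat).
  by apply/funext => x; rewrite /row_fun mxE.
elim: n (const_mx 1) => [|n IH] v; first by rewrite expr0 mulmx1.
by rewrite weightS transfer_row_fun IH exprS mulmxA.
Qed.

(** The Cayley-Hamilton theorem for the transfer matrix. *)
Lemma num_nondegenerate_rec n : let p := char_poly transfer_mx in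
  \sum_(i < k.+2) p`_i * (num_nondegenerate I (i + n))%:R = 0.
Proof.
move=> p.
pose L : {linear 'rV[rat]_k.+1 -> rat^o} :=
  HB.pack start_form (GRing.isLinear.Build _ _ _ _ _ start_form_linear).
have : L (const_mx 1 *m (horner_mx transfer_mx p *m transfer_mx ^+ n)) = 0.
  by rewrite Cayley_Hamilton mul0mx mulmx0 linear0.
have -> : horner_mx transfer_mx p = \sum_(i < k.+2) p`_i *: transfer_mx ^+ i.
  have szp : size p = k.+2 by rewrite size_char_poly.
  rewrite -{1}[p]coefK poly_def szp rmorph_sum; apply: eq_bigr => i _.
  by rewrite /= horner_mxZ rmorphXn /= horner_mx_X.
rewrite mulmx_suml mulmx_sumr linear_sum => E; rewrite -[RHS]E; apply: eq_bigr => i _.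
by rewrite -scalemxAl -scalemxAr linearZ /= num_nondegenerate_mx exprD.
Qed.

End Transfer.

(** The recurrence makes the product of the generating function with the reversed
    characteristic polynomial h a polynomial; h has constant coefficient 1. *)
Lemma num_nondegenerate_rational : exists g h : {poly rat},
  represents g h (fun n => (num_nondegenerate I n)%:R).
Proof.
case E : objects => [|x0 s].
  exists 0, 1; split; first exact: oner_neq0.
  have a0 n : num_nondegenerate I n = 0%N.
    by rewrite size_nd_chains; elim: n => [|n] /=; [rewrite E|case: (nd_chains n)].
  by move=> n; rewrite coef0 /convol big1// => i _; rewrite a0 mulr0.
have sz : size objects = (size s).+1 by rewrite E.
set k := size s in sz.
have := num_nondegenerate_rec x0 sz; set p := char_poly _ => rec.
have szp : size p = k.+2 by rewrite size_char_poly.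
pose h := \poly_(j < k.+2) p`_(k.+1 - j).
have hE j : h`_j = if (j < k.+2)%N then p`_(k.+1 - j) else 0 by rewrite coef_poly.
exists (\poly_(m < k.+1) convol h (fun n => (num_nondegenerate I n)%:R) m), h; split.
  apply/eqP => /(congr1 (fun q : {poly rat} => q`_0)); rewrite hE coef0 subn0 /=.
  have := char_poly_monic (transfer_mx k x0); rewrite monicE lead_coefE szp /= => /eqP ->.
  by move/eqP; rewrite oner_eq0.
move=> n; rewrite coef_poly; case: ltnP => // kn.
rewrite /convol -(big_mkord xpredT (fun i => h`_i * (num_nondegenerate I (n - i))%:R)).
rewrite (big_cat_nat _ (n := k.+2))//= [X in _ + X]big_nat_cond [X in _ + X]big1 ?addr0; last first.
  by move=> i /andP[/andP[ki _] _]; rewrite hE ltnNge ki mul0r.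
rewrite big_mkord (reindex_inj rev_ord_inj) /= -[RHS](rec (n - k.+1)%N).
apply: eq_bigr => i _; rewrite subSS hE; have ik : (i <= k.+1)%N by rewrite -ltnS.
rewrite ltnS leq_subr subKn//; congr (_ * (num_nondegenerate I _)%:R).
by move: ik kn; lia.
Qed.

End Counting.

(** * The main theorem *)

Section BettiSum.
Variables (R : realType) (I : category).
Hypothesis finI : finite_category I.
Local Notation J := (op_cat (Sd I)).

Lemma repr_iso_class (Y : ndchain I) : repr (\pi_(iso_class J) (Y : {classic J})) = Y.
Proof. by apply: sd_isomorphic; rewrite -eqmodE; apply/eqP; rewrite reprK. Qed.

Lemma ndchain_inj n (X X' : chain n I) (nd : nondegenerate X) (nd' : nondegenerate X') :
  NDChain nd = NDChain nd' -> X = X'.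
Proof.
move=> /(congr1 (fun Y : ndchain I => existT (fun n => functor (ordcat n) I) (len Y) Y)).
by apply: inj_pair2_eq_dec => m k; exact: pselect.
Qed.

Definition class_of n (t : {classic {X : chain n I | nondegenerate X}}) : iso_class J :=
  \pi_(iso_class J) (NDChain (svalP t) : {classic J}).

(** Isomorphic objects of the subdivision are equal, so the isomorphism classes are
    the nondegenerate chains, and those of length n contribute 1 each. *)
Lemma l2_hE (P : proj_resolution (const_presheaf R J)) n :
  l2_h P n = ((num_nondegenerate I n)%:R)%:E.
Proof.
have E1 : l2_h P n = (\esum_(c in [set c : iso_class J | len (repr c : ndchain I) = n]) 1)%E.
  rewrite esum_mkcond; apply: eq_esum => c _.
  rewrite (l2_betti_eq P (chains_resolution R I)) chains_betti eq_sym.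
  have [cn|cn] := eqVneq (len (repr c : ndchain I)) n; first by rewrite mem_set.
  by rewrite memNset//= => /eqP; rewrite (negbTE cn).
have E2 : (\esum_(c in [set c : iso_class J | len (repr c : ndchain I) = n]) 1 =
    \esum_(t in [set: {classic {X : chain n I | nondegenerate X}}]) (1 : \bar R))%E.
  apply: (reindex_esum _ _ (@class_of n)); split.
  - by move=> t _ /=; rewrite /class_of repr_iso_class.
  - move=> [X nd] [X' nd'] _ _ /(congr1 repr); rewrite /class_of !repr_iso_class => /ndchain_inj /= XX.
    by apply: eq_exist.
  - move=> c /= cn; move: (repr_iso_class (repr c)) cn; rewrite reprK.
    case E : (repr c) => [m X nd] _ /= mn; subst m.
    exists (exist _ X nd) => //; rewrite /class_of /=.
    by rewrite -[RHS]reprK E; congr (\pi_(iso_class J) _); congr NDChain; exact: Prop_irrelevance.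
have E3 : (\esum_(X in [set X : {classic chain n I} | nondegenerate X]) (1 : \bar R) =
    \esum_(t in [set: {classic {X : chain n I | nondegenerate X}}]) 1)%E.
  apply: (reindex_esum _ _ (fun t : {classic {X : chain n I | nondegenerate X}} => (sval t : {classic chain n I}))); split.
  - by move=> t _ /=; exact: (svalP t).
  - by move=> [X nd] [X' nd'] _ _ /= XX; apply: eq_exist.
  - by move=> X nd; exists (exist _ X nd).
rewrite E1 E2 -E3 esum_fset; [|exact: nd_chains_finite|by move=> X _; exact: lee01].
rewrite fsbig_finite; last exact: nd_chains_finite.
rewrite /= /num_nondegenerate sumEFin big_const_seq count_predT iter_addr_0.
by [].
Qed.

End BettiSum.

Section RationalFunctions.
Variables (R : realType) (a : nat -> nat).
Local Notation C := (R[i]).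
Local Notation toC := (map_poly (ratr : rat -> C)).

Lemma represents_complex (g h : {poly rat}) : represents g h (fun n => (a n)%:R) ->
  represents (toC g) (toC h) (fun n => ((a n)%:R : R)%:C%C).
Proof.
move=> [h0 gh]; split; first by rewrite map_poly_eq0.
move=> n; rewrite coef_map /= -gh rmorph_sum; apply: eq_bigr => i _.
by rewrite coef_map /= rmorphM /= !rmorph_nat.
Qed.

Lemma toC_N1 (g : {poly rat}) : (toC g).[-1] = ratr g.[-1].
Proof. by rewrite -horner_map /= rmorphN1. Qed.

End RationalFunctions.

Theorem mainTheorem2 (R : realType) (I : category) (finI : finite_category I) :
  ((exists v : R[i], is_chi2_ex (op_cat (Sd I)) v) <->
   (exists q : rat, is_chi_sum I q)) /\
  (forall (q : rat) (v : R[i]),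
     is_chi_sum I q -> is_chi2_ex (op_cat (Sd I)) v -> ratr q = v).
Proof.
pose u n : R := (num_nondegenerate I n)%:R.
have hE (P : proj_resolution (const_presheaf R (op_cat (Sd I)))) :
    (fun n => fine (l2_h P n)) = u.
  by apply/funext => n; rewrite l2_hE.
have to_cont (v : R[i]) : is_chi2_ex (op_cat (Sd I)) v -> continuation_value u v.
  by move=> [P [_]]; rewrite hE.
have rep (g h : {poly rat}) : (forall n, \sum_(i < n.+1) h`_i * (num_nondegenerate I (n - i))%:R = g`_n) ->
    h.[-1] != 0 -> represents g h (fun n => (num_nondegenerate I n)%:R).
  by move=> gh h1; split=> //; apply: contraNneq h1 => ->; rewrite horner0.
split; first split.
- move=> [v /to_cont cv].
  have [g [h gh]] := num_nondegenerate_rational finI.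
  have [g' [h' [gh' co]]] := represents_reduce1 (-1) gh.
  have := continuation_value_eq (represents_complex R gh') cv; rewrite !toC_N1 => E.
  have h1 : h'.[-1] != 0.
    apply/eqP => h0; move: co; rewrite h0 eqxx orbF => /negP; apply.
    by move: E; rewrite h0 rmorph0 mul0r => /esym/eqP; rewrite fmorph_eq0.
  by exists (g'.[-1] / h'.[-1]), g', h'; split => //; case: gh'.
- move=> [q [g [h [h1 gh _]]]].
  have := represents_complex R (rep g h gh h1) => ghC.
  have h1C : (map_poly (ratr : rat -> R[i]) h).[-1] != 0 by rewrite toC_N1 fmorph_eq0.
  have [g' [h' [r1 r2 r3 r4]]] := represents_reduce ghC h1C.
  have [c [K [K0 cK]]] := num_nondegenerate_growth finI.
  exists (g'.[-1] / h'.[-1]), (chains_resolution R I); split.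
    by move=> n; rewrite l2_hE.
  rewrite hE; apply: (represents_continuation (c := c%:R) (K := K%:R) r1 r2 r3) => //.
    by rewrite ltr0n.
  by move=> n; rewrite /u normr_nat -natrX -natrM ler_nat.
- move=> q v [g [h [h1 gh ->]]] /to_cont cv.
  have := continuation_value_eq (represents_complex R (rep g h gh h1)) cv.
  rewrite !toC_N1 => E; rewrite fmorph_div /= -E mulrC mulKf// fmorph_eq0//.
Qed.
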